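(* Let $k\in\mathbb C$. For $\ell\in\mathbb Z$ and $[\nu]\in\mathbb R/\mathbb Z$, the character $$\mathrm{ch}[\Pi^\ell_{[\nu]}](\zeta_a,\zeta_d;\tau)=\frac{\mathrm e^{2\pi\mathrm i\zeta_a(\ell-1)}\,\mathrm e^{-2\pi\mathrm ik\ell\tau/3}}{\eta(\tau)^2}\sum_{n\in\mathbb Z}\mathrm e^{2\pi\mathrm in\nu}\,\delta(2\zeta_d+\ell\tau-n)$$ of the irreducible $\Pi$-module $\Pi^\ell_{[\nu]}$ has S-transform $$\mathrm{ch}[\Pi^\ell_{[\nu]}]\Big(\frac{\zeta_a}\tau,\frac{\zeta_d}\tau;-\frac1\tau\Big)=A(\zeta_a,\zeta_d;\tau)\sum_{\ell'\in\mathbb Z}\int_{\mathbb R/\mathbb Z}\mathsf S^{\Pi}_{(\ell,\nu),(\ell',\nu')}\,\mathrm{ch}[\Pi^{\ell'}_{[\nu']}](\zeta_a,\zeta_d;\tau)\,\mathrm d[\nu'],$$ where $$\mathsf S^{\Pi}_{(\ell,\nu),(\ell',\nu')}=\mathrm e^{2\pi\mathrm i(\ell+\ell')k/3}\,\mathrm e^{-2\pi\mathrm i(\ell\nu'+\ell'\nu)}$$ and the automorphy factor is $$A(\zeta_a,\zeta_d;\tau)=\frac{|\tau|}{-\mathrm i\tau}\,\mathrm e^{4\pi\mathrm i\zeta_a\zeta_d/\tau}\,\mathrm e^{2\pi\mathrm i\zeta_a(\tau-1)/\tau}\,\mathrm e^{-4\pi\mathrm ik\zeta_d(\tau-1)/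3\tau}.$$
   Context: $\Pi$ is the lattice-type vertex algebra generated by Heisenberg fields $a,d$ with $a(z)a(w)\sim0\sim d(z)d(w)$, $a(z)d(w)\sim\frac{2}{(z-w)^2}$, and vertex operators $\mathrm e^{ma}$, $m\in\mathbb Z$, with $a(z)\mathrm e^{ma}(w)\sim0$, $\mathrm e^{ma}(z)\mathrm e^{m'a}(w)\sim0$, $d(z)\mathrm e^{ma}(w)\sim\frac{2m\,\mathrm e^{ma}(w)}{z-w}$. Its conformal vector is $T^\Pi=\frac12{:}ad{:}+\frac k3\partial a-\frac12\partial d$, of central charge $c_\Pi=8k+2$. $\Pi^\ell_{[\nu]}$ is the $\Pi$-module generated by $\mathrm e^{\nu a+(\ell-1)d/2}$, i.e. the direct sum over $\lambda\in[\nu]$ of the Heisenberg Fock spaces generated by $\mathrm e^{\lambda a+(\ell-1)d/2}$. Its character is $\mathrm{tr}\,\mathrm z_a^{a_0}\mathrm z_d^{d_0}\mathrm q^{T^\Pi_0-c_\Pi/24}$ with $\mathrm z_a=\mathrm e^{2\pi\mathrm i\zeta_a}$, $\mathrm z_d=\mathrm e^{2\pi\mathrm i\zeta_d}$, $\mathrm q=\mathrm e^{2\pi\mathrm i\tau}$, $\mathrm{Im}\,\tau>0$. $\eta$ is the Dedekind eta function. $\delta$ is the Dirac delta function, related to formal power series by $\sum_{n\in\mathbb Z}\mathrm e^{2\pi\mathrm i xn}=\sum_{n\in\mathbb Z}\delta(x-n)$; expressions $\delta(2\zeta_d+\ell\tau-n)$ are treated formally (a coefficient function multiplying such a delta may be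 evaluated on the support $2\zeta_d=n-\ell\tau$, and $\delta(x/\tau)=|\tau|\,\delta(x)$). *)

(* Defs.v *)
From Stdlib Require Import Reals ZArith List.
From Coquelicot Require Import Coquelicot.
Open Scope C_scope.

Definition ZtoC (n : Z) : C := RtoC (IZR n).

Definition Cexp (z : C) : C :=
  RtoC (exp (Re z)) * (cos (Im z), sin (Im z)).

Definition cis2pi (z : C) : C := Cexp (2 * PI * Ci * z).

Definition CSeries (u : nat -> C) : C :=
  (Series (fun n => Re (u n)), Series (fun n => Im (u n))).

Definition CLim (u : nat -> C) : C :=
  (real (Lim_seq (fun n => Re (u n))), real (Lim_seq (fun n => Im (u n)))).

Definition ZSeries (u : Z -> C) : C :=
  CSeries (fun n => u (Z.of_nat n)) +
  CSeries (fun n => u (- Z.of_nat (S n))%Z).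

Definition list_sum {J : Type} (f : J -> C) (L : list J) : C :=
  fold_right (fun j s => f j + s) (RtoC 0) L.

(* Unconditional (equivalently, absolute) convergence over any index type. *)
Definition has_sum {J : Type} (f : J -> C) (s : C) : Prop :=
  forall eps : R, (0 < eps)%R -> exists L0 : list J,
  forall L : list J, NoDup L -> incl L0 L ->
    (Cmod (list_sum f L - s) < eps)%R.

Fixpoint euler_prod (q : C) (n : nat) : C :=
  match n with
  | O => 1
  | S m => euler_prod q m * (1 - q ^ S m)
  end.

Definition dedekind_eta (tau : C) : C :=
  cis2pi (tau / 24) * CLim (euler_prod (cis2pi tau)).

(* A [state] is the monomial
     prod_p a_{-p}^(occ_a p) d_{-p}^(occ_d p) e^{lam a + (l-1) d/2};
   the weight l is a parameter of the operators below.  A [vec] is the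
   family of coefficients of a combination of such monomials. *)
Record state : Type := State {
  lam : R;
  occ_a : positive -> nat;
  occ_d : positive -> nat
}.

Definition vec : Type := state -> C.
Definition op : Type := vec -> vec.

Definition finite_occ (mu : positive -> nat) : Prop :=
  exists N : positive, forall p, (N < p)%positive -> mu p = O.

Definition in_coset (nu x : R) : Prop := exists n : Z, x = (nu + IZR n)%R.

(* The underlying space of Pi^l_[nu]: the direct sum over x in [nu] of the
   Fock spaces of e^{x a + (l-1) d/2}.  It depends on nu only modulo 1, and on
   l only through the action. *)
Definition in_Pi (nu : R) (g : vec) : Prop :=
  exists L : list state,
    (forall s, In s L ->
       in_coset nu (lam s) /\ finite_occ (occ_a s) /\ finite_occ (occ_d s)) /\
    (forall s, g s <> 0 -> In s L).

Definition vadd (g h : vec) : vec := fun s => g s + h s.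
Definition vscal (c : C) (g : vec) : vec := fun s => c * g s.

Definition upd (mu : positive -> nat) (p : positive) (v : nat) :
    positive -> nat :=
  fun r => if Pos.eqb r p then v else mu r.

Definition set_a (s : state) (p : positive) (v : nat) : state :=
  State (lam s) (upd (occ_a s) p v) (occ_d s).
Definition set_d (s : state) (p : positive) (v : nat) : state :=
  State (lam s) (occ_a s) (upd (occ_d s) p v).

(* [a_m, d_n] = 2 m delta_{m+n,0}: for p > 0, a_{-p} and d_{-p} multiply by
   the corresponding variables, a_p = 2 p (d/d d_{-p}) and
   d_p = 2 p (d/d a_{-p}), read off on coefficients. *)
Definition mode_a (l : Z) (n : Z) : op := fun g s =>
  match n with
  | Z0 => ZtoC (l - 1) * g s
  | Zpos p =>
      ZtoC (2 * Zpos p) * INR (S (occ_d s p)) * g (set_d s p (S (occ_d s p)))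
  | Zneg p =>
      match occ_a s p with O => RtoC 0 | S v => g (set_a s p v) end
  end.

Definition mode_d (n : Z) : op := fun g s =>
  match n with
  | Z0 => 2 * lam s * g s
  | Zpos p =>
      ZtoC (2 * Zpos p) * INR (S (occ_a s p)) * g (set_a s p (S (occ_a s p)))
  | Zneg p =>
      match occ_d s p with O => RtoC 0 | S v => g (set_d s p v) end
  end.

(* For commuting operators x_1, x_2, ..., [exp_coeff c x j j] is the
   coefficient E_j of z^j in E(z) = exp (c sum_{n>=1} x_n z^n / n), computed
   from z E'(z) = c (sum_n x_n z^n) E(z).  The first natural number is fuel;
   j units suffice. *)
Fixpoint exp_coeff (c : C) (x : positive -> op) (fuel j : nat) : op :=
  fun g s =>
  match j, fuel with
  | O, _ => g s
  | S _, O => RtoC 0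
  | S j', S f =>
      c / INR j *
      list_sum
        (fun i => x (Pos.of_succ_nat i) (exp_coeff c x f (j' - i) g) s)
        (seq 0 j)
  end.

Definition shift (m : Z) : op :=
  fun g s => g (State (lam s - IZR m) (occ_a s) (occ_d s)).

(* Coefficient of z^r in the field
     e^{ma}(z) = exp (m sum_{n>=1} a_{-n} z^n / n)
                 exp (- m sum_{n>=1} a_n z^{-n} / n) e^{ma} z^{m a_0},
   where a_0 = l - 1.  On [in_Pi nu] only finitely many terms of the series
   over j are nonzero. *)
Definition mode_exp (l m r : Z) : op := fun g s =>
  CSeries (fun j =>
    let i := (r - m * (l - 1) + Z.of_nat j)%Z in
    if (i <? 0)%Z then RtoC 0 else
      exp_coeff (ZtoC m) (fun p => mode_a l (Zneg p)) (Z.to_nat i) (Z.to_nat i)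
        (exp_coeff (- ZtoC m) (fun p => mode_a l (Zpos p)) j j (shift m g)) s).

(* Zero mode of T = :ad:/2 + (k/3) da - dd/2 (with (da)_0 = - a_0); on
   [in_Pi nu] only finitely many terms of the series are nonzero. *)
Definition T0 (k : C) (l : Z) : op := fun g s =>
  / 2 * mode_a l 0 (mode_d 0 g) s
  + CSeries (fun n =>
      let p := Pos.of_succ_nat n in
      / 2 * (mode_a l (Zneg p) (mode_d (Zpos p) g) s
             + mode_d (Zneg p) (mode_a l (Zpos p) g) s))
  - k / 3 * mode_a l 0 g s
  + / 2 * mode_d 0 g s.

Definition Pi_submodule (l : Z) (nu : R) (W : vec -> Prop) : Prop :=
  (forall g, W g -> in_Pi nu g) /\
  W (fun _ => RtoC 0) /\
  (forall g h, W g -> W h -> W (vadd g h)) /\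
  (forall c g, W g -> W (vscal c g)) /\
  (forall n g, W g -> W (mode_a l n g)) /\
  (forall n g, W g -> W (mode_d n g)) /\
  (forall m r g, W g -> W (mode_exp l m r g)).

Definition Pi_irreducible (l : Z) (nu : R) : Prop :=
  Pi_submodule l nu (in_Pi nu) /\
  (exists g, in_Pi nu g /\ exists s, g s <> 0) /\
  forall W : vec -> Prop, Pi_submodule l nu W ->
    (exists g, W g /\ exists s, g s <> 0) -> forall g, in_Pi nu g -> W g.

Definition is_line_derive (phi : C -> C) (v z d : C) : Prop :=
  is_derive (V := C_R_NormedModule) (fun t : R => phi (z + t * v)) 0%R d.

(* Class C^n on the real plane underlying C. *)
Fixpoint class_C (n : nat) (phi : C -> C) : Prop :=
  match n with
  | O => forall z, continuous phi z
  | S m => (forall z, continuous phi z) /\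
      exists phix phiy : C -> C,
        (forall z, is_line_derive phi 1 z (phix z)) /\
        (forall z, is_line_derive phi Ci z (phiy z)) /\
        class_C m phix /\ class_C m phiy
  end.

Definition test_function (phi : C -> C) : Prop :=
  (forall n, class_C n phi) /\
  exists K : R, forall z, (K < Cmod z)%R -> phi z = 0.

(* A generalised function F of zeta_d, with support in a union of lines, is
   represented by phi |-> int F(zeta_d) phi(zeta_d) |d(2 zeta_d)|, the integral
   being along these lines; only its values on test functions matter. *)
Definition gfun : Type := (C -> C) -> C.

Definition gf_eq (F G : gfun) : Prop :=
  forall phi, test_function phi -> F phi = G phi.

(* delta (2 zeta_d - y) *)
Definition gf_delta (y : C) : gfun := fun phi => phi (y / 2).

Definition gf_scal (c : C) (F : gfun) : gfun := fun phi => c * F phi.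

Definition gf_mul (A : C -> C) (F : gfun) : gfun :=
  fun phi => F (fun zd => A zd * phi zd).

(* F (zeta_d / tau); the Jacobian |tau| is that of a dilation of lines, so
   that delta (x / tau) = |tau| delta (x). *)
Definition gf_dilate (tau : C) (F : gfun) : gfun :=
  fun phi => Cmod tau * F (fun zd => phi (tau * zd)).

(* Weak integral over R/Z of a family given by a 1-periodic function of the
   representative. *)
Definition gf_circle_integral (F : R -> gfun) (G : gfun) : Prop :=
  forall phi, test_function phi ->
    is_RInt (V := C_R_NormedModule) (fun nu => F nu phi) 0%R 1%R (G phi).

Definition gf_Zsum (F : Z -> gfun) (G : gfun) : Prop :=
  forall phi, test_function phi -> has_sum (fun n => F n phi) (G phi).

(* For tau not real and phi of bounded support, the sum over n is finite. *)
Definition ch_Pi (k : C) (l : Z) (nu : R) (za tau : C) : gfun := fun phi =>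
  cis2pi (za * ZtoC (l - 1)) * cis2pi (- (k * ZtoC l * tau / 3))
  / dedekind_eta tau ^ 2
  * ZSeries (fun n =>
      cis2pi (ZtoC n * nu) * gf_delta (ZtoC n - ZtoC l * tau) phi).

Definition lin_comb {J : Type} (e : J -> vec) (c : J -> C) (L : list J) : vec :=
  fun s => list_sum (fun j => c j * e j s) L.

Definition is_basis (V : vec -> Prop) {J : Type} (e : J -> vec) : Prop :=
  (forall j, V (e j)) /\
  (forall g, V g -> exists c L, g = lin_comb e c L) /\
  (forall c L, NoDup L -> lin_comb e c L = (fun _ => RtoC 0) ->
     forall j, In j L -> c j = 0).

Definition central_charge (k : C) : C := 8 * k + 2.

(* [chi] is the trace of z_a^{a_0} z_d^{d_0} q^{T_0 - c/24} over Pi^l_[nu].  The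
   trace is computed in a basis of joint eigenvectors, with eigenvalues
   alpha, beta, gamma.  As a series of functions of zeta_d it converges nowhere;
   it is summed weakly on the line where x = 2 zeta_d + l tau is real, as in
   sum_n e^{2 pi i x n} = sum_n delta (x - n). *)
Definition is_Pi_character (k : C) (l : Z) (nu : R) (chi : C -> C -> gfun) :
    Prop :=
  exists (J : Type) (e : J -> vec) (alpha beta gamma : J -> C),
    is_basis (in_Pi nu) e /\
    (forall j, mode_a l 0 (e j) = vscal (alpha j) (e j)) /\
    (forall j, mode_d 0 (e j) = vscal (beta j) (e j)) /\
    (forall j, T0 k l (e j) = vscal (gamma j) (e j)) /\
    forall za tau : C, (0 < Im tau)%R ->
    forall phi, test_function phi ->
    exists I : J -> C,
      (forall j, is_RInt_gen (V := C_R_NormedModule)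
         (fun x : R =>
            let zd := (x - ZtoC l * tau) / 2 in
            cis2pi (za * alpha j + zd * beta j
                    + tau * (gamma j - central_charge k / 24)) * phi zd)
         (Rbar_locally m_infty) (Rbar_locally p_infty) (I j)) /\
      has_sum I (chi za tau phi).

Definition S_Pi (k : C) (l : Z) (nu : R) (l' : Z) (nu' : R) : C :=
  cis2pi (ZtoC (l + l') * k / 3) * cis2pi (- (ZtoC l * nu' + ZtoC l' * nu)).

Definition automorphy (k za zd tau : C) : C :=
  Cmod tau / (- Ci * tau)
  * Cexp (4 * PI * Ci * za * zd / tau)
  * Cexp (2 * PI * Ci * za * (tau - 1) / tau)
  * Cexp (- (4 * PI * Ci * k * zd * (tau - 1) / (3 * tau))).

(* Main.v *)
(** Irreducibility: the operators [d_0], [a_{-p} d_p] and [d_{-p} a_p] are diagonal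
    on monomials and separate them, so a nonzero submodule contains a monomial;
    the Heisenberg modes and the leading coefficients of the fields [e^{ma}] connect
    all monomials.

    Character: on the monomial with [lam = nu + m] the trace contributes a Fourier
    coefficient of [x |-> e^{2 pi i nu x} phi ((x - l tau) / 2)] times a power of [q].
    Poisson summation turns the sum over [m] into the sum of delta functions, and the
    two families of oscillators contribute [prod (1 - q^n)^{-2}].

    S-transform: integrating over [nu'] keeps one delta function for each [l'], and
    the coefficients agree by [eta (-1/tau)^2 = - i tau eta (tau)^2]. The latter is
    Poisson summation for a Gaussian, applied to Euler's pentagonal series; that series
    is obtained from Shanks's finite identity
    [sum_{|k| <= n} (-1)^k q^{k(3k+1)/2}
       = sum_{s <= n} (-1)^s (q^{s+1}; q)_{n-s} q^{s n + s(s+1)/2}]. *)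
From Stdlib Require Import Reals ZArith List Permutation Lra Lia Psatz.
From Stdlib Require Import FunctionalExtensionality ClassicalEpsilon ProofIrrelevance.
From Coquelicot Require Import Coquelicot.
Import ListNotations.
Require Import Defs.
Open Scope R_scope.

(** The analysis rests on one quantitative form of Poisson summation: replacing the full Fourier sum
    by its [N]-th Dirichlet partial sum costs at most a constant over [N], and the constant does not
    depend on the interval of integration. This uniformity lets the interval grow with [N] fixed
    before [N] tends to infinity, so Gaussian integrals over the whole line are never formed, and
    one estimate serves both the test functions of the character and the Gaussians of the eta
    function. The character contains eta only squared, so the inversion formula is proved for the
    square. For the trace, the monomials are exhausted by finite boxes on which the sum factors
    exactly into Fourier coefficients and two truncated partition functions. The same factorisation
    of the moduli gives absolute convergence, hence a sum that does not depend on the order of the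
    monomials. *)

Lemma continuous_ex_derive (f : R -> R) (x : R) : ex_derive f x -> continuous f x.
Proof. apply (ex_derive_continuous (K := R_AbsRing) (V := R_NormedModule)). Qed.

Lemma continuous_derivable (f : R -> R) (x l : R) : is_derive f x l -> continuous f x.
Proof. intros H. apply continuous_ex_derive. exists l. exact H. Qed.

Lemma continuous_plus_R (f g : R -> R) (x : R) :
  continuous f x -> continuous g x -> continuous (fun t => f t + g t) x.
Proof. apply (continuous_plus (V := R_NormedModule)). Qed.

Lemma continuous_minus_R (f g : R -> R) (x : R) :
  continuous f x -> continuous g x -> continuous (fun t => f t - g t) x.
Proof. apply (continuous_minus (V := R_NormedModule)). Qed.

Lemma continuous_mult_R (f g : R -> R) (x : R) :
  continuous f x -> continuous g x -> continuous (fun t => f t * g t) x.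
Proof. apply (continuous_mult (K := R_AbsRing)). Qed.

Lemma is_derive_const_R (c x : R) : is_derive (fun _ : R => c) x 0.
Proof. apply (is_derive_const (K := R_AbsRing) (V := R_NormedModule)). Qed.

Lemma is_derive_plus_R (f g : R -> R) (x l m : R) :
  is_derive f x l -> is_derive g x m -> is_derive (fun t => f t + g t) x (l + m).
Proof. apply (is_derive_plus (K := R_AbsRing) (V := R_NormedModule)). Qed.

Lemma is_derive_minus_R (f g : R -> R) (x l m : R) :
  is_derive f x l -> is_derive g x m -> is_derive (fun t => f t - g t) x (l - m).
Proof. apply (is_derive_minus (K := R_AbsRing) (V := R_NormedModule)). Qed.

Lemma RInt_correct_R (f : R -> R) (a b : R) : ex_RInt f a b -> is_RInt f a b (RInt f a b).
Proof. apply (RInt_correct (V := R_CompleteNormedModule)). Qed.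

Lemma is_RInt_const_R (a b c : R) : is_RInt (fun _ => c) a b ((b - a) * c).
Proof. apply (is_RInt_const (V := R_NormedModule)). Qed.

Lemma is_RInt_scal_R (f : R -> R) (a b k l : R) :
  is_RInt f a b l -> is_RInt (fun x => k * f x) a b (k * l).
Proof. apply (is_RInt_scal (V := R_NormedModule)). Qed.

Lemma is_RInt_plus_R (f g : R -> R) (a b l m : R) :
  is_RInt f a b l -> is_RInt g a b m -> is_RInt (fun x => f x + g x) a b (l + m).
Proof. apply (is_RInt_plus (V := R_NormedModule)). Qed.

Lemma is_RInt_minus_R (f g : R -> R) (a b l m : R) :
  is_RInt f a b l -> is_RInt g a b m -> is_RInt (fun x => f x - g x) a b (l - m).
Proof. apply (is_RInt_minus (V := R_NormedModule)). Qed.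

Lemma ex_RInt_cont (f : R -> R) (a b : R) : (forall x, continuous f x) -> ex_RInt f a b.
Proof. intros H. apply (ex_RInt_continuous (V := R_CompleteNormedModule)). intros x _. apply H. Qed.

Lemma is_lim_diff_quotient (f : R -> R) (x l : R) :
  is_derive f x l -> is_lim (fun y => (f y - f x) / (y - x)) x l.
Proof.
  intros H. apply is_derive_Reals in H. apply is_lim_spec. intros eps.
  destruct (H eps (cond_pos eps)) as [d Hd]. exists d. intros y Hy Hne.
  specialize (Hd (y - x)). rewrite Rplus_minus in Hd. apply Hd; [|exact Hy].
  intros E. apply Hne, Rminus_diag_uniq, E.
Qed.

(** At a common zero of [f] and [s] the quotient is a quotient of two convergent difference
    quotients, so the singularity is removable. This handles the zeros of [sin (PI * x)] at 0 and
    1. *)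
Lemma continuous_quotient (f s g : R -> R) (x f' s' : R) :
  is_derive f x f' -> is_derive s x s' -> f x = 0 -> s x = 0 -> s' <> 0 ->
  g x = f' / s' -> locally x (fun y => y <> x -> g y = f y / s y) -> continuous g x.
Proof.
  intros Hf Hs f0 s0 Hs' Hg Hloc.
  apply continuity_pt_filterlim, continuity_pt_filterlim'.
  change (is_lim g x (g x)). rewrite Hg.
  apply is_lim_ext_loc with (fun y => ((f y - f x) / (y - x)) / ((s y - s x) / (y - x))).
  - destruct Hloc as [d Hd]. exists d. intros y Hy Hne. rewrite (Hd y Hy Hne), f0, s0, !Rminus_0_r.
    unfold Rdiv. rewrite Rinv_mult, Rinv_inv.
    replace (f y * / (y - x) * (/ s y * (y - x))) with (f y * / s y * ((y - x) * / (y - x))) by ring.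
    rewrite Rinv_r by lra. ring.
  - apply (is_lim_div _ _ x f' s').
    + apply is_lim_diff_quotient, Hf.
    + apply is_lim_diff_quotient, Hs.
    + intros E. injection E. exact Hs'.
    + exact I.
Qed.

(** * Pointwise Fourier inversion and Poisson summation on the line *)

(** The numerator of the Dirichlet kernel ([sin_dirichlet]). These functions are themselves
    orthogonal on [0, 1], with square norm 1/2, so Bessel's inequality applies to them directly. *)
Definition osc (n : nat) (x : R) : R := sin ((2 * INR n + 1) * PI * x).

Lemma osc_continuous n x : continuous (osc n) x.
Proof. unfold osc. apply continuous_ex_derive. auto_derive. exact I. Qed.

Lemma sin_nat_PI (n : nat) : sin (INR n * PI) = 0.
Proof.
  induction n as [|n IH]; [simpl; rewrite Rmult_0_l; apply sin_0|].
  rewrite S_INR. replace ((INR n + 1) * PI) with (INR n * PI + PI) by ring. rewrite neg_sin, IH. ring.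
Qed.

Lemma cos_2nat_PI (n : nat) : cos (2 * PI * INR n) = 1.
Proof.
  replace (2 * PI * INR n) with (2 * (INR n * PI)) by ring. rewrite cos_2a_sin, sin_nat_PI. ring.
Qed.

Lemma sin_2nat_PI (n : nat) : sin (2 * PI * INR n) = 0.
Proof.
  replace (2 * PI * INR n) with (INR (2 * n) * PI) by (rewrite mult_INR; simpl; ring). apply sin_nat_PI.
Qed.

Lemma is_RInt_derive_R (F f : R -> R) (a b : R) :
  (forall x, is_derive F x (f x)) -> (forall x, continuous f x) -> is_RInt f a b (F b - F a).
Proof. intros H1 H2. apply (is_RInt_derive F f); intros x _; [apply H1|apply H2]. Qed.

Lemma is_RInt_eq (f : R -> R) (a b l l' : R) : is_RInt f a b l -> l = l' -> is_RInt f a b l'.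
Proof. intros H <-. exact H. Qed.

Lemma is_RInt_extR (f g : R -> R) (a b l : R) : (forall x, f x = g x) -> is_RInt f a b l -> is_RInt g a b l.
Proof. intros H. apply is_RInt_ext. intros x _. apply H. Qed.

Lemma RInt_extR (f g : R -> R) (a b : R) :
  (forall x, Rmin a b < x < Rmax a b -> f x = g x) -> RInt f a b = RInt g a b.
Proof. apply (RInt_ext (V := R_CompleteNormedModule)). Qed.

Lemma is_RInt_cos (n : nat) : (0 < n)%nat -> is_RInt (fun x => cos (2 * PI * INR n * x)) 0 1 0.
Proof.
  intros Hn. assert (Hw : 2 * PI * INR n <> 0).
  { apply Rmult_integral_contrapositive_currified; [pose proof PI_RGT_0; lra|apply not_0_INR; lia]. }
  set (w := 2 * PI * INR n) in *.
  apply is_RInt_eq with (sin (w * 1) / w - sin (w * 0) / w).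
  2: { rewrite Rmult_1_r, Rmult_0_r, sin_0. replace (sin w) with 0 by (symmetry; apply sin_2nat_PI). field. exact Hw. }
  apply (is_RInt_derive_R (fun x => sin (w * x) / w) (fun x => cos (w * x))).
  - intros x. auto_derive; [exact I|]. field. exact Hw.
  - intros x. apply continuous_ex_derive. auto_derive. exact I.
Qed.

Lemma is_RInt_x_cos (n : nat) : (0 < n)%nat -> is_RInt (fun x => x * cos (2 * PI * INR n * x)) 0 1 0.
Proof.
  intros Hn. assert (Hw : 2 * PI * INR n <> 0).
  { apply Rmult_integral_contrapositive_currified; [pose proof PI_RGT_0; lra|apply not_0_INR; lia]. }
  set (w := 2 * PI * INR n) in *.
  pose (F := fun x => x * sin (w * x) / w + cos (w * x) / w ^ 2).
  apply is_RInt_eq with (F 1 - F 0).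
  2: { unfold F. rewrite Rmult_1_r, Rmult_0_r, sin_0, cos_0. replace (sin w) with 0 by (symmetry; apply sin_2nat_PI).
       replace (cos w) with 1 by (symmetry; apply cos_2nat_PI). field. exact Hw. }
  apply (is_RInt_derive_R F).
  - intros x. unfold F. auto_derive; [exact I|]. field. exact Hw.
  - intros x. apply continuous_ex_derive. auto_derive. exact I.
Qed.

Lemma is_RInt_osc_diag (n : nat) : is_RInt (fun x => osc n x * osc n x) 0 1 (1 / 2).
Proof.
  replace (1 / 2) with (/ 2 * ((1 - 0) * 1 - 0)) by field.
  apply is_RInt_extR with (fun x => / 2 * (1 - cos (2 * PI * INR (2 * n + 1) * x))).
  - intros x. unfold osc. rewrite plus_INR, mult_INR. simpl INR.
    replace (2 * PI * ((1 + 1) * INR n + 1) * x) with (2 * ((2 * INR n + 1) * PI * x)) by ring.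
    rewrite cos_2a_sin. field.
  - apply is_RInt_scal_R. apply is_RInt_minus_R.
    + apply is_RInt_const_R.
    + apply is_RInt_cos. lia.
Qed.

Lemma is_RInt_osc_orth (n m : nat) : (n < m)%nat -> is_RInt (fun x => osc n x * osc m x) 0 1 0.
Proof.
  intros H. apply is_RInt_eq with (/ 2 * (0 - 0)); [|field].
  apply is_RInt_extR with (fun x => / 2 * (cos (2 * PI * INR (m - n) * x) - cos (2 * PI * INR (m + n + 1) * x))).
  - intros x. unfold osc. rewrite minus_INR by lia. rewrite !plus_INR. simpl INR.
    replace (2 * PI * (INR m - INR n) * x) with ((2 * INR m + 1) * PI * x - (2 * INR n + 1) * PI * x) by ring.
    replace (2 * PI * (INR m + INR n + 1) * x) with ((2 * INR m + 1) * PI * x + (2 * INR n + 1) * PI * x) by ring.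
    rewrite cos_minus, cos_plus. field.
  - apply is_RInt_scal_R.
    apply is_RInt_minus_R; apply is_RInt_cos; lia.
Qed.

(** The orthogonal projections are removed from [g] one at a time. Each removal leaves the
    coefficients against the later [osc] untouched and lowers the square norm by [2 * c n ^ 2]; what
    remains is nonnegative. *)
Lemma bessel_osc (g : R -> R) (N : nat) :
  ex_RInt g 0 1 -> (forall n, ex_RInt (fun x => g x * osc n x) 0 1) -> ex_RInt (fun x => g x * g x) 0 1 ->
  2 * sum_f_R0 (fun n => (RInt (fun x => g x * osc n x) 0 1) ^ 2) N <= RInt (fun x => g x * g x) 0 1.
Proof.
  intros H1 H2 H3. set (c := fun n => RInt (fun x => g x * osc n x) 0 1).
  assert (Hc : forall n, is_RInt (fun x => g x * osc n x) 0 1 (c n)) by (intros n; apply RInt_correct_R, H2).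
  assert (H : exists h : R -> R, (forall n, (N < n)%nat -> is_RInt (fun x => h x * osc n x) 0 1 (c n)) /\
    is_RInt (fun x => h x * h x) 0 1 (RInt (fun x => g x * g x) 0 1 - 2 * sum_f_R0 (fun n => c n ^ 2) N)).
  { assert (Step : forall (h : R -> R) S n, (forall k, (n <= k)%nat -> is_RInt (fun x => h x * osc k x) 0 1 (c k)) ->
      is_RInt (fun x => h x * h x) 0 1 S ->
      exists h' : R -> R, (forall k, (n < k)%nat -> is_RInt (fun x => h' x * osc k x) 0 1 (c k)) /\
        is_RInt (fun x => h' x * h' x) 0 1 (S - 2 * c n ^ 2)).
    { intros h S n Hh HS. exists (fun x => h x - 2 * c n * osc n x). split.
      - intros k Hk. replace (c k) with (c k - 2 * c n * 0) by ring.
        apply is_RInt_extR with (fun x => h x * osc k x - 2 * c n * (osc n x * osc k x)); [intros x; cbv beta; ring|].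
        apply is_RInt_minus_R; [apply Hh; lia|].
        apply is_RInt_scal_R, is_RInt_osc_orth, Hk.
      - replace (S - 2 * c n ^ 2) with (S - 4 * c n * c n + 4 * c n ^ 2 * (1 / 2)) by field.
        apply is_RInt_extR with (fun x => h x * h x - 4 * c n * (h x * osc n x) + 4 * c n ^ 2 * (osc n x * osc n x));
          [intros x; cbv beta; ring|].
        apply is_RInt_plus_R; [apply is_RInt_minus_R; [exact HS|]|].
        + apply is_RInt_scal_R, Hh; lia.
        + apply is_RInt_scal_R, is_RInt_osc_diag. }
    induction N as [|N IH].
    - apply (Step g _ 0%nat); [intros; apply Hc|apply RInt_correct_R, H3].
    - destruct IH as [h [Hh HS]]. destruct (Step h _ (S N) (fun k Hk => Hh k Hk) HS) as [h' [A B]].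
      exists h'. split; [exact A|]. eapply is_RInt_eq; [exact B|]. simpl sum_f_R0. ring. }
  destruct H as [h [_ Hh]]. apply (is_RInt_le (fun _ => 0) _ 0 1 (scal (1 - 0) 0)) in Hh.
  - unfold scal in Hh; simpl in Hh; unfold mult in Hh; simpl in Hh. rewrite Rmult_0_r in Hh. fold c in Hh. apply Rminus_le_0. exact Hh.
  - lra.
  - apply is_RInt_const_R.
  - intros x _. apply Rle_0_sqr.
Qed.

(** By Bessel the squares of the coefficients are summable, hence tend to 0. Continuity on [0, 1]
    suffices, which matters because the quotient in [dirichlet_lim_0] is only known to be continuous
    there. *)
Lemma riemann_lebesgue_osc (g : R -> R) :
  (forall x, 0 <= x <= 1 -> continuous g x) ->
  is_lim_seq (fun n => RInt (fun x => g x * osc n x) 0 1) 0.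
Proof.
  intros Hg.
  assert (ex : forall f : R -> R, (forall x, 0 <= x <= 1 -> continuous f x) -> ex_RInt f 0 1).
  { intros f Hf. apply (ex_RInt_continuous (V := R_CompleteNormedModule)). intros x.
    rewrite Rmin_left, Rmax_right by lra. apply Hf. }
  set (c := fun n => RInt (fun x => g x * osc n x) 0 1).
  assert (Hb : forall N, 2 * sum_f_R0 (fun n => c n ^ 2) N <= RInt (fun x => g x * g x) 0 1).
  { intros N. apply bessel_osc; [apply ex, Hg|intros n|]; apply ex; intros x Hx;
      apply continuous_mult_R; try apply Hg, Hx; apply osc_continuous. }
  assert (Hs : ex_series (fun n => c n ^ 2)).
  { destruct (ex_finite_lim_seq_incr (sum_n (fun n => c n ^ 2)) (RInt (fun x => g x * g x) 0 1)) as [l Hl].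
    - intros n. rewrite sum_Sn. unfold plus; simpl. pose proof (pow2_ge_0 (c (S n))). simpl in *. lra.
    - intros n. rewrite sum_n_Reals. specialize (Hb n).
      pose proof (cond_pos_sum (fun n => c n ^ 2) n (fun n => pow2_ge_0 (c n))). lra.
    - exists l. exact Hl. }
  apply ex_series_lim_0 in Hs. apply is_lim_seq_spec. intros eps. apply is_lim_seq_spec in Hs.
  assert (He : 0 < eps ^ 2) by (apply pow_lt, cond_pos).
  destruct (Hs (mkposreal _ He)) as [N HN]. exists N. intros n Hn. specialize (HN n Hn). simpl pos in HN.
  rewrite Rminus_0_r in *. rewrite <- RPow_abs in HN.
  apply Rnot_le_lt. intros Hle. assert (eps ^ 2 <= Rabs (c n) ^ 2); [|lra].
  apply pow_incr. split; [left; apply cond_pos|exact Hle].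
Qed.

(** The sum of e^{2 pi i m x} over |m| <= N, written with cosines so that real integrals can be
    used; [dirichlet_cis] restores the exponential form. *)
Fixpoint dirichlet (N : nat) (x : R) : R :=
  match N with
  | O => 1
  | S M => dirichlet M x + 2 * cos (2 * PI * INR (S M) * x)
  end.

Lemma dirichlet_continuous N x : continuous (dirichlet N) x.
Proof.
  induction N as [|N IH]; [apply continuous_const|].
  cbn [dirichlet]. apply continuous_plus_R; [exact IH|].
  apply continuous_ex_derive. auto_derive. exact I.
Qed.

Lemma sin_dirichlet N x : sin (PI * x) * dirichlet N x = osc N x.
Proof.
  induction N as [|N IH].
  - simpl. unfold osc. simpl. rewrite Rmult_1_r. f_equal. ring.
  - cbn [dirichlet]. rewrite Rmult_plus_distr_l, IH. unfold osc. rewrite S_INR.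
    replace ((2 * (INR N + 1) + 1) * PI * x) with (2 * PI * (INR N + 1) * x + PI * x) by ring.
    replace ((2 * INR N + 1) * PI * x) with (2 * PI * (INR N + 1) * x - PI * x) by ring.
    rewrite sin_minus, sin_plus. ring.
Qed.

Lemma is_RInt_dirichlet N : is_RInt (dirichlet N) 0 1 1.
Proof.
  induction N as [|N IH].
  - apply is_RInt_eq with ((1 - 0) * 1); [|ring]. apply is_RInt_const_R.
  - apply is_RInt_eq with (1 + 2 * 0); [|ring]. apply is_RInt_plus_R; [exact IH|].
    apply is_RInt_scal_R, is_RInt_cos. lia.
Qed.

(** Together with [is_RInt_dirichlet] this evaluates the kernel exactly on affine functions, for
    every [N]. *)
Lemma is_RInt_x_dirichlet N : is_RInt (fun x => x * dirichlet N x) 0 1 (1 / 2).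
Proof.
  induction N as [|N IH].
  - replace (1 / 2) with (1 ^ 2 / 2 - 0 ^ 2 / 2) by field.
    apply (is_RInt_derive_R (fun x => x ^ 2 / 2)).
    + intros x. auto_derive; [exact I|]. simpl. field.
    + intros x. simpl. apply continuous_ex_derive. auto_derive. exact I.
  - replace (1 / 2) with (1 / 2 + 2 * 0) by field.
    apply is_RInt_extR with (fun x => x * dirichlet N x + 2 * (x * cos (2 * PI * INR (S N) * x)));
      [intros; cbn [dirichlet]; ring|].
    apply is_RInt_plus_R; [exact IH|].
    apply is_RInt_scal_R, is_RInt_x_cos. lia.
Qed.

(** Vanishing at both ends makes [f x / sin (PI * x)] continuous on [0, 1]; the integral against the
    kernel is then an integral of this quotient against [osc N], to which Riemann-Lebesgue
    applies. *)
Lemma dirichlet_lim_0 (f : R -> R) (d0 d1 : R) :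
  (forall x, continuous f x) -> is_derive f 0 d0 -> is_derive f 1 d1 -> f 0 = 0 -> f 1 = 0 ->
  is_lim_seq (fun N => RInt (fun x => f x * dirichlet N x) 0 1) 0.
Proof.
  intros Hf H0 H1 f0 f1.
  (* The end values are the limits of the quotient; the slope of [sin (PI * x)] is [PI] at 0 and
     [- PI] at 1. *)
  pose (g := fun x => if Req_dec_T x 0 then d0 / PI else if Req_dec_T x 1 then d1 / (- PI) else f x / sin (PI * x)).
  assert (Hsin : forall x, 0 < x < 1 -> sin (PI * x) <> 0).
  { intros x Hx. apply Rgt_not_eq, sin_gt_0; pose proof PI_RGT_0; nra. }
  assert (Hder : forall x, is_derive (fun x => sin (PI * x)) x (PI * cos (PI * x))).
  { intros x. auto_derive; [exact I|]. ring. }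
  apply is_lim_seq_ext with (fun N => RInt (fun x => g x * osc N x) 0 1).
  { intros N. apply RInt_extR. intros x. rewrite Rmin_left, Rmax_right by lra. intros Hx.
    rewrite <- sin_dirichlet. unfold g. destruct (Req_dec_T x 0); [lra|]. destruct (Req_dec_T x 1); [lra|].
    field. apply Hsin, Hx. }
  apply riemann_lebesgue_osc. intros x Hx.
  destruct (Req_dec_T x 0) as [E|E0]; [|destruct (Req_dec_T x 1) as [E|E1]].
  - subst x. apply (continuous_quotient f (fun x => sin (PI * x)) g 0 d0 (PI * cos (PI * 0))); auto.
    + rewrite Rmult_0_r. apply sin_0.
    + rewrite Rmult_0_r, cos_0. pose proof PI_RGT_0. lra.
    + unfold g. destruct (Req_dec_T 0 0); [|lra]. rewrite Rmult_0_r, cos_0. f_equal. ring.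
    + exists (mkposreal 1 Rlt_0_1). intros y Hy Hne. unfold ball in Hy; simpl in Hy; unfold AbsRing_ball, abs, minus, plus, opp in Hy; simpl in Hy.
      apply Rabs_def2 in Hy. unfold g. destruct (Req_dec_T y 0); [contradiction|]. destruct (Req_dec_T y 1); [lra|reflexivity].
  - subst x. apply (continuous_quotient f (fun x => sin (PI * x)) g 1 d1 (PI * cos (PI * 1))); auto.
    + rewrite Rmult_1_r. apply sin_PI.
    + rewrite Rmult_1_r, cos_PI. pose proof PI_RGT_0. lra.
    + unfold g. destruct (Req_dec_T 1 0); [lra|]. destruct (Req_dec_T 1 1); [|lra]. rewrite Rmult_1_r, cos_PI. f_equal. ring.
    + exists (mkposreal 1 Rlt_0_1). intros y Hy Hne. unfold ball in Hy; simpl in Hy; unfold AbsRing_ball, abs, minus, plus, opp in Hy; simpl in Hy.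
      apply Rabs_def2 in Hy. unfold g. destruct (Req_dec_T y 0); [lra|]. destruct (Req_dec_T y 1); [lra|reflexivity].
  - assert (Hx' : 0 < x < 1) by lra.
    apply (continuous_ext_loc _ (fun y => f y * / sin (PI * y))).
    + assert (Hd : 0 < Rmin x (1 - x)) by (apply Rmin_glb_lt; lra).
      exists (mkposreal _ Hd). intros y Hy. unfold ball in Hy; simpl in Hy; unfold AbsRing_ball, abs, minus, plus, opp in Hy; simpl in Hy.
      apply Rabs_def2 in Hy. pose proof (Rmin_l x (1 - x)). pose proof (Rmin_r x (1 - x)).
      unfold g. destruct (Req_dec_T y 0); [lra|]. destruct (Req_dec_T y 1); [lra|reflexivity].
    + apply continuous_mult_R; [apply Hf|].
      apply continuous_Rinv_comp; [eapply continuous_derivable, Hder|apply Hsin, Hx'].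
Qed.

(** Subtracting the affine interpolant of the end values reduces to [dirichlet_lim_0]; the
    interpolant integrates to the mean of the end values for every [N]. *)
Lemma dirichlet_lim (f : R -> R) (d0 d1 : R) :
  (forall x, continuous f x) -> is_derive f 0 d0 -> is_derive f 1 d1 ->
  is_lim_seq (fun N => RInt (fun x => f x * dirichlet N x) 0 1) ((f 0 + f 1) / 2).
Proof.
  intros Hf H0 H1. pose (h := fun x => f x - (f 0 + (f 1 - f 0) * x)).
  assert (Hh : forall x, continuous h x).
  { intros x. apply continuous_minus_R; [apply Hf|].
    apply continuous_ex_derive. auto_derive. exact I. }
  assert (Hlim : is_lim_seq (fun N => RInt (fun x => h x * dirichlet N x) 0 1) 0).
  { apply (dirichlet_lim_0 h (d0 - (f 1 - f 0)) (d1 - (f 1 - f 0))); [exact Hh| | |unfold h; ring|unfold h; ring].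
    - apply is_derive_minus_R; [exact H0|]. auto_derive; [exact I|]. ring.
    - apply is_derive_minus_R; [exact H1|]. auto_derive; [exact I|]. ring. }
  apply is_lim_seq_ext with (fun N => RInt (fun x => h x * dirichlet N x) 0 1 + (f 0 + f 1) / 2).
  - intros N. symmetry. apply is_RInt_unique.
    replace ((f 0 + f 1) / 2) with (f 0 * 1 + (f 1 - f 0) * (1 / 2)) by field.
    apply is_RInt_extR with (fun x => h x * dirichlet N x + (f 0 * dirichlet N x + (f 1 - f 0) * (x * dirichlet N x)));
      [intros x; unfold h; ring|].
    apply is_RInt_plus_R; [|apply is_RInt_plus_R].
    + apply RInt_correct_R, ex_RInt_cont. intros x.
      apply continuous_mult_R; [apply Hh|apply dirichlet_continuous].
    + apply is_RInt_scal_R, is_RInt_dirichlet.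
    + apply is_RInt_scal_R, is_RInt_x_dirichlet.
  - replace (Finite ((f 0 + f 1) / 2)) with (Finite (0 + (f 0 + f 1) / 2)) by (f_equal; ring).
    apply is_lim_seq_plus'; [exact Hlim|apply is_lim_seq_const].
Qed.

(** * Rate of convergence of the Fourier series of a C^2 function *)

Section C2.
Context (f f' f'' : R -> R).
Context (Hf : forall x, is_derive f x (f' x)) (Hf' : forall x, is_derive f' x (f'' x))
  (Hf'' : forall x, continuous f'' x).

(** Two integrations by parts condensed into one primitive, [f * sin / w + f' * cos / w ^ 2], whose
    derivative differs from the integrand only by the term in [f'']. *)
Lemma RInt_by_parts_cos (w a b : R) : w <> 0 ->
  is_RInt (fun x => f x * cos (w * x)) a b
    (f b * sin (w * b) / w + f' b * cos (w * b) / w ^ 2 - (f a * sin (w * a) / w + f' a * cos (w * a) / w ^ 2)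
     - RInt (fun x => f'' x * cos (w * x)) a b / w ^ 2).
Proof.
  intros Hw.
  assert (Cc : forall x, continuous (fun x => cos (w * x)) x)
    by (intros x; apply continuous_ex_derive; auto_derive; exact I).
  assert (C2 : forall x, continuous (fun x => f'' x * cos (w * x)) x)
    by (intros x; apply continuous_mult_R; [apply Hf''|apply Cc]).
  apply is_RInt_extR with (fun x => (f x * cos (w * x) + f'' x * cos (w * x) / w ^ 2) - / w ^ 2 * (f'' x * cos (w * x)));
    [intros x; simpl; field; exact Hw|].
  apply is_RInt_minus_R.
  - apply (is_RInt_derive_R (fun x => f x * sin (w * x) / w + f' x * cos (w * x) / w ^ 2)).
    + intros x. pose proof (Hf x) as D1. pose proof (Hf' x) as D2. auto_derive.
      * repeat split; [eexists; exact D1|eexists; exact D2].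
      * change (Derive (fun x0 => f x0) x) with (Derive f x). change (Derive (fun x0 => f' x0) x) with (Derive f' x).
        rewrite (is_derive_unique _ _ _ D1), (is_derive_unique _ _ _ D2). field. exact Hw.
    + intros x. apply continuous_plus_R.
      * apply continuous_mult_R; [eapply continuous_derivable, Hf|apply Cc].
      * apply continuous_mult_R; [apply C2|apply continuous_const].
  - unfold Rdiv. rewrite (Rmult_comm (RInt _ _ _)).
    apply is_RInt_scal_R, RInt_correct_R, ex_RInt_cont, C2.
Qed.

Lemma RInt_abs_le (g : R -> R) (a b B : R) : a <= b -> (forall x, continuous g x) ->
  (forall x, a <= x <= b -> Rabs (g x) <= B) -> Rabs (RInt g a b) <= (b - a) * B.
Proof.
  intros Hab Hg HB.
  apply (abs_RInt_le_const g a b B); [exact Hab|apply ex_RInt_cont, Hg|exact HB].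
Qed.

(** At an integral frequency the sine boundary terms vanish, and [f' 1 - f' 0] is again an integral
    of [f'']. This leaves [4 * B / w ^ 2] with [w = 2 * PI * INR m], and [PI > 1] absorbs the
    constant. *)
Lemma fourier_coeff_bound (B : R) (m : nat) : (0 < m)%nat ->
  (forall x, 0 <= x <= 1 -> Rabs (f'' x) <= B) ->
  Rabs (RInt (fun x => f x * (2 * cos (2 * PI * INR m * x))) 0 1) <= B / INR m ^ 2.
Proof.
  intros Hm HB. assert (Hi : 1 <= INR m) by (apply (le_INR 1); lia).
  assert (Hpi : 2 < PI) by (pose proof PI2_1; lra).
  set (w := 2 * PI * INR m). assert (Hw : w <> 0) by (unfold w; nra).
  assert (E : RInt (fun x => f x * (2 * cos (w * x))) 0 1 =
    2 * ((f' 1 - f' 0 - RInt (fun x => f'' x * cos (w * x)) 0 1) / w ^ 2)).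
  { apply is_RInt_unique. apply is_RInt_extR with (fun x => 2 * (f x * cos (w * x))); [intros x; cbv beta; ring|].
    apply is_RInt_scal_R.
    pose proof (RInt_by_parts_cos w 0 1 Hw) as H.
    rewrite Rmult_0_r, Rmult_1_r, sin_0, cos_0 in H. replace (sin w) with 0 in H by (symmetry; apply sin_2nat_PI).
    replace (cos w) with 1 in H by (symmetry; apply cos_2nat_PI).
    eapply is_RInt_eq; [exact H|]. field. exact Hw. }
  rewrite E.
  assert (H1 : Rabs (f' 1 - f' 0) <= B).
  { rewrite <- (is_RInt_unique f'' 0 1 (f' 1 - f' 0)) by (apply is_RInt_derive_R; assumption).
    eapply Rle_trans; [apply (RInt_abs_le f'' 0 1 B); [lra|exact Hf''|exact HB]|lra]. }
  assert (H2 : Rabs (RInt (fun x => f'' x * cos (w * x)) 0 1) <= B).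
  { eapply Rle_trans; [apply (RInt_abs_le _ 0 1 B); [lra| |]|lra].
    - intros x. apply continuous_mult_R; [apply Hf''|].
      apply continuous_ex_derive; auto_derive; exact I.
    - intros x Hx. rewrite Rabs_mult. specialize (HB x Hx).
      assert (Rabs (cos (w * x)) <= 1) by (apply Rabs_le, COS_bound). pose proof (Rabs_pos (f'' x)). nra. }
  unfold Rdiv. rewrite !Rabs_mult, (Rabs_pos_eq 2), (Rabs_pos_eq (/ w ^ 2)) by (try lra; left; apply Rinv_0_lt_compat; nra).
  assert (HB0 : 0 <= B) by (pose proof (Rabs_pos (f' 1 - f' 0)); lra).
  assert (H3 : Rabs (f' 1 - f' 0 - RInt (fun x => f'' x * cos (w * x)) 0 1) <= 2 * B).
  { unfold Rminus at 1. eapply Rle_trans; [apply Rabs_triang|]. rewrite Rabs_Ropp. lra. }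
  assert (H4 : 4 * / w ^ 2 <= / INR m ^ 2).
  { unfold w. replace (4 * / (2 * PI * INR m) ^ 2) with (/ PI ^ 2 * / INR m ^ 2) by (field; nra).
    rewrite <- (Rmult_1_l (/ INR m ^ 2)) at 2. apply Rmult_le_compat_r.
    - left; apply Rinv_0_lt_compat; nra.
    - rewrite <- Rinv_1. apply Rinv_le_contravar; nra. }
  assert (H5 : 0 < / w ^ 2) by (apply Rinv_0_lt_compat; nra).
  pose proof (Rabs_pos (f' 1 - f' 0 - RInt (fun x => f'' x * cos (w * x)) 0 1)). nra.
Qed.

(** The limit is known from [dirichlet_lim], so only the tail has to be summed. Step [M] adds at
    most [B / (M + 1) ^ 2 <= B / M - B / (M + 1)], which telescopes to at most [B / N]. *)
Lemma dirichlet_error (B : R) (N : nat) : (0 < N)%nat ->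
  (forall x, 0 <= x <= 1 -> Rabs (f'' x) <= B) ->
  Rabs ((f 0 + f 1) / 2 - RInt (fun x => f x * dirichlet N x) 0 1) <= B / INR N.
Proof.
  intros HN HB. set (u := fun N => RInt (fun x => f x * dirichlet N x) 0 1).
  assert (Cf : forall x, continuous f x) by (intros x; eapply continuous_derivable, Hf).
  assert (HB0 : 0 <= B) by (pose proof (Rabs_pos (f'' 0)); specialize (HB 0 ltac:(lra)); lra).
  assert (Step : forall M, u (S M) = u M + RInt (fun x => f x * (2 * cos (2 * PI * INR (S M) * x))) 0 1).
  { intros M. unfold u. rewrite <- (RInt_plus (V := R_CompleteNormedModule)).
    - apply RInt_extR. intros x _. cbn [dirichlet]. unfold plus; simpl. ring.
    - apply ex_RInt_cont. intros x. apply continuous_mult_R; [apply Cf|apply dirichlet_continuous].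
    - apply ex_RInt_cont. intros x. apply continuous_mult_R; [apply Cf|].
      apply continuous_ex_derive; auto_derive; exact I. }
  assert (Hd : forall k, Rabs (u (N + k)%nat - u N) <= B / INR N - B / INR (N + k)).
  { induction k as [|k IH].
    - rewrite Nat.add_0_r, !Rminus_diag, Rabs_R0. lra.
    - rewrite Nat.add_succ_r, Step.
      replace (_ - u N) with ((u (N + k)%nat - u N) + RInt (fun x => f x * (2 * cos (2 * PI * INR (S (N + k)) * x))) 0 1) by ring.
      eapply Rle_trans; [apply Rabs_triang|].
      pose proof (fourier_coeff_bound B (S (N + k)) ltac:(lia) HB) as H.
      assert (Hn : 0 < INR (N + k)) by (apply lt_0_INR; lia).
      assert (H' : B / INR (S (N + k)) ^ 2 <= B / INR (N + k) - B / INR (S (N + k))).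
      { rewrite S_INR. set (n := INR (N + k)) in *.
        replace (B / n - B / (n + 1)) with (B * / (n * (n + 1))) by (field; lra).
        unfold Rdiv. apply Rmult_le_compat_l; [exact HB0|]. apply Rinv_le_contravar; nra. }
      lra. }
  assert (Hl : is_lim_seq (fun k => Rabs (u (k + N)%nat - u N)) (Rabs ((f 0 + f 1) / 2 - u N))).
  { apply (is_lim_seq_abs _ (Finite ((f 0 + f 1) / 2 - u N))). apply is_lim_seq_minus'; [|apply is_lim_seq_const].
    apply (is_lim_seq_incr_n u N). apply (dirichlet_lim f (f' 0) (f' 1)); auto. }
  apply (is_lim_seq_le _ (fun _ => B / INR N) (Finite _) (Finite (B / INR N))) in Hl; [exact Hl| |apply is_lim_seq_const].
  intros k. rewrite Nat.add_comm. eapply Rle_trans; [apply Hd|].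
  assert (0 <= B / INR (N + k)); [|lra].
  apply Rmult_le_pos; [exact HB0|]. left. apply Rinv_0_lt_compat, lt_0_INR. lia.
Qed.
End C2.

Lemma dirichlet_shift (N : nat) (n : Z) (x : R) : dirichlet N (x + IZR n) = dirichlet N x.
Proof.
  induction N as [|N IH]; [reflexivity|]. cbn [dirichlet]. rewrite IH. f_equal. f_equal.
  set (k := INR (S N)).
  replace (2 * PI * k * (x + IZR n)) with (2 * PI * k * x + 2 * PI * IZR (Z.of_nat (S N) * n))
    by (rewrite mult_IZR, <- INR_IZR_INZ; unfold k; ring).
  assert (Hc : forall j : Z, cos (2 * PI * IZR j) = 1 /\ sin (2 * PI * IZR j) = 0).
  { intros j. destruct (Z_le_gt_dec 0 j) as [H|H].
    - rewrite <- (Z2Nat.id j H), <- INR_IZR_INZ. split; [apply cos_2nat_PI|apply sin_2nat_PI].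
    - replace j with (- Z.of_nat (Z.to_nat (- j)))%Z by lia. rewrite opp_IZR, <- INR_IZR_INZ.
      replace (2 * PI * - INR (Z.to_nat (- j))) with (- (2 * PI * INR (Z.to_nat (- j)))) by ring.
      rewrite cos_neg, sin_neg, cos_2nat_PI, sin_2nat_PI. split; ring. }
  rewrite cos_plus. destruct (Hc (Z.of_nat (S N) * n)%Z) as [-> ->]. ring.
Qed.

(** The trapezoidal sum is what the Dirichlet kernel recovers in the limit: each unit interval
    returns the mean of its end values, so interior integers get weight one and the two ends one
    half. *)
Fixpoint trapezoid (f : R -> R) (a : R) (n : nat) : R :=
  match n with
  | O => 0
  | S m => trapezoid f a m + (f (a + INR m) + f (a + INR (S m))) / 2
  end.

Lemma atan_le_PI2 (x y : R) : atan x - atan y <= 4.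
Proof. pose proof (atan_bound x). pose proof (atan_bound y). pose proof PI_4. lra. Qed.

(** The errors on unit intervals inherit the decay [1 / (1 + x ^ 2)], whose sum is controlled by the
    variation of [atan]; hence the bound is independent of [a] and [n]. The constant 12 is the
    factor 3 lost inside a unit interval times the bound 4 for the variation of [atan]. *)
Lemma poisson_real (f f' f'' : R -> R) (K : R) (a : Z) (n N : nat) :
  (forall x, is_derive f x (f' x)) -> (forall x, is_derive f' x (f'' x)) -> (forall x, continuous f'' x) ->
  (forall x, Rabs (f'' x) <= K / (1 + x ^ 2)) -> (0 < N)%nat ->
  Rabs (trapezoid f (IZR a) n - RInt (fun x => f x * dirichlet N x) (IZR a) (IZR a + INR n)) <= 12 * K / INR N.
Proof.
  intros Hf Hf' Hf'' HK HN.
  assert (Cf : forall x, continuous f x) by (intros x; eapply continuous_derivable, Hf).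
  assert (CD : forall x, continuous (fun x => f x * dirichlet N x) x)
    by (intros x; apply continuous_mult_R; [apply Cf|apply dirichlet_continuous]).
  assert (HN0 : 0 < INR N) by (apply lt_0_INR; lia).
  assert (HK0 : 0 <= K).
  { specialize (HK 0). pose proof (Rabs_pos (f'' 0)). replace (K / (1 + 0 ^ 2)) with K in HK by (simpl; field). lra. }
  assert (H : Rabs (trapezoid f (IZR a) n - RInt (fun x => f x * dirichlet N x) (IZR a) (IZR a + INR n))
    <= 3 * K / INR N * (atan (IZR a + INR n) - atan (IZR a))).
  { induction n as [|n IH].
    - simpl. rewrite Rplus_0_r, RInt_point. unfold zero; simpl. rewrite !Rminus_diag, Rabs_R0. lra.
    - set (c := IZR a + INR n) in *. assert (Ec : IZR a + INR (S n) = c + 1) by (rewrite S_INR; unfold c; ring).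
      cbn [trapezoid]. rewrite Ec. fold c.
      rewrite <- (RInt_Chasles (V := R_CompleteNormedModule) _ (IZR a) c (c + 1)) by (apply ex_RInt_cont, CD).
      unfold plus; simpl. set (I1 := RInt _ (IZR a) c) in *.
      assert (Hc : c = IZR (a + Z.of_nat n)) by (unfold c; rewrite plus_IZR, <- INR_IZR_INZ; reflexivity).
      assert (E2 : RInt (fun x => f x * dirichlet N x) c (c + 1) = RInt (fun x => f (x + c) * dirichlet N x) 0 1).
      { transitivity (RInt (fun y => scal 1 ((fun x => f x * dirichlet N x) (y + c))) 0 1).
        - symmetry. apply is_RInt_unique.
          pose proof (is_RInt_comp (V := R_CompleteNormedModule) (fun x => f x * dirichlet N x) (fun y => y + c) (fun _ => 1) 0 1) as H.
          simpl in H. replace (0 + c) with c in H by ring. replace (1 + c) with (c + 1) in H by ring. apply H.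
          + intros x _. apply CD.
          + intros x _. split; [auto_derive; [exact I|ring]|apply continuous_const].
        - apply RInt_extR. intros x _. unfold scal; simpl; unfold mult; simpl. rewrite Hc, dirichlet_shift. ring. }
      rewrite E2.
      (* The mean value point [y] makes [/ (1 + y ^ 2)] a telescoping difference of [atan]. At
         distance at most 1 from [y], [1 + x ^ 2] is at least one third of [1 + y ^ 2]. *)
      destruct (MVT_gen atan c (c + 1) (fun x => / (1 + x ^ 2))) as [y [Hy Ey]].
      { intros x _. apply is_derive_Reals. exact (derivable_pt_lim_atan x). }
      { intros x _. apply derivable_continuous_pt. eexists. exact (derivable_pt_lim_atan x). }
      rewrite Rmin_left, Rmax_right in Hy by lra. replace (c + 1 - c) with 1 in Ey by ring. rewrite Rmult_1_r in Ey.
      pose proof (dirichlet_error (fun x => f (x + c)) (fun x => f' (x + c)) (fun x => f'' (x + c))) as H.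
      assert (Sh : forall (g g' : R -> R), (forall x, is_derive g x (g' x)) -> forall x, is_derive (fun x => g (x + c)) x (g' (x + c))).
      { intros g g' Hg x. pose proof (is_derive_comp g (fun x => x + c) x (g' (x + c)) 1 (Hg _)) as D.
        replace (g' (x + c)) with (scal 1 (g' (x + c))) by (unfold scal; simpl; unfold mult; simpl; ring).
        apply D. auto_derive; [exact I|ring]. }
      specialize (H (Sh _ _ Hf) (Sh _ _ Hf')).
      assert (HC : forall x, continuous (fun x => f'' (x + c)) x).
      { intros x. apply (continuous_comp (fun x => x + c) f''); [|apply Hf''].
        apply continuous_ex_derive; auto_derive; exact I. }
      specialize (H HC (3 * K * / (1 + y ^ 2)) N HN).
      assert (HB : forall x, 0 <= x <= 1 -> Rabs (f'' (x + c)) <= 3 * K * / (1 + y ^ 2)).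
      { intros x Hx. eapply Rle_trans; [apply HK|]. unfold Rdiv. rewrite (Rmult_comm 3 K), Rmult_assoc.
        apply Rmult_le_compat_l; [exact HK0|]. set (z := x + c). assert (Hz : Rabs (z - y) <= 1) by (apply Rabs_le; unfold z; split; lra).
        assert (P1 : 0 < 1 + z ^ 2) by nra. assert (P2 : 0 < 1 + y ^ 2) by nra.
        apply Rmult_le_reg_l with (1 + z ^ 2); [exact P1|]. rewrite Rinv_r by lra.
        apply Rmult_le_reg_r with (1 + y ^ 2); [exact P2|].
        replace ((1 + z ^ 2) * (3 * / (1 + y ^ 2)) * (1 + y ^ 2)) with (3 * (1 + z ^ 2)) by (field; lra).
        apply Rabs_le_between in Hz. destruct Hz as [Hz1 Hz2].
        assert (0 <= (1 - (z - y)) * (1 + (z - y))) by (apply Rmult_le_pos; lra).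
        pose proof (pow2_ge_0 (2 * z - y)). pose proof (pow2_ge_0 z). nra. }
      specialize (H HB). cbv beta in H. rewrite Rplus_0_l, (Rplus_comm 1 c) in H.
      replace (trapezoid f (IZR a) n + (f c + f (c + 1)) / 2 - (I1 + RInt (fun x => f (x + c) * dirichlet N x) 0 1))
        with ((trapezoid f (IZR a) n - I1) + ((f c + f (c + 1)) / 2 - RInt (fun x => f (x + c) * dirichlet N x) 0 1)) by ring.
      eapply Rle_trans; [apply Rabs_triang|].
      replace (3 * K / INR N * (atan (c + 1) - atan (IZR a))) with
        (3 * K / INR N * (atan c - atan (IZR a)) + 3 * K / INR N * (atan (c + 1) - atan c)) by ring.
      apply Rplus_le_compat; [exact IH|]. rewrite Ey. eapply Rle_trans; [exact H|]. right. field. split; nra. }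
  eapply Rle_trans; [exact H|]. pose proof (atan_le_PI2 (IZR a + INR n) (IZR a)).
  replace (12 * K / INR N) with (3 * K / INR N * 4) by (field; lra).
  apply Rmult_le_compat_l; [|assumption]. apply Rmult_le_pos; [lra|left; apply Rinv_0_lt_compat, HN0].
Qed.

Open Scope C_scope.

(** * Complex exponential and limits *)

Lemma C_ext (z w : C) : Re z = Re w -> Im z = Im w -> z = w.
Proof. destruct z, w; simpl; congruence. Qed.

Lemma exp_le (x y : R) : (x <= y)%R -> (exp x <= exp y)%R.
Proof. intros [H| ->]; [left; apply exp_increasing, H|right; reflexivity]. Qed.

Lemma Cminus_0_r (z : C) : z - 0 = z.
Proof. ring. Qed.

Lemma RtoC_neq_0 (r : R) : r <> 0%R -> RtoC r <> 0.
Proof. intros H E. apply H. injection E. auto. Qed.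

Lemma Re_RtoC_mult (r : R) (z : C) : Re (r * z) = (r * Re z)%R.
Proof. destruct z; simpl; ring. Qed.

Lemma Im_RtoC_mult (r : R) (z : C) : Im (r * z) = (r * Im z)%R.
Proof. destruct z; simpl; ring. Qed.

Lemma Cmod_le_abs (z : C) : (Cmod z <= Rabs (Re z) + Rabs (Im z))%R.
Proof.
  replace z with (RtoC (Re z) + Ci * RtoC (Im z)) at 1 by (destruct z; apply C_ext; simpl; ring).
  eapply Rle_trans; [apply Cmod_triangle|].
  rewrite Cmod_mult, Cmod_Ci, !Cmod_R. lra.
Qed.

Lemma im_le_Cmod (z : C) : (Rabs (Im z) <= Cmod z)%R.
Proof. eapply Rle_trans; [apply Rmax_r | apply Rmax_Cmod]. Qed.

Lemma Cmod_sub_sym (z w : C) : Cmod (z - w) = Cmod (w - z).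
Proof. rewrite <- Cmod_opp. f_equal. ring. Qed.

Lemma Cmod_sub_triangle (z w v : C) : (Cmod (z - v) <= Cmod (z - w) + Cmod (w - v))%R.
Proof. replace (z - v) with ((z - w) + (w - v)) by ring. apply Cmod_triangle. Qed.

Lemma Cexp_plus (z w : C) : Cexp (z + w) = Cexp z * Cexp w.
Proof.
  unfold Cexp. destruct z as [a b], w as [c d]; simpl. rewrite exp_plus.
  apply C_ext; simpl; rewrite ?cos_plus, ?sin_plus; ring.
Qed.

Lemma Cexp_0 : Cexp 0 = 1.
Proof. unfold Cexp; simpl. rewrite exp_0, cos_0, sin_0. apply C_ext; simpl; ring. Qed.

Lemma Cmod_Cexp (z : C) : Cmod (Cexp z) = exp (Re z).
Proof.
  unfold Cexp. rewrite Cmod_mult, Cmod_R, Rabs_pos_eq by (left; apply exp_pos).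
  replace (Cmod _) with 1%R; [ring|].
  unfold Cmod; simpl. replace (_ + _)%R with ((sin (Im z))² + (cos (Im z))²)%R by (unfold Rsqr; ring).
  rewrite sin2_cos2, sqrt_1. reflexivity.
Qed.

Lemma Cexp_neq_0 (z : C) : Cexp z <> 0.
Proof. apply Cmod_gt_0. rewrite Cmod_Cexp. apply exp_pos. Qed.

Lemma Cexp_opp (z : C) : Cexp (- z) = / Cexp z.
Proof.
  assert (H : Cexp (- z) * Cexp z = 1) by (rewrite <- Cexp_plus; replace (- z + z) with (RtoC 0) by ring; apply Cexp_0).
  rewrite <- (Cmult_1_l (/ Cexp z)), <- H. field. apply Cexp_neq_0.
Qed.

Lemma Cexp_pow (z : C) (n : nat) : Cexp z ^ n = Cexp (INR n * z).
Proof.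
  induction n as [|n IH]; [simpl; rewrite Cmult_0_l, Cexp_0; reflexivity|].
  rewrite S_INR, RtoC_plus. simpl Cpow. rewrite IH, <- Cexp_plus. f_equal. ring.
Qed.

Lemma cis2pi_plus (z w : C) : cis2pi (z + w) = cis2pi z * cis2pi w.
Proof. unfold cis2pi. rewrite <- Cexp_plus. f_equal. ring. Qed.

Lemma cis2pi_0 : cis2pi 0 = 1.
Proof. unfold cis2pi. rewrite Cmult_0_r. apply Cexp_0. Qed.

Lemma cis2pi_neq_0 (z : C) : cis2pi z <> 0.
Proof. apply Cexp_neq_0. Qed.

Lemma cis2pi_opp (z : C) : cis2pi (- z) = / cis2pi z.
Proof. unfold cis2pi. rewrite <- Cexp_opp. f_equal. ring. Qed.

Lemma cis2pi_pow (z : C) (n : nat) : cis2pi z ^ n = cis2pi (INR n * z).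
Proof. unfold cis2pi. rewrite Cexp_pow. f_equal. ring. Qed.

Lemma Cmod_cis2pi (z : C) : Cmod (cis2pi z) = exp (- (2 * PI * Im z)).
Proof. unfold cis2pi. rewrite Cmod_Cexp. f_equal. destruct z; simpl; ring. Qed.

Lemma cis2pi_R (x : R) : cis2pi x = (cos (2 * PI * x), sin (2 * PI * x)).
Proof.
  unfold cis2pi, Cexp. replace (2 * PI * Ci * x) with (0%R, (2 * PI * x)%R) by (apply C_ext; simpl; ring).
  simpl. rewrite exp_0. apply C_ext; simpl; ring.
Qed.

Lemma cis2pi_Z (n : Z) : cis2pi (ZtoC n) = 1.
Proof.
  assert (E1 : cis2pi 1 = 1) by (rewrite cis2pi_R, Rmult_1_r, cos_2PI, sin_2PI; reflexivity).
  assert (En : forall k : nat, cis2pi (INR k) = 1).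
  { intros k. replace (RtoC (INR k)) with (INR k * 1) by ring.
    rewrite <- cis2pi_pow, E1. apply Cpow_1_l. }
  unfold ZtoC. destruct (Z_le_gt_dec 0 n) as [H|H].
  - rewrite <- (Z2Nat.id n H), <- INR_IZR_INZ. apply En.
  - replace n with (- Z.of_nat (Z.to_nat (- n)))%Z by lia.
    rewrite opp_IZR, <- INR_IZR_INZ, RtoC_opp, cis2pi_opp, En. field.
Qed.

Lemma ZtoC_plus (a b : Z) : ZtoC (a + b) = ZtoC a + ZtoC b.
Proof. unfold ZtoC. rewrite plus_IZR, RtoC_plus. reflexivity. Qed.
Lemma ZtoC_opp (a : Z) : ZtoC (- a) = - ZtoC a.
Proof. unfold ZtoC. rewrite opp_IZR, RtoC_opp. reflexivity. Qed.
Lemma ZtoC_sub (a b : Z) : ZtoC (a - b) = ZtoC a - ZtoC b.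
Proof. unfold ZtoC. rewrite minus_IZR, RtoC_minus. reflexivity. Qed.
Lemma ZtoC_mult (a b : Z) : ZtoC (a * b) = ZtoC a * ZtoC b.
Proof. unfold ZtoC. rewrite mult_IZR, RtoC_mult. reflexivity. Qed.
Lemma ZtoC_nat (n : nat) : ZtoC (Z.of_nat n) = INR n.
Proof. unfold ZtoC. rewrite <- INR_IZR_INZ. reflexivity. Qed.

Lemma upper_half_neq_0 (tau : C) : (0 < Im tau)%R -> tau <> 0.
Proof. intros H E. rewrite E in H. simpl in H. lra. Qed.

Lemma Im_inv (z : C) : z <> 0 -> Im (/ z) = (- Im z / Cmod z ^ 2)%R.
Proof. intros H. rewrite Cmod2_alt. destruct z; simpl. unfold Rdiv. reflexivity. Qed.

(** Convergence stated as a real null sequence, so that a majorant proves it ([Clim_bound]).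
    [CLim_eq] and [CSeries_eq] translate it to the componentwise limits of the definitions. *)
Definition Clim (u : nat -> C) (s : C) : Prop :=
  is_lim_seq (fun n => Cmod (u n - s)) 0%R.

Lemma is_lim_seq_0_le (u v : nat -> R) :
  (forall n, (0 <= u n <= v n)%R) -> is_lim_seq v 0%R -> is_lim_seq u 0%R.
Proof. intros H Hv. apply (is_lim_seq_le_le (fun _ => 0%R) u v); [exact H|apply is_lim_seq_const|exact Hv]. Qed.

Lemma Clim_bound (u : nat -> C) (s : C) (e : nat -> R) :
  (forall n, (Cmod (u n - s) <= e n)%R) -> is_lim_seq e 0%R -> Clim u s.
Proof. intros H. apply is_lim_seq_0_le. intros n. split; [apply Cmod_ge_0|apply H]. Qed.

Lemma Clim_ext (u v : nat -> C) (s : C) : (forall n, u n = v n) -> Clim u s -> Clim v s.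
Proof. intros H. apply is_lim_seq_ext. intros n. rewrite H. reflexivity. Qed.

Lemma Clim_ext_loc (u v : nat -> C) (s : C) (N : nat) :
  (forall n, (N <= n)%nat -> u n = v n) -> Clim u s -> Clim v s.
Proof. intros H. apply is_lim_seq_ext_loc. exists N. intros n Hn. rewrite H by exact Hn. reflexivity. Qed.

Lemma Clim_eq (u : nat -> C) (s t : C) : Clim u s -> s = t -> Clim u t.
Proof. intros H <-. exact H. Qed.

Lemma Clim_const (s : C) : Clim (fun _ => s) s.
Proof.
  apply is_lim_seq_ext with (fun _ => 0%R); [|apply is_lim_seq_const].
  intros _. replace (s - s) with (RtoC 0) by ring. rewrite Cmod_0. reflexivity.
Qed.

Lemma Clim_plus (u v : nat -> C) (s t : C) :
  Clim u s -> Clim v t -> Clim (fun n => u n + v n) (s + t).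
Proof.
  intros Hu Hv. apply Clim_bound with (fun n => (Cmod (u n - s) + Cmod (v n - t))%R).
  - intros n. replace (u n + v n - (s + t)) with ((u n - s) + (v n - t)) by ring. apply Cmod_triangle.
  - replace (Finite 0) with (Finite (0 + 0)) by (f_equal; lra). apply is_lim_seq_plus'; assumption.
Qed.

Lemma Clim_bounded (u : nat -> C) (s : C) : Clim u s -> exists B, forall n, (Cmod (u n) <= B)%R.
Proof.
  intros H. destruct (filterlim_bounded (K := R_AbsRing) (V := R_NormedModule) (fun n => Cmod (u n - s))) as [B HB];
    [exists 0%R; exact H|].
  exists (B + Cmod s)%R. intros n. specialize (HB n).
  change (Rabs (Cmod (u n - s)) <= B)%R in HB. rewrite Rabs_pos_eq in HB by apply Cmod_ge_0.
  replace (u n) with ((u n - s) + s) by ring. eapply Rle_trans; [apply Cmod_triangle|lra].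
Qed.

Lemma Clim_scal (c : C) (u : nat -> C) (s : C) : Clim u s -> Clim (fun n => c * u n) (c * s).
Proof.
  intros H. apply is_lim_seq_ext with (fun n => (Cmod c * Cmod (u n - s))%R).
  - intros n. rewrite <- Cmod_mult. f_equal. ring.
  - replace (Finite 0) with (Finite (Cmod c * 0)) by (f_equal; lra).
    apply (is_lim_seq_scal_l _ (Cmod c) 0%R). exact H.
Qed.

Lemma Clim_mult (u v : nat -> C) (s t : C) :
  Clim u s -> Clim v t -> Clim (fun n => u n * v n) (s * t).
Proof.
  intros Hu Hv. destruct (Clim_bounded u s Hu) as [B HB].
  apply Clim_bound with (fun n => (B * Cmod (v n - t) + Cmod t * Cmod (u n - s))%R).
  - intros n. replace (u n * v n - s * t) with (u n * (v n - t) + t * (u n - s)) by ring.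
    eapply Rle_trans; [apply Cmod_triangle|]. rewrite !Cmod_mult.
    apply Rplus_le_compat_r, Rmult_le_compat_r; [apply Cmod_ge_0|apply HB].
  - replace (Finite 0) with (Finite (B * 0 + Cmod t * 0)) by (f_equal; lra).
    apply is_lim_seq_plus'; [apply (is_lim_seq_scal_l _ B 0%R)|apply (is_lim_seq_scal_l _ (Cmod t) 0%R)]; assumption.
Qed.

Lemma Clim_Re (u : nat -> C) (s : C) : Clim u s -> is_lim_seq (fun n => Re (u n)) (Re s).
Proof.
  intros H. apply is_lim_seq_spec. intros eps. apply is_lim_seq_spec in H. specialize (H eps).
  destruct H as [N HN]. exists N. intros n Hn. specialize (HN n Hn).
  rewrite Rminus_0_r, Rabs_pos_eq in HN by apply Cmod_ge_0.
  eapply Rle_lt_trans; [|exact HN]. eapply Rle_trans; [|apply re_le_Cmod]. simpl. right; f_equal; ring.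
Qed.

Lemma Clim_Im (u : nat -> C) (s : C) : Clim u s -> is_lim_seq (fun n => Im (u n)) (Im s).
Proof.
  intros H. apply is_lim_seq_spec. intros eps. apply is_lim_seq_spec in H. specialize (H eps).
  destruct H as [N HN]. exists N. intros n Hn. specialize (HN n Hn).
  rewrite Rminus_0_r, Rabs_pos_eq in HN by apply Cmod_ge_0.
  eapply Rle_lt_trans; [|exact HN]. eapply Rle_trans; [|apply im_le_Cmod]. simpl. right; f_equal; ring.
Qed.

Lemma Clim_of_Re_Im (u : nat -> C) (s : C) :
  is_lim_seq (fun n => Re (u n)) (Re s) -> is_lim_seq (fun n => Im (u n)) (Im s) -> Clim u s.
Proof.
  intros H1 H2.
  apply Clim_bound with (fun n => (Rabs (Re (u n) - Re s) + Rabs (Im (u n) - Im s))%R).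
  - intros n. eapply Rle_trans; [apply Cmod_le_abs|]. right. simpl. reflexivity.
  - replace (Finite 0) with (Finite (Rabs 0 + Rabs 0)) by (f_equal; rewrite Rabs_R0; lra).
    apply is_lim_seq_plus'; apply (is_lim_seq_abs _ 0%R).
    + replace (Finite 0) with (Finite (Re s - Re s)) by (f_equal; lra). apply is_lim_seq_minus'; [exact H1|apply is_lim_seq_const].
    + replace (Finite 0) with (Finite (Im s - Im s)) by (f_equal; lra). apply is_lim_seq_minus'; [exact H2|apply is_lim_seq_const].
Qed.

Lemma Clim_unique (u : nat -> C) (s t : C) : Clim u s -> Clim u t -> s = t.
Proof.
  intros H1 H2. apply C_ext.
  - apply Clim_Re in H1. apply Clim_Re in H2. apply is_lim_seq_unique in H1. apply is_lim_seq_unique in H2.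
    rewrite H1 in H2. injection H2. auto.
  - apply Clim_Im in H1. apply Clim_Im in H2. apply is_lim_seq_unique in H1. apply is_lim_seq_unique in H2.
    rewrite H1 in H2. injection H2. auto.
Qed.

Lemma CLim_eq (u : nat -> C) (s : C) : Clim u s -> CLim u = s.
Proof.
  intros H. unfold CLim. apply C_ext; simpl.
  - rewrite (is_lim_seq_unique _ _ (Clim_Re _ _ H)). reflexivity.
  - rewrite (is_lim_seq_unique _ _ (Clim_Im _ _ H)). reflexivity.
Qed.

Lemma Clim_sub (u : nat -> C) (s : C) (phi : nat -> nat) :
  (forall n, (n <= phi n)%nat) -> Clim u s -> Clim (fun n => u (phi n)) s.
Proof.
  intros Hphi H. apply (is_lim_seq_subseq (fun n => Cmod (u n - s)) 0%R phi); [|exact H].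
  intros P [N HN]. exists N. intros n Hn. apply HN. specialize (Hphi n). lia.
Qed.

Fixpoint Csum (u : nat -> C) (n : nat) : C :=
  match n with O => 0 | S m => Csum u m + u m end.

Lemma Csum_ext (u v : nat -> C) (n : nat) :
  (forall i, (i < n)%nat -> u i = v i) -> Csum u n = Csum v n.
Proof. induction n as [|n IH]; intros H; [reflexivity|]. simpl. rewrite IH, H by (intros; try apply H; lia). reflexivity. Qed.

Lemma Csum_plus (u v : nat -> C) (n : nat) : Csum (fun i => u i + v i) n = Csum u n + Csum v n.
Proof. induction n as [|n IH]; simpl; [ring|rewrite IH; ring]. Qed.

Lemma Csum_scal (c : C) (u : nat -> C) (n : nat) : Csum (fun i => c * u i) n = c * Csum u n.
Proof. induction n as [|n IH]; simpl; [ring|rewrite IH; ring]. Qed.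

Lemma Re_Csum (u : nat -> C) (n : nat) : Re (Csum u (S n)) = sum_n (fun i => Re (u i)) n.
Proof.
  induction n as [|n IH]; [simpl; rewrite sum_O; destruct (u 0%nat); simpl; ring|].
  rewrite sum_Sn, <- IH. reflexivity.
Qed.

Lemma Im_Csum (u : nat -> C) (n : nat) : Im (Csum u (S n)) = sum_n (fun i => Im (u i)) n.
Proof.
  induction n as [|n IH]; [simpl; rewrite sum_O; destruct (u 0%nat); simpl; ring|].
  rewrite sum_Sn, <- IH. reflexivity.
Qed.

Lemma CSeries_eq (u : nat -> C) (s : C) : Clim (Csum u) s -> CSeries u = s.
Proof.
  (* [sum_n] includes its upper index and [Csum] does not, hence the passage to the subsequence
     [S]. *)
  intros H. apply (Clim_sub _ _ S) in H; [|intros; lia]. unfold CSeries. apply C_ext; simpl; apply is_series_unique.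
  - change (is_lim_seq (sum_n (fun n => Re (u n))) (Re s)).
    apply is_lim_seq_ext with (fun n => Re (Csum u (S n))); [apply Re_Csum|]. apply (Clim_Re _ _ H).
  - change (is_lim_seq (sum_n (fun n => Im (u n))) (Im s)).
    apply is_lim_seq_ext with (fun n => Im (Csum u (S n))); [apply Im_Csum|]. apply (Clim_Im _ _ H).
Qed.

Lemma CSeries_finite (u : nat -> C) (N : nat) :
  (forall n, (N <= n)%nat -> u n = 0) -> CSeries u = Csum u N.
Proof.
  intros H. apply CSeries_eq. apply Clim_ext_loc with (fun _ => Csum u N) N; [|apply Clim_const].
  intros n Hn. induction Hn as [|m Hm IH]; [reflexivity|]. simpl. rewrite <- IH, H by exact Hm. ring.
Qed.

Lemma CSeries_0 (u : nat -> C) : (forall n, u n = 0) -> CSeries u = 0.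
Proof. intros H. rewrite (CSeries_finite u 0); [reflexivity|auto]. Qed.

Lemma CSeries_neq_0 (u : nat -> C) : CSeries u <> 0 -> exists n, u n <> 0.
Proof.
  intros H. apply Classical_Prop.NNPP. intros Hn. apply H, CSeries_0. intros n.
  apply Classical_Prop.NNPP. intros Hu. apply Hn. exists n. exact Hu.
Qed.

Lemma ex_Clim_Csum (u : nat -> C) (b : nat -> R) :
  (forall n, (Cmod (u n) <= b n)%R) -> ex_series b -> exists s, Clim (Csum u) s.
Proof.
  intros H Hb.
  assert (HR : ex_series (fun n => Re (u n))).
  { apply (ex_series_le (K := R_AbsRing) (V := R_CompleteNormedModule) _ b); [|exact Hb].
    intros n. eapply Rle_trans; [apply re_le_Cmod|apply H]. }
  assert (HI : ex_series (fun n => Im (u n))).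
  { apply (ex_series_le (K := R_AbsRing) (V := R_CompleteNormedModule) _ b); [|exact Hb].
    intros n. eapply Rle_trans; [apply im_le_Cmod|apply H]. }
  destruct HR as [sr Hr], HI as [si Hi]. exists (sr, si).
  apply Clim_of_Re_Im; apply is_lim_seq_incr_1; simpl.
  - apply is_lim_seq_ext with (sum_n (fun i => Re (u i))); [intros; symmetry; apply Re_Csum|exact Hr].
  - apply is_lim_seq_ext with (sum_n (fun i => Im (u i))); [intros; symmetry; apply Im_Csum|exact Hi].
Qed.

(** * Irreducibility *)

Fixpoint degree_upto (mu : positive -> nat) (n : nat) : nat :=
  match n with
  | O => O
  | S m => (degree_upto mu m + S m * mu (Pos.of_succ_nat m))%nat
  end.

(** A uniform bound on the partial degrees says at once that the support is finite and the total
    degree at most [D], without forming an infinite sum. *)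
Definition degree_le (mu : positive -> nat) (D : nat) : Prop := forall n, (degree_upto mu n <= D)%nat.

Lemma upd_eq mu p v : upd mu p v p = v.
Proof. unfold upd. rewrite Pos.eqb_refl. reflexivity. Qed.

Lemma upd_neq mu p v r : r <> p -> upd mu p v r = mu r.
Proof. intros H. unfold upd. destruct (Pos.eqb_spec r p); congruence. Qed.

Lemma upd_upd mu p v w : upd (upd mu p v) p w = upd mu p w.
Proof. apply functional_extensionality. intros r. unfold upd. destruct (Pos.eqb r p); reflexivity. Qed.

Lemma upd_same mu p : upd mu p (mu p) = mu.
Proof. apply functional_extensionality. intros r. unfold upd. destruct (Pos.eqb_spec r p); congruence. Qed.

Lemma degree_upto_upd mu p v n :
  ((n < Pos.to_nat p)%nat /\ degree_upto (upd mu p v) n = degree_upto mu n) \/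
  ((Pos.to_nat p <= n)%nat /\
   (degree_upto (upd mu p v) n + Pos.to_nat p * mu p = degree_upto mu n + Pos.to_nat p * v)%nat).
Proof.
  induction n as [|n IH]; [left; split; [lia|reflexivity]|].
  simpl degree_upto. set (q := Pos.of_succ_nat n) in *.
  assert (Hq : Pos.to_nat q = S n) by (unfold q; lia).
  destruct (Pos.eq_dec q p) as [E|E].
  - right. subst p. rewrite upd_eq. destruct IH as [[_ IH]|[IH _]]; [|lia]. rewrite IH, Hq. lia.
  - rewrite upd_neq by exact E.
    assert (Pos.to_nat q <> Pos.to_nat p) by (intro H; apply E, Pos2Nat.inj, H).
    destruct IH as [[H1 IH]|[H1 IH]]; [left|right]; split; lia.
Qed.

Lemma degree_upto_mono mu n m : (n <= m)%nat -> (degree_upto mu n <= degree_upto mu m)%nat.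
Proof. induction 1; simpl; lia. Qed.

Lemma degree_le_set mu p v D : mu p = S v -> degree_le (upd mu p v) D -> degree_le mu (D + Pos.to_nat p).
Proof.
  intros E H n. specialize (H n). destruct (degree_upto_upd mu p v n) as [[_ H1]|[_ H1]]; rewrite ?E in H1; lia.
Qed.

Lemma degree_le_succ mu p D : degree_le (upd mu p (S (mu p))) D ->
  forall n, (degree_upto mu n + Pos.to_nat p <= D)%nat.
Proof.
  intros H n. pose proof (degree_upto_mono mu n (Nat.max n (Pos.to_nat p)) ltac:(lia)).
  specialize (H (Nat.max n (Pos.to_nat p))).
  destruct (degree_upto_upd mu p (S (mu p)) (Nat.max n (Pos.to_nat p))) as [[H1 _]|[_ H1]]; lia.
Qed.

Lemma degree_le_val mu D p : degree_le mu D -> (Pos.to_nat p * mu p <= D)%nat.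
Proof.
  intros H. specialize (H (Pos.to_nat p)). destruct (Pos2Nat.is_succ p) as [m Hm].
  rewrite Hm in *. simpl degree_upto in H. replace (Pos.of_succ_nat m) with p in H by lia. lia.
Qed.

Lemma degree_upto_finite mu N n : (forall p, (N < Pos.to_nat p)%nat -> mu p = O) -> (degree_upto mu n <= degree_upto mu N)%nat.
Proof.
  intros H. induction n as [|n IH]; [simpl; lia|].
  destruct (le_lt_dec (S n) N) as [L|L]; [apply degree_upto_mono, L|].
  simpl. rewrite H by lia. lia.
Qed.

Lemma finite_occ_dle mu : finite_occ mu <-> exists D, degree_le mu D.
Proof.
  split.
  - intros [N HN]. exists (degree_upto mu (Pos.to_nat N)). intros n. apply degree_upto_finite. intros p Hp. apply HN. lia.
  - intros [D HD]. exists (Pos.of_nat (S D)). intros p Hp. pose proof (degree_le_val mu D p HD).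
    assert (D < Pos.to_nat p)%nat by lia. nia.
Qed.

(** Values are bounded by [V] and the support by [n]. Cutting by a box rather than by degree lets
    the generating function factor mode by mode in [box_sum_euler]. *)
Fixpoint occ_box (V n : nat) : list (positive -> nat) :=
  match n with
  | O => [fun _ => O]
  | S m => map (fun x => upd (fst x) (Pos.of_succ_nat m) (snd x))
             (list_prod (occ_box V m) (seq 0 (S V)))
  end.

Lemma in_occ_box V n : forall mu,
  In mu (occ_box V n) <->
  (forall p, (mu p <= V)%nat) /\ (forall p, (n < Pos.to_nat p)%nat -> mu p = O).
Proof.
  induction n as [|n IH]; intros mu; cbn [occ_box].
  - split.
    + intros [<-|[]]. split; intros; lia.
    + intros [_ H]. left. apply functional_extensionality. intros p. rewrite H by lia. reflexivity.
  - set (q := Pos.of_succ_nat n). rewrite in_map_iff. split.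
    + intros [[mu' v] [<- H]]. apply in_prod_iff in H. destruct H as [H1 H2].
      apply IH in H1. apply in_seq in H2. destruct H1 as [H1 H3]. simpl. split; intros p.
      * unfold upd. destruct (Pos.eqb p q); [lia|apply H1].
      * intros Hp. rewrite upd_neq by lia. apply H3. lia.
    + intros [H1 H2]. exists (upd mu q 0, mu q). cbn [fst snd]. rewrite upd_upd, upd_same. split; [reflexivity|].
      apply in_prod_iff. split.
      * apply IH. split; intros p; unfold upd; destruct (Pos.eqb_spec p q); try lia; try apply H1.
        intros Hp. apply H2. lia.
      * apply in_seq. specialize (H1 q). lia.
Qed.

Definition Zrange (N : nat) : list Z :=
  map (fun i => (Z.of_nat i - Z.of_nat N)%Z) (seq 0 (2 * N + 1)).

Lemma in_Zrange N z : In z (Zrange N) <-> (Z.abs z <= Z.of_nat N)%Z.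
Proof.
  unfold Zrange. rewrite in_map_iff. split.
  - intros [i [<- H]]. apply in_seq in H. lia.
  - intros H. exists (Z.to_nat (z + Z.of_nat N)). split; [lia|]. apply in_seq. lia.
Qed.

Definition state_of (nu : R) (x : Z * (positive -> nat) * (positive -> nat)) : state :=
  State (nu + IZR (fst (fst x))) (snd (fst x)) (snd x).

Definition state_box (nu : R) (N : nat) : list state :=
  map (state_of nu) (list_prod (list_prod (Zrange N) (occ_box N N)) (occ_box N N)).

Definition lam_le (nu : R) (D : nat) (x : R) : Prop :=
  exists z : Z, (Z.abs z <= Z.of_nat D)%Z /\ x = (nu + IZR z)%R.

Definition state_le (nu : R) (D : nat) (s : state) : Prop :=
  lam_le nu D (lam s) /\ degree_le (occ_a s) D /\ degree_le (occ_d s) D.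

Lemma degree_le_box mu D : degree_le mu D -> In mu (occ_box D D).
Proof.
  intros H. apply in_occ_box. split; intros p; pose proof (degree_le_val mu D p H); nia.
Qed.

Lemma state_le_box nu D s : state_le nu D s -> In s (state_box nu D).
Proof.
  intros [[z [Hz Ez]] [Ha Hd]]. apply in_map_iff. exists (z, occ_a s, occ_d s). split.
  - unfold state_of; simpl. rewrite <- Ez. destruct s; reflexivity.
  - apply in_prod_iff. split; [|apply degree_le_box, Hd].
    apply in_prod_iff. split; [apply in_Zrange, Hz|apply degree_le_box, Ha].
Qed.

Lemma lam_le_mono nu D D' x : (D <= D')%nat -> lam_le nu D x -> lam_le nu D' x.
Proof. intros H [z [Hz E]]. exists z. split; [lia|exact E]. Qed.

Lemma degree_le_mono mu D D' : (D <= D')%nat -> degree_le mu D -> degree_le mu D'.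
Proof. intros H H' n. specialize (H' n). lia. Qed.

Lemma state_le_mono nu D D' s : (D <= D')%nat -> state_le nu D s -> state_le nu D' s.
Proof.
  intros H [H1 [H2 H3]]. split; [|split]; [eapply lam_le_mono|eapply degree_le_mono|eapply degree_le_mono]; eassumption.
Qed.

Definition good_state (nu : R) (s : state) : Prop :=
  in_coset nu (lam s) /\ finite_occ (occ_a s) /\ finite_occ (occ_d s).

Lemma good_state_le nu s : good_state nu s <-> exists D, state_le nu D s.
Proof.
  split.
  - intros [[z Hz] [Ha Hd]]. apply finite_occ_dle in Ha. apply finite_occ_dle in Hd.
    destruct Ha as [A HA], Hd as [B HB]. exists (Z.abs_nat z + A + B)%nat. split; [|split].
    + exists z. split; [lia|exact Hz].
    + eapply degree_le_mono; [|exact HA]; lia.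
    + eapply degree_le_mono; [|exact HB]; lia.
  - intros [D [[z [_ Hz]] [Ha Hd]]]. split; [exists z; exact Hz|].
    split; apply finite_occ_dle; eexists; eassumption.
Qed.

Definition supp_le (nu : R) (D : nat) (g : vec) : Prop := forall s, g s <> 0 -> state_le nu D s.

Lemma supp_le_mono nu D D' g : (D <= D')%nat -> supp_le nu D g -> supp_le nu D' g.
Proof. intros H Hg s Hs. eapply state_le_mono; [exact H|apply Hg, Hs]. Qed.

Lemma state_box_good nu D s : In s (state_box nu D) -> good_state nu s.
Proof.
  intros H. apply in_map_iff in H. destruct H as [[[z mu] mu'] [<- H]].
  apply in_prod_iff in H. destruct H as [H H'']. apply in_prod_iff in H. destruct H as [_ H'].
  apply in_occ_box in H'. apply in_occ_box in H''. unfold good_state, state_of; simpl.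
  split; [exists z; reflexivity|].
  split; exists (Pos.of_nat (S D)); intros p Hp; [apply H'|apply H'']; lia.
Qed.

(** A single bound replaces the list of states: the bounds of the listed states add up to one, and a
    bound gives back the finite list [state_box]. Closure under an operator becomes an estimate of
    how the operator moves [D]. *)
Lemma in_Pi_supp nu g : in_Pi nu g <-> exists D, supp_le nu D g.
Proof.
  split.
  - intros [L [HL Hg]]. assert (H : exists D, forall s, In s L -> state_le nu D s).
    { clear g Hg. induction L as [|s L IH]; [exists O; intros s []|].
      destruct IH as [D HD]; [intros t Ht; apply HL; right; exact Ht|].
      destruct (proj1 (good_state_le nu s) (HL s (or_introl eq_refl))) as [D' HD'].
      exists (D + D')%nat. intros t [<-|Ht];
        [apply (state_le_mono nu D')|apply (state_le_mono nu D); [|apply HD, Ht]]; try assumption; lia. }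
    destruct H as [D HD]. exists D. intros s Hs. apply HD, Hg, Hs.
  - intros [D HD]. exists (state_box nu D). split; [apply state_box_good|].
    intros s Hs. apply state_le_box, HD, Hs.
Qed.

Lemma Cmult_neq_0_inv (a b : C) : a * b <> 0 -> a <> 0 /\ b <> 0.
Proof. intros H. split; intros E; apply H; rewrite E; ring. Qed.

Lemma supp_le_vadd nu D g h : supp_le nu D g -> supp_le nu D h -> supp_le nu D (vadd g h).
Proof.
  intros Hg Hh s Hs. destruct (excluded_middle_informative (g s = 0)) as [E|E]; [|apply Hg, E].
  apply Hh. intros E'. apply Hs. unfold vadd. rewrite E, E'. ring.
Qed.

(* [occ true] counts the [a]-oscillators and [occ false] the [d]-oscillators;
   by [a_m, d_n] = 2 m delta_{m+n,0}, [lower b] removes what [raise b] creates. *)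
Definition occ (b : bool) (s : state) : positive -> nat := if b then occ_a s else occ_d s.

Definition set_occ (b : bool) : state -> positive -> nat -> state := if b then set_a else set_d.

Definition raise (l : Z) (b : bool) (p : positive) : op := if b then mode_a l (Zneg p) else mode_d (Zneg p).

Definition lower (l : Z) (b : bool) (p : positive) : op := if b then mode_d (Zpos p) else mode_a l (Zpos p).

Lemma raise_eq l b p g s :
  raise l b p g s = match occ b s p with O => RtoC 0 | S v => g (set_occ b s p v) end.
Proof. destruct b; reflexivity. Qed.

Lemma lower_eq l b p g s :
  lower l b p g s = ZtoC (2 * Zpos p) * INR (S (occ b s p)) * g (set_occ b s p (S (occ b s p))).
Proof. destruct b; reflexivity. Qed.

Lemma supp_le_raise nu D l b p g : supp_le nu D g -> supp_le nu (D + Pos.to_nat p) (raise l b p g).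
Proof.
  intros Hg s Hs. rewrite raise_eq in Hs. destruct (occ b s p) as [|v] eqn:E; [congruence|].
  apply Hg in Hs. destruct Hs as [H1 [H2 H3]].
  destruct b; simpl in *; (split; [|split]); first
    [eapply lam_le_mono; [|exact H1]|exact (degree_le_set _ _ _ _ E H2)|exact (degree_le_set _ _ _ _ E H3)
    |eapply degree_le_mono; [|exact H2]|eapply degree_le_mono; [|exact H3]]; lia.
Qed.

Lemma supp_le_lower nu D l b p g : supp_le nu D g -> supp_le nu D (lower l b p g).
Proof.
  intros Hg s Hs. rewrite lower_eq in Hs. apply Cmult_neq_0_inv in Hs. destruct Hs as [_ Hs].
  apply Hg in Hs. destruct Hs as [H1 [H2 H3]].
  destruct b; simpl in *; (split; [exact H1|split]); try assumption; intros m;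
    [pose proof (degree_le_succ _ _ _ H2 m)|pose proof (degree_le_succ _ _ _ H3 m)]; lia.
Qed.

Lemma supp_le_scal nu D (c : state -> C) g : supp_le nu D g -> supp_le nu D (fun s => c s * g s).
Proof. intros Hg s Hs. apply Cmult_neq_0_inv in Hs. apply Hg, Hs. Qed.

Lemma list_sum_neq_0 {J : Type} (f : J -> C) (L : list J) :
  list_sum f L <> 0 -> exists j, In j L /\ f j <> 0.
Proof.
  induction L as [|j L IH]; intros H; [exfalso; apply H; reflexivity|].
  destruct (excluded_middle_informative (f j = 0)) as [E|E]; [|exists j; split; [left; reflexivity|exact E]].
  destruct IH as [i [Hi Ei]].
  - intros E'. apply H. unfold list_sum in *. simpl. rewrite E, E'. ring.
  - exists i. split; [right; exact Hi|exact Ei].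
Qed.

(** If [x p] has weight [p], the coefficient of z^j has weight [j]. [Q] is an arbitrary condition on
    supports graded by this weight: it serves to count removed [d]-degree, to count added [a]-degree
    and, as [False], to propagate the zero vector. *)
Lemma exp_coeff_supp (Q : nat -> state -> Prop) (c : C) (x : positive -> op) :
  (forall p k (h : vec), (forall s, h s <> 0 -> Q k s) ->
     forall s, x p h s <> 0 -> Q (k + Pos.to_nat p)%nat s) ->
  forall fuel j (g : vec) k, (forall s, g s <> 0 -> Q k s) ->
  forall s, exp_coeff c x fuel j g s <> 0 -> Q (k + j)%nat s.
Proof.
  intros Hx fuel. induction fuel as [|f IH]; intros [|j] g k Hg s Hs.
  - rewrite Nat.add_0_r. apply Hg, Hs.
  - exfalso. apply Hs. reflexivity.
  - rewrite Nat.add_0_r. apply Hg, Hs.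
  - cbn [exp_coeff] in Hs. apply Cmult_neq_0_inv in Hs. destruct Hs as [_ Hs].
    apply list_sum_neq_0 in Hs. destruct Hs as [i [Hi Hs]]. apply in_seq in Hi.
    replace (k + S j)%nat with ((k + (j - i)) + Pos.to_nat (Pos.of_succ_nat i))%nat by lia.
    revert s Hs. apply Hx. apply IH. exact Hg.
Qed.

(** The coefficient of index [j] of the annihilating exponential removes [d]-degree [j], so a
    nonzero term has [j <= D]. The index [i] of the creating exponential is then at most
    [D + |r - m * (l - 1)|], which bounds the [a]-degree that it adds. *)
Lemma supp_le_mode_exp nu D l m r g :
  supp_le nu D g ->
  supp_le nu (3 * D + Z.abs_nat m + Z.abs_nat (r - m * (l - 1))) (mode_exp l m r g).
Proof.
  intros Hg s Hs. unfold mode_exp in Hs. apply CSeries_neq_0 in Hs. destruct Hs as [j Hs].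
  cbv zeta in Hs. set (i := (r - m * (l - 1) + Z.of_nat j)%Z) in *.
  destruct (i <? 0)%Z eqn:Ei; [exfalso; apply Hs; reflexivity|]. apply Z.ltb_ge in Ei.
  pose (D1 := (D + Z.abs_nat m)%nat).
  assert (H1 : forall s, exp_coeff (- ZtoC m) (fun p => mode_a l (Zpos p)) j j (shift m g) s <> 0 ->
    lam_le nu D1 (lam s) /\ degree_le (occ_a s) D /\ forall n, (degree_upto (occ_d s) n + j <= D)%nat).
  { intros t Ht. refine (exp_coeff_supp (fun k s => lam_le nu D1 (lam s) /\ degree_le (occ_a s) D /\
      forall n, (degree_upto (occ_d s) n + k <= D)%nat) _ _ _ _ _ _ 0%nat _ t Ht); clear t Ht.
    - intros p k h Hh t Ht. simpl in Ht. apply Cmult_neq_0_inv in Ht. destruct Ht as [_ Ht].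
      apply Hh in Ht. destruct Ht as [T1 [T2 T3]]. split; [exact T1|split; [exact T2|]]. intros n.
      assert (D3 : degree_le (occ_d (set_d t p (S (occ_d t p)))) (D - k)) by (intros n'; specialize (T3 n'); lia).
      pose proof (degree_le_succ _ _ _ D3 n). specialize (T3 O). lia.
    - intros t Ht. apply Hg in Ht. destruct Ht as [[z [Hz Ez]] [T2 T3]]. simpl in *.
      split; [|split; [exact T2|intros n; specialize (T3 n); lia]].
      exists (z + m)%Z. split; [unfold D1; lia|]. rewrite plus_IZR. lra. }
  set (h := exp_coeff (- ZtoC m) (fun p => mode_a l (Zpos p)) j j (shift m g)) in *.
  assert (H2 : lam_le nu D1 (lam s) /\ degree_le (occ_a s) (D + (0 + Z.to_nat i)) /\ degree_le (occ_d s) D /\ (j <= D)%nat).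
  { refine (exp_coeff_supp (fun k s => lam_le nu D1 (lam s) /\ degree_le (occ_a s) (D + k) /\
      degree_le (occ_d s) D /\ (j <= D)%nat) _ _ _ _ _ _ 0%nat _ s Hs).
    - intros p k h' Hh t Ht. simpl in Ht. destruct (occ_a t p) as [|v] eqn:E; [congruence|].
      apply Hh in Ht. destruct Ht as [T1 [T2 T3]]. split; [exact T1|split; [|exact T3]].
      eapply degree_le_mono; [|exact (degree_le_set _ _ _ _ E T2)]. lia.
    - intros t Ht. apply H1 in Ht. destruct Ht as [T1 [T2 T3]]. split; [exact T1|].
      split; [eapply degree_le_mono; [|exact T2]; lia|]. split; [intros n; specialize (T3 n); lia|specialize (T3 O); lia]. }
  destruct H2 as [T1 [T2 [T3 T4]]]. unfold D1 in *.
  split; [|split]; [eapply lam_le_mono; [|exact T1]|eapply degree_le_mono; [|exact T2]|eapply degree_le_mono; [|exact T3]]; lia.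
Qed.

Lemma in_Pi_submodule l nu : Pi_submodule l nu (in_Pi nu).
Proof.
  split; [auto|]. split; [|split; [|split; [|split; [|split]]]].
  - apply in_Pi_supp. exists O. intros s Hs. exfalso. apply Hs. reflexivity.
  - intros g h Hg Hh. apply in_Pi_supp in Hg. apply in_Pi_supp in Hh. apply in_Pi_supp.
    destruct Hg as [D HD], Hh as [D' HD']. exists (D + D')%nat.
    apply supp_le_vadd; [eapply supp_le_mono; [|exact HD]|eapply supp_le_mono; [|exact HD']]; lia.
  - intros c g Hg. apply in_Pi_supp in Hg. apply in_Pi_supp. destruct Hg as [D HD]. exists D.
    intros s Hs. apply Cmult_neq_0_inv in Hs. apply HD, Hs.
  - intros n g Hg. apply in_Pi_supp in Hg. apply in_Pi_supp. destruct Hg as [D HD]. destruct n as [|p|p].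
    + exists D. apply (supp_le_scal nu D (fun _ => ZtoC (l - 1))), HD.
    + exists D. apply (supp_le_lower nu D l false p g HD).
    + eexists. apply (supp_le_raise nu D l true p g HD).
  - intros n g Hg. apply in_Pi_supp in Hg. apply in_Pi_supp. destruct Hg as [D HD]. destruct n as [|p|p].
    + exists D. apply (supp_le_scal nu D (fun s => 2 * lam s)), HD.
    + exists D. apply (supp_le_lower nu D l true p g HD).
    + eexists. apply (supp_le_raise nu D l false p g HD).
  - intros m r g Hg. apply in_Pi_supp in Hg. apply in_Pi_supp. destruct Hg as [D HD].
    eexists. apply supp_le_mode_exp, HD.
Qed.

(** Equality of states is decided classically, since [lam] is a real number and the occupations are
    functions. *)
Definition delta (s0 : state) : vec := fun s => if excluded_middle_informative (s = s0) then 1 else 0.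

Lemma delta_eq s : delta s s = 1.
Proof. unfold delta. destruct (excluded_middle_informative (s = s)); congruence. Qed.

Lemma delta_neq s t : t <> s -> delta s t = 0.
Proof. intros H. unfold delta. destruct (excluded_middle_informative (t = s)); congruence. Qed.

Lemma set_occ_set_occ b s p v w : set_occ b (set_occ b s p v) p w = set_occ b s p w.
Proof. destruct b; simpl; unfold set_a, set_d; simpl; rewrite upd_upd; reflexivity. Qed.

Lemma set_occ_same b s p : set_occ b s p (occ b s p) = s.
Proof. destruct b, s; simpl; unfold set_a, set_d; simpl; rewrite upd_same; reflexivity. Qed.

Lemma occ_set_occ b s p v : occ b (set_occ b s p v) p = v.
Proof. destruct b; apply upd_eq. Qed.

(** This product is, up to the factor [2 * p], the number operator of one mode. It serves twice: its
    eigenvalues separate monomials inside a submodule, and they give the oscillator part of the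
    spectrum of [T0]. *)
Lemma raise_lower l b p g s :
  raise l b p (lower l b p g) s = ZtoC (2 * Zpos p) * INR (occ b s p) * g s.
Proof.
  rewrite raise_eq. destruct (occ b s p) as [|v] eqn:E; [simpl INR; ring|].
  rewrite lower_eq, occ_set_occ, set_occ_set_occ, <- E, set_occ_same. reflexivity.
Qed.

Lemma mode_a_mode_d l p g s :
  mode_a l (Zneg p) (mode_d (Zpos p) g) s = ZtoC (2 * Zpos p) * INR (occ_a s p) * g s.
Proof. exact (raise_lower l true p g s). Qed.

Lemma mode_d_mode_a l p g s :
  mode_d (Zneg p) (mode_a l (Zpos p) g) s = ZtoC (2 * Zpos p) * INR (occ_d s p) * g s.
Proof. exact (raise_lower l false p g s). Qed.

Lemma raise_delta l b p s : raise l b p (delta s) = delta (set_occ b s p (S (occ b s p))).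
Proof.
  apply functional_extensionality. intros t. rewrite raise_eq.
  destruct (excluded_middle_informative (t = set_occ b s p (S (occ b s p)))) as [E|E].
  - rewrite E, delta_eq, occ_set_occ, set_occ_set_occ, set_occ_same. apply delta_eq.
  - rewrite (delta_neq _ t) by exact E. destruct (occ b t p) as [|v] eqn:Ev; [reflexivity|].
    apply delta_neq. intros E'. apply E.
    rewrite <- E', occ_set_occ, set_occ_set_occ, <- Ev, set_occ_same. reflexivity.
Qed.

Lemma lower_delta l b p s v : occ b s p = S v ->
  lower l b p (delta s) = vscal (ZtoC (2 * Zpos p) * INR (S v)) (delta (set_occ b s p v)).
Proof.
  intros Hv. apply functional_extensionality. intros t. unfold vscal. rewrite lower_eq.
  destruct (excluded_middle_informative (t = set_occ b s p v)) as [E|E].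
  - rewrite E, delta_eq, occ_set_occ, set_occ_set_occ, <- Hv, set_occ_same, delta_eq. reflexivity.
  - rewrite (delta_neq _ t) by exact E. rewrite delta_neq; [ring|].
    intros E'. apply E. rewrite <- E' in *. rewrite occ_set_occ in Hv. injection Hv as <-.
    rewrite set_occ_set_occ, set_occ_same. reflexivity.
Qed.

(** On a vacuum the factor z^{m a_0} puts the leading coefficient of the field in degree
    [m * (l - 1)], and this coefficient only translates the momentum. It is what joins the Fock
    spaces of different [lam]. *)
Lemma mode_exp_vacuum l m x :
  mode_exp l m (m * (l - 1)) (delta (State x (fun _ => O) (fun _ => O)))
  = delta (State (x + IZR m) (fun _ => O) (fun _ => O)).
Proof.
  apply functional_extensionality. intros s. unfold mode_exp.
  rewrite (CSeries_finite _ 1).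
  - simpl. rewrite Z.sub_diag. simpl. rewrite Cplus_0_l. unfold shift.
    destruct (excluded_middle_informative (s = State (x + IZR m) (fun _ => O) (fun _ => O))) as [->|E].
    + rewrite delta_eq. simpl. replace (x + IZR m - IZR m)%R with x by ring. apply delta_eq.
    + rewrite (delta_neq _ s) by exact E. apply delta_neq. intros E'. apply E. destruct s as [y a d].
      injection E' as E1 E2 E3. simpl in *. subst. f_equal. lra.
  - intros j Hj. cbv zeta. destruct (_ <? 0)%Z; [reflexivity|].
    apply Classical_Prop.NNPP. intros Hs.
    (* For [j > 0] the annihilating factor already vanishes: a state in its support would force
       degree at least [j] on a vacuum. The creating factor then acts on zero, which is the case
       where [Q] is [False]. *)
    refine (exp_coeff_supp (fun _ _ => False) _ _ _ _ _ _ 0%nat _ s Hs).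
    + intros p k h Hh t Ht. simpl in Ht. destruct (occ_a t p); [congruence|]. exact (Hh _ Ht).
    + clear s Hs. intros s Hs.
      assert (H : forall n, (degree_upto (occ_d s) n + (0 + j) <= 0)%nat); [|specialize (H O); lia].
      refine (exp_coeff_supp (fun k s => forall n, (degree_upto (occ_d s) n + k <= 0)%nat) _ _ _ _ _ _ 0%nat _ s Hs).
      * intros p k h Hh t Ht. simpl in Ht. apply Cmult_neq_0_inv in Ht. destruct Ht as [_ Ht].
        specialize (Hh _ Ht). intros n.
        assert (D3 : degree_le (occ_d (set_d t p (S (occ_d t p)))) (0 - k)) by (intros n'; specialize (Hh n'); lia).
        pose proof (degree_le_succ _ _ _ D3 n). lia.
      * intros t Ht n. unfold shift in Ht. destruct t as [y a d]. simpl in *.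
        assert (Hd : d = fun _ => O).
        { apply Classical_Prop.NNPP. intros E. apply Ht, delta_neq. intros E'. injection E'. auto. }
        subst d. induction n; simpl; lia.
Qed.

(** * A nonzero submodule contains every monomial *)

Section Irreducible.
Context (l : Z) (nu : R) (W : vec -> Prop) (HW : Pi_submodule l nu W).

Lemma W_vscal_inv (c : C) g : c <> 0 -> W (vscal c g) -> W g.
Proof.
  intros Hc H. replace g with (vscal (/ c) (vscal c g)); [apply HW, H|].
  apply functional_extensionality. intros s. unfold vscal. field. exact Hc.
Qed.

Lemma W_raise b p g : W g -> W (raise l b p g).
Proof. intros Hg. destruct b; apply HW, Hg. Qed.

Lemma W_lower b p g : W g -> W (lower l b p g).
Proof. intros Hg. destruct b; apply HW, Hg. Qed.

(** The occupation of the mode is first annihilated down to 0, dividing by the nonzero scalar that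
    each [lower] produces, and then created up to [v]. *)
Lemma W_delta_set b s p v : W (delta s) -> W (delta (set_occ b s p v)).
Proof.
  intros H. assert (H0 : W (delta (set_occ b s p 0))).
  { remember (occ b s p) as n eqn:En. revert s H En.
    induction n as [|n IH]; intros s H En.
    - rewrite En, set_occ_same. exact H.
    - rewrite <- (set_occ_set_occ b s p n). apply IH; [|rewrite occ_set_occ; reflexivity].
      apply (W_vscal_inv (ZtoC (2 * Zpos p) * INR (S n))).
      + apply Cmult_neq_0; apply RtoC_neq_0; [apply not_0_IZR; lia|apply not_0_INR; lia].
      + rewrite <- (lower_delta l) by auto. apply W_lower, H. }
  induction v as [|v IH]; [exact H0|].
  replace (set_occ b s p (S v)) with (set_occ b (set_occ b s p v) p (S (occ b (set_occ b s p v) p)))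
    by (rewrite occ_set_occ, set_occ_set_occ; reflexivity).
  rewrite <- (raise_delta l). apply W_raise, IH.
Qed.

(** The modes are corrected one at a time, starting from the cutoff [N] above which the two states
    already agree. *)
Lemma W_delta_occ1 b t N : forall s, W (delta s) -> lam t = lam s -> occ (negb b) t = occ (negb b) s ->
  (forall p, (N < Pos.to_nat p)%nat -> occ b t p = occ b s p) -> W (delta t).
Proof.
  induction N as [|N IH]; intros s H El En E.
  - replace t with s; [exact H|].
    assert (Eb : occ b t = occ b s) by (apply functional_extensionality; intros p; apply E; lia).
    destruct s, t, b; simpl in *; congruence.
  - set (q := Pos.of_succ_nat N). apply (IH (set_occ b s q (occ b t q))).
    + apply W_delta_set, H.
    + destruct b; exact El.
    + destruct b; exact En.
    + intros p Hp. destruct (Pos.eq_dec p q) as [->|Hne]; [symmetry; apply occ_set_occ|].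
      rewrite E by lia. destruct b; symmetry; apply upd_neq, Hne.
Qed.

Lemma W_delta_occ s mu mu' :
  finite_occ (occ_a s) -> finite_occ (occ_d s) -> finite_occ mu -> finite_occ mu' ->
  W (delta s) -> W (delta (State (lam s) mu mu')).
Proof.
  intros [A HA] [B HB] [A' HA'] [B' HB'] H.
  apply (W_delta_occ1 false _ (Pos.to_nat B + Pos.to_nat B') (State (lam s) mu (occ_d s))); try reflexivity.
  - apply (W_delta_occ1 true _ (Pos.to_nat A + Pos.to_nat A') s H); try reflexivity.
    intros p Hp. simpl. rewrite HA, HA' by lia. reflexivity.
  - intros p Hp. simpl. rewrite HB, HB' by lia. reflexivity.
Qed.

Lemma W_delta_all s t : good_state nu s -> good_state nu t -> W (delta s) -> W (delta t).
Proof.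
  intros [[z Hz] [Ha Hd]] [[z' Hz'] [Ha' Hd']] H.
  assert (Hv : finite_occ (fun _ => O)) by (exists 1%positive; reflexivity).
  apply (W_delta_occ s _ _ Ha Hd Hv Hv) in H.
  assert (H' : W (delta (State (lam t) (fun _ => O) (fun _ => O)))).
  { replace (lam t) with (lam s + IZR (z' - z))%R by (rewrite Hz, Hz', minus_IZR; ring).
    rewrite <- (mode_exp_vacuum l). apply HW, H. }
  destruct t as [x a d]. exact (W_delta_occ (State x (fun _ => O) (fun _ => O)) a d Hv Hv Ha' Hd' H').
Qed.

(* Joint eigenspaces of the modes d_0, a_{-p} d_p and d_{-p} a_p are lines. *)
Lemma W_separate s s0 : s <> s0 -> exists ev : state -> C, ev s <> ev s0 /\
  forall g, W g -> W (fun t => ev t * g t).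
Proof.
  intros Hne. destruct (Req_dec (lam s) (lam s0)) as [El|El].
  2: { exists (fun t => 2 * lam t). split; [|intros g Hg; apply (proj1 (proj2 (proj2 (proj2 (proj2 (proj2 HW))))) 0%Z g Hg)].
       intros E. apply El. rewrite <- !RtoC_mult in E. injection E. lra. }
  destruct (excluded_middle_informative (exists b p, occ b s p <> occ b s0 p)) as [[b [p Hp]]|Hn].
  { exists (fun t => ZtoC (2 * Zpos p) * INR (occ b t p)). split.
    - intros E. apply Hp. unfold ZtoC in E. rewrite <- !RtoC_mult in E. injection E as E.
      apply Rmult_eq_reg_l in E; [apply INR_eq, E|apply not_0_IZR; lia].
    - intros g Hg. replace (fun t => _) with (raise l b p (lower l b p g)); [apply W_raise, W_lower, Hg|].
      apply functional_extensionality. intros t. apply raise_lower. }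
  exfalso. apply Hne.
  assert (E : forall b, occ b s = occ b s0).
  { intros b. apply functional_extensionality. intros p. apply Classical_Prop.NNPP. intros E.
    apply Hn. exists b, p. exact E. }
  pose proof (E true). pose proof (E false). destruct s, s0. simpl in *. congruence.
Qed.

(** Interpolation with the separating diagonal operators: for each unwanted state [s] of [L], the
    factor [ev - ev s] kills the coefficient at [s] and keeps the one at [s0] nonzero. The last
    clause records that the support never grows, so a list containing the support of [g] leaves only
    [s0]. *)
Lemma W_project s0 L : forall g, W g -> g s0 <> 0 ->
  exists g', W g' /\ g' s0 <> 0 /\ (forall s, In s L -> s <> s0 -> g' s = 0) /\
    (forall s, g s = 0 -> g' s = 0).
Proof.
  induction L as [|s L IH]; intros g Hg H0; [exists g; repeat split; auto; intros s []|].
  destruct (IH g Hg H0) as [h [Hh [Hh0 [HL Hz]]]].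
  destruct (excluded_middle_informative (s = s0)) as [E|E].
  - exists h. repeat split; auto. intros t [<-|Ht] Hne; [contradiction|apply HL; assumption].
  - destruct (W_separate s s0 E) as [ev [Hev Hop]].
    exists (fun t => (ev t - ev s) * h t). repeat split.
    + replace (fun t => _) with (vadd (fun t => ev t * h t) (vscal (- ev s) h)).
      * apply HW; [apply Hop, Hh|apply HW, Hh].
      * apply functional_extensionality. intros t. unfold vadd, vscal. ring.
    + apply Cmult_neq_0; [|exact Hh0]. intros E'. apply Hev.
      replace (ev s) with (ev s0 - (ev s0 - ev s)) by ring. rewrite E'. ring.
    + intros t [<-|Ht] Hne; [ring|]. rewrite HL by assumption. ring.
    + intros t Ht. rewrite Hz by exact Ht. ring.
Qed.

Lemma W_delta_of_neq_0 g s0 : W g -> g s0 <> 0 -> W (delta s0).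
Proof.
  intros Hg H0. destruct (proj1 HW g Hg) as [L [_ HL]].
  destruct (W_project s0 L g Hg H0) as [h [Hh [Hh0 [Hz Hz']]]].
  apply (W_vscal_inv (h s0) _ Hh0). replace (vscal (h s0) (delta s0)) with h; [exact Hh|].
  apply functional_extensionality. intros t. unfold vscal.
  destruct (excluded_middle_informative (t = s0)) as [->|E]; [rewrite delta_eq; ring|].
  rewrite delta_neq by exact E. rewrite Cmult_0_r.
  destruct (excluded_middle_informative (g t = 0)) as [E'|E']; [apply Hz', E'|apply Hz; [apply HL, E'|exact E]].
Qed.

Lemma W_of_delta : (forall s, good_state nu s -> W (delta s)) -> forall g, in_Pi nu g -> W g.
Proof.
  intros Hd g [L [HL Hg]]. revert g Hg. induction L as [|s L IH]; intros g Hg.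
  - replace g with (fun _ : state => RtoC 0); [apply HW|].
    apply functional_extensionality. intros s. apply Classical_Prop.NNPP. intros E. apply (Hg s). auto.
  - replace g with (vadd (fun t => g t - g s * delta s t) (vscal (g s) (delta s))).
    + apply HW; [|apply HW, Hd, HL; left; reflexivity].
      apply IH; [intros t Ht; apply HL; right; exact Ht|].
      intros t Ht. destruct (excluded_middle_informative (t = s)) as [->|E].
      * exfalso. apply Ht. rewrite delta_eq. ring.
      * rewrite delta_neq in Ht by exact E. destruct (Hg t) as [->|H]; [|contradiction|exact H].
        intros E'. apply Ht. rewrite E'. ring.
    + apply functional_extensionality. intros t. unfold vadd, vscal. ring.
Qed.
End Irreducible.

Lemma in_Pi_delta nu s : good_state nu s -> in_Pi nu (delta s).
Proof.
  intros H. exists [s]. split.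
  - intros t [<-|[]]. exact H.
  - intros t Ht. left. apply Classical_Prop.NNPP. intros E. apply Ht, delta_neq. auto.
Qed.

Lemma Pi_irreducible_all l nu : Pi_irreducible l nu.
Proof.
  split; [apply in_Pi_submodule|]. split.
  - pose (s := State nu (fun _ => O) (fun _ => O)). exists (delta s). split.
    + apply in_Pi_delta. split; [exists 0%Z; simpl; lra|]. split; exists 1%positive; reflexivity.
    + exists s. rewrite delta_eq. apply RtoC_neq_0. lra.
  - intros W HW [g [Hg [s0 H0]]]. apply (W_of_delta l nu W HW). intros s Hs.
    assert (Hs0 : good_state nu s0).
    { destruct (proj1 HW g Hg) as [L [HL HL']]. apply HL, HL', H0. }
    apply (W_delta_all l nu W HW s0 s Hs0 Hs). apply (W_delta_of_neq_0 l nu W HW g s0 Hg H0).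
Qed.

(** * Calculus of complex-valued functions of a real variable *)

(** Integrals, continuity and derivatives are taken componentwise in order to use the real theory;
    [is_RInt_CInt] and [CderAt_is_derive] connect them with the module [C_R_NormedModule] of the
    definitions. *)
Definition CInt (f : R -> C) (a b : R) : C :=
  (RInt (fun x => Re (f x)) a b, RInt (fun x => Im (f x)) a b).

Definition Ccont (f : R -> C) : Prop :=
  forall x, continuous (fun t => Re (f t)) x /\ continuous (fun t => Im (f t)) x.

Definition CderAt (f : R -> C) (x : R) (l : C) : Prop :=
  is_derive (fun t => Re (f t)) x (Re l) /\ is_derive (fun t => Im (f t)) x (Im l).

Lemma ex_RInt_Re (f : R -> C) (a b : R) : Ccont f -> ex_RInt (fun x => Re (f x)) a b.
Proof. intros H. apply ex_RInt_cont. intros x. exact (proj1 (H x)). Qed.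

Lemma ex_RInt_Im (f : R -> C) (a b : R) : Ccont f -> ex_RInt (fun x => Im (f x)) a b.
Proof. intros H. apply ex_RInt_cont. intros x. exact (proj2 (H x)). Qed.

Lemma Ccont_const (c : C) : Ccont (fun _ => c).
Proof. intros x. split; apply continuous_const. Qed.

Lemma Ccont_id : Ccont RtoC.
Proof. intros x. split; [apply continuous_id|apply continuous_const]. Qed.

Lemma Ccont_plus f g : Ccont f -> Ccont g -> Ccont (fun x => f x + g x).
Proof.
  intros Hf Hg x. destruct (Hf x), (Hg x).
  split; apply continuous_plus_R; assumption.
Qed.

Lemma Ccont_mult f g : Ccont f -> Ccont g -> Ccont (fun x => f x * g x).
Proof.
  intros Hf Hg x. destruct (Hf x), (Hg x). simpl. split.
  - apply continuous_minus_R; apply continuous_mult_R; assumption.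
  - apply continuous_plus_R; apply continuous_mult_R; assumption.
Qed.

Lemma Ccont_opp f : Ccont f -> Ccont (fun x => - f x).
Proof. intros Hf x. destruct (Hf x). split; apply (continuous_opp (V := R_NormedModule)); assumption. Qed.

Lemma Ccont_minus f g : Ccont f -> Ccont g -> Ccont (fun x => f x - g x).
Proof. intros Hf Hg. apply (Ccont_plus f (fun x => - g x) Hf), Ccont_opp, Hg. Qed.

Lemma Ccont_RtoC (f : R -> R) : (forall x, continuous f x) -> Ccont (fun x => RtoC (f x)).
Proof. intros Hf x. split; [apply Hf|apply continuous_const]. Qed.

Lemma Re_Cexp z : Re (Cexp z) = (exp (Re z) * cos (Im z))%R.
Proof. unfold Cexp; simpl; ring. Qed.

Lemma Im_Cexp z : Im (Cexp z) = (exp (Re z) * sin (Im z))%R.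
Proof. unfold Cexp; simpl; ring. Qed.

Lemma CderAt_cont f f' : (forall x, CderAt f x (f' x)) -> Ccont f.
Proof. intros H x. destruct (H x). split; eapply continuous_derivable; eassumption. Qed.

Lemma CderAt_eq f x l l' : CderAt f x l -> l = l' -> CderAt f x l'.
Proof. intros H <-. exact H. Qed.

Lemma CderAt_ext f g x l : (forall t, f t = g t) -> CderAt f x l -> CderAt g x l.
Proof.
  intros E [H1 H2]. split; eapply is_derive_ext; [|exact H1| |exact H2]; intros t; simpl; rewrite E; reflexivity.
Qed.

Lemma CderAt_const c x : CderAt (fun _ => c) x 0.
Proof. split; apply is_derive_const_R. Qed.

Lemma CderAt_id x : CderAt RtoC x 1.
Proof. split; simpl; [apply (is_derive_id (K := R_AbsRing))|apply is_derive_const_R]. Qed.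

Lemma CderAt_plus f g x l m : CderAt f x l -> CderAt g x m -> CderAt (fun t => f t + g t) x (l + m).
Proof. intros [H1 H2] [H3 H4]. split; apply is_derive_plus_R; assumption. Qed.

Lemma is_derive_eq (f : R -> R) (x l l' : R) : is_derive f x l -> l = l' -> is_derive f x l'.
Proof. intros H <-. exact H. Qed.

Lemma CderAt_mult f g x l m :
  CderAt f x l -> CderAt g x m -> CderAt (fun t => f t * g t) x (l * g x + f x * m).
Proof.
  intros [H1 H2] [H3 H4].
  assert (M : forall (u v : R -> R) (a b : R), is_derive u x a -> is_derive v x b ->
    is_derive (fun t => (u t * v t)%R) x (a * v x + u x * b)%R).
  { intros u v a b Hu Hv. apply (is_derive_mult (K := R_AbsRing) u v x a b Hu Hv). intros; apply Rmult_comm. }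
  split; simpl.
  - eapply is_derive_eq.
    + apply is_derive_minus_R; apply M; [exact H1|exact H3|exact H2|exact H4].
    + unfold minus, plus, opp, Re, Im; simpl. ring.
  - eapply is_derive_eq.
    + apply is_derive_plus_R; apply M; [exact H1|exact H4|exact H2|exact H3].
    + unfold plus, Re, Im; simpl. ring.
Qed.

Lemma CderAt_Cexp f x l : CderAt f x l -> CderAt (fun t => Cexp (f t)) x (l * Cexp (f x)).
Proof.
  intros [H1 H2].
  assert (E : forall (u v : R -> R) (a b : R), is_derive u x a -> is_derive v x b ->
    is_derive (fun t => (exp (u t) * cos (v t))%R) x (exp (u x) * (a * cos (v x) - b * sin (v x)))%R /\
    is_derive (fun t => (exp (u t) * sin (v t))%R) x (exp (u x) * (a * sin (v x) + b * cos (v x)))%R).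
  { intros u v a b Hu Hv.
    split; auto_derive; try (repeat split; try exact I; eexists; eassumption);
      change (Derive (fun t : R => u t) x) with (Derive u x); change (Derive (fun t : R => v t) x) with (Derive v x);
      rewrite (is_derive_unique u x a Hu), (is_derive_unique v x b Hv); ring. }
  destruct (E _ _ _ _ H1 H2) as [E1 E2]. split.
  - eapply is_derive_ext; [intros t; symmetry; apply Re_Cexp|].
    eapply is_derive_eq; [exact E1|].
    destruct l as [l1 l2]. unfold Cexp; simpl. unfold Re, Im. ring.
  - eapply is_derive_ext; [intros t; symmetry; apply Im_Cexp|].
    eapply is_derive_eq; [exact E2|].
    destruct l as [l1 l2]. unfold Cexp; simpl. unfold Re, Im. ring.
Qed.

Lemma CderAt_comp (f : R -> C) (g : R -> R) (x d : R) (l : C) :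
  CderAt f (g x) l -> is_derive g x d -> CderAt (fun t => f (g t)) x (d * l).
Proof.
  intros [H1 H2] D. split; rewrite ?Re_RtoC_mult, ?Im_RtoC_mult.
  - exact (is_derive_comp (fun t => Re (f t)) g x _ _ H1 D).
  - exact (is_derive_comp (fun t => Im (f t)) g x _ _ H2 D).
Qed.

Lemma CderAt_comp_scal (f : R -> C) (c x : R) (l : C) :
  CderAt f (c * x) l -> CderAt (fun t => f (c * t)%R) x (c * l).
Proof. intros H. apply (CderAt_comp f (fun t => (c * t)%R)); [exact H|]. auto_derive; [exact I|ring]. Qed.

Lemma CderAt_opp f x l : CderAt f x l -> CderAt (fun t => - f t) x (- l).
Proof. intros [H1 H2]. split; apply (is_derive_opp (K := R_AbsRing) (V := R_NormedModule)); assumption. Qed.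

Lemma CderAt_minus f g x l m : CderAt f x l -> CderAt g x m -> CderAt (fun t => f t - g t) x (l - m).
Proof. intros Hf Hg. apply (CderAt_plus f (fun t => - g t)); [exact Hf|apply CderAt_opp, Hg]. Qed.

#[local] Hint Resolve CderAt_id : cder.
#[local] Hint Constants Opaque : ccont.
#[local] Hint Resolve Ccont_const Ccont_id Ccont_opp Ccont_plus Ccont_minus Ccont_mult : ccont.

Ltac cder_rec :=
  lazymatch goal with
  | |- CderAt (fun _ => ?c) _ _ => apply CderAt_const
  | |- CderAt (fun t => Cplus (@?f t) (@?g t)) _ _ => apply (CderAt_plus f g); cder_rec
  | |- CderAt (fun t => Cminus (@?f t) (@?g t)) _ _ => apply (CderAt_minus f g); cder_rec
  | |- CderAt (fun t => Cmult (@?f t) (@?g t)) _ _ => apply (CderAt_mult f g); cder_rec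
  | |- CderAt (fun t => Copp (@?f t)) _ _ => apply (CderAt_opp f); cder_rec
  | |- CderAt (fun t => Cexp (@?f t)) _ _ => apply (CderAt_Cexp f); cder_rec
  | _ => solve [eauto with cder]
  end.

Ltac cder := eapply CderAt_eq; [cder_rec|cbv beta].

Lemma CInt_ext f g a b : (forall x, f x = g x) -> CInt f a b = CInt g a b.
Proof. intros H. unfold CInt. f_equal; apply RInt_extR; intros x _; rewrite H; reflexivity. Qed.

Lemma CInt_plus f g a b : Ccont f -> Ccont g -> CInt (fun x => f x + g x) a b = CInt f a b + CInt g a b.
Proof.
  intros Hf Hg. apply C_ext.
  - apply (RInt_plus (V := R_CompleteNormedModule)); apply ex_RInt_Re; assumption.
  - apply (RInt_plus (V := R_CompleteNormedModule)); apply ex_RInt_Im; assumption.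
Qed.

Lemma CInt_scal (c : C) f a b : Ccont f -> CInt (fun x => c * f x) a b = c * CInt f a b.
Proof.
  intros Hf. pose proof (ex_RInt_Re f a b Hf) as HR. pose proof (ex_RInt_Im f a b Hf) as HI.
  apply C_ext; simpl; apply is_RInt_unique.
  - apply is_RInt_minus_R; apply is_RInt_scal_R;
      apply RInt_correct_R; assumption.
  - apply is_RInt_plus_R; apply is_RInt_scal_R;
      apply RInt_correct_R; assumption.
Qed.

Lemma CInt_Chasles f a b c : Ccont f -> CInt f a b + CInt f b c = CInt f a c.
Proof.
  intros Hf. apply C_ext.
  - apply (RInt_Chasles (V := R_CompleteNormedModule)); apply ex_RInt_Re, Hf.
  - apply (RInt_Chasles (V := R_CompleteNormedModule)); apply ex_RInt_Im, Hf.
Qed.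

Lemma CInt_point f a : CInt f a a = 0.
Proof. unfold CInt. apply C_ext; simpl; apply (RInt_point (V := R_CompleteNormedModule)). Qed.

Lemma CInt_derive f f' a b : (forall x, CderAt f x (f' x)) -> Ccont f' -> CInt f' a b = f b - f a.
Proof.
  intros H Hc. apply C_ext; simpl; apply is_RInt_unique.
  - apply (is_RInt_derive_R (fun t => Re (f t)) (fun t => Re (f' t))); intros x; [exact (proj1 (H x))|exact (proj1 (Hc x))].
  - apply (is_RInt_derive_R (fun t => Im (f t)) (fun t => Im (f' t))); intros x; [exact (proj2 (H x))|exact (proj2 (Hc x))].
Qed.

Lemma CderAt_0_const f (a b : R) : (forall x, CderAt f x 0) -> f b = f a.
Proof.
  (* The derivative 0 is written [0 * 0] so that [CInt_scal] evaluates its integral to 0. *)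
  intros H. pose proof (CInt_derive f (fun _ => 0 * 0) a b) as E.
  rewrite CInt_scal in E by apply Ccont_const.
  replace (f b) with ((f b - f a) + f a) by ring. rewrite <- E; [ring| |apply Ccont_const].
  intros x. eapply CderAt_eq; [apply H|ring].
Qed.

(** The factor 2 comes from bounding the real and the imaginary part separately. *)
Lemma CInt_bound f a b B : (a <= b)%R -> Ccont f -> (forall x, (a <= x <= b)%R -> (Cmod (f x) <= B)%R) ->
  (Cmod (CInt f a b) <= 2 * ((b - a) * B))%R.
Proof.
  intros Hab Hf HB. eapply Rle_trans; [apply Cmod_le_abs|]. unfold CInt; simpl.
  assert (H1 : (Rabs (RInt (fun x => Re (f x)) a b) <= (b - a) * B)%R).
  { apply RInt_abs_le; [exact Hab|intros x; exact (proj1 (Hf x))|]. intros x Hx. eapply Rle_trans; [apply re_le_Cmod|apply HB, Hx]. }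
  assert (H2 : (Rabs (RInt (fun x => Im (f x)) a b) <= (b - a) * B)%R).
  { apply RInt_abs_le; [exact Hab|intros x; exact (proj2 (Hf x))|]. intros x Hx. eapply Rle_trans; [apply im_le_Cmod|apply HB, Hx]. }
  unfold Re, Im in *. lra.
Qed.

Lemma CInt_primitive f a x : Ccont f -> CderAt (fun t => CInt f a t) x (f x).
Proof.
  intros Hf.
  assert (H : forall g : R -> R, (forall y, continuous g y) -> is_derive (fun t => RInt g a t) x (g x)).
  { intros g Hg. apply (is_derive_RInt (V := R_NormedModule) g _ a); [|apply Hg].
    exists (mkposreal 1 Rlt_0_1). intros t _. apply RInt_correct_R, ex_RInt_cont, Hg. }
  split; [apply (H (fun t => Re (f t)))|apply (H (fun t => Im (f t)))]; intros y; apply (Hf y).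
Qed.

(* Sum over [-N, N-1]. *)
Definition Zsum (u : Z -> C) (N : nat) : C :=
  Csum (fun i => u (Z.of_nat i) + u (- Z.of_nat (S i))%Z) N.

Lemma Csum_head (u : nat -> C) n : Csum u (S n) = u O + Csum (fun i => u (S i)) n.
Proof. induction n as [|n IH]; [simpl; ring|]. change (Csum u (S (S n))) with (Csum u (S n) + u (S n)). rewrite IH. simpl. ring. Qed.

Lemma Zsum_shift (u : Z -> C) N : Csum (fun i => u (Z.of_nat i - Z.of_nat N)%Z) (2 * N) = Zsum u N.
Proof.
  induction N as [|N IH]; [reflexivity|].
  replace (2 * S N)%nat with (S (S (2 * N))) by lia. rewrite Csum_head.
  cbn [Csum]. rewrite (Csum_ext _ (fun i => u (Z.of_nat i - Z.of_nat N)%Z)) by (intros; f_equal; lia).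
  rewrite IH. unfold Zsum. cbn [Csum].
  replace (Z.of_nat 0 - Z.of_nat (S N))%Z with (- Z.of_nat (S N))%Z by lia.
  replace (Z.of_nat (S (2 * N)) - Z.of_nat (S N))%Z with (Z.of_nat N) by lia. ring.
Qed.

Lemma Zsum_ext (u v : Z -> C) N : (forall n, u n = v n) -> Zsum u N = Zsum v N.
Proof. intros H. apply Csum_ext. intros i _. rewrite !H. reflexivity. Qed.

Lemma Zsum_scal (c : C) (u : Z -> C) N : Zsum (fun n => c * u n) N = c * Zsum u N.
Proof. unfold Zsum. rewrite <- Csum_scal. apply Csum_ext. intros; ring. Qed.

Lemma ZSeries_finite (u : Z -> C) N : (forall n, (Z.of_nat N <= Z.abs n)%Z -> u n = 0) -> ZSeries u = Zsum u N.
Proof.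
  intros H. unfold ZSeries. rewrite !(CSeries_finite _ N) by (intros; apply H; lia).
  unfold Zsum. rewrite Csum_plus. reflexivity.
Qed.

Definition Ctrapezoid (f : R -> C) (a : R) (n : nat) : C :=
  (trapezoid (fun x => Re (f x)) a n, trapezoid (fun x => Im (f x)) a n).

Lemma Ctrapezoid_Csum f a n :
  Ctrapezoid f a n = Csum (fun i => f (a + INR i)%R) n + (f (a + INR n)%R - f a) / 2.
Proof.
  induction n as [|n IH].
  - unfold Ctrapezoid. simpl. rewrite Rplus_0_r. change (0%R, 0%R) with (RtoC 0). field.
  - transitivity (Ctrapezoid f a n + (f (a + INR n)%R + f (a + INR (S n))%R) / 2).
    + unfold Ctrapezoid. cbn [trapezoid].
      apply C_ext; unfold Re, Im; simpl; field.
    + rewrite IH. cbn [Csum]. field.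
Qed.

Lemma Ctrapezoid_Zsum f M :
  Ctrapezoid f (- INR M) (2 * M) = Zsum (fun n => f (IZR n)) M + (f (INR M) - f (- INR M)%R) / 2.
Proof.
  rewrite Ctrapezoid_Csum, <- Zsum_shift. f_equal.
  - apply Csum_ext. intros i _. f_equal. rewrite minus_IZR, <- !INR_IZR_INZ. ring.
  - f_equal. f_equal. f_equal. rewrite mult_INR. simpl. ring.
Qed.

(** Real and imaginary part contribute [12 * K / N] each. The constant is free of [M], which permits
    [M] to tend to infinity first. *)
Lemma poisson_complex (f f' f'' : R -> C) (K : R) (M N : nat) :
  (forall x, CderAt f x (f' x)) -> (forall x, CderAt f' x (f'' x)) -> Ccont f'' ->
  (forall x, (Cmod (f'' x) <= K / (1 + x ^ 2))%R) -> (0 < N)%nat ->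
  (Cmod (Ctrapezoid f (- INR M) (2 * M) -
     CInt (fun x => (RtoC (dirichlet N x) * f x)%C) (- INR M) (INR M)) <= 24 * K / INR N)%R.
Proof.
  intros Hf Hf' Hf'' HK HN. eapply Rle_trans; [apply Cmod_le_abs|].
  replace (24 * K / INR N)%R with (12 * K / INR N + 12 * K / INR N)%R by (field; apply not_0_INR; lia).
  assert (EM : (- INR M)%R = IZR (- Z.of_nat M)) by (rewrite opp_IZR, <- INR_IZR_INZ; reflexivity).
  assert (EM2 : INR M = (IZR (- Z.of_nat M) + INR (2 * M))%R) by (rewrite <- EM, mult_INR; simpl; ring).
  apply Rplus_le_compat.
  - pose proof (poisson_real (fun x => Re (f x)) (fun x => Re (f' x)) (fun x => Re (f'' x)) K (- Z.of_nat M) (2 * M) N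
      (fun x => proj1 (Hf x)) (fun x => proj1 (Hf' x)) (fun x => proj1 (Hf'' x))) as H.
    rewrite <- EM2, <- EM in H.
    replace (Re _) with (trapezoid (fun x => Re (f x)) (- INR M) (2 * M) -
      RInt (fun x => Re (f x) * dirichlet N x) (- INR M) (INR M))%R.
    + apply H; [|exact HN]. intros x. eapply Rle_trans; [apply re_le_Cmod|apply HK].
    + unfold CInt. simpl. unfold Rminus. f_equal. f_equal. apply RInt_extR. intros x _. unfold Re. ring.
  - pose proof (poisson_real (fun x => Im (f x)) (fun x => Im (f' x)) (fun x => Im (f'' x)) K (- Z.of_nat M) (2 * M) N
      (fun x => proj2 (Hf x)) (fun x => proj2 (Hf' x)) (fun x => proj2 (Hf'' x))) as H.
    rewrite <- EM2, <- EM in H.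
    replace (Im _) with (trapezoid (fun x => Im (f x)) (- INR M) (2 * M) -
      RInt (fun x => Im (f x) * dirichlet N x) (- INR M) (INR M))%R.
    + apply H; [|exact HN]. intros x. eapply Rle_trans; [apply im_le_Cmod|apply HK].
    + unfold CInt. simpl. unfold Rminus. f_equal. f_equal. apply RInt_extR. intros x _. unfold Im. ring.
Qed.

Lemma dirichlet_cis N x :
  RtoC (dirichlet N x) = 1 + Csum (fun i => cis2pi (INR (S i) * x) + cis2pi (- (INR (S i) * x))) N.
Proof.
  induction N as [|N IH]; [simpl; ring|].
  cbn [dirichlet Csum]. rewrite RtoC_plus, IH.
  replace (INR (S N) * x) with (RtoC (INR (S N) * x)) by (rewrite RtoC_mult; reflexivity).
  rewrite <- RtoC_opp, !cis2pi_R.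
  replace (2 * PI * - (INR (S N) * x))%R with (- (2 * PI * INR (S N) * x))%R by ring.
  replace (2 * PI * (INR (S N) * x))%R with (2 * PI * INR (S N) * x)%R by ring.
  rewrite cos_neg, sin_neg, <- Cplus_assoc. f_equal. f_equal. apply C_ext; simpl; ring.
Qed.

Lemma CderAt_cis2pi (c : C) (x : R) : CderAt (fun t => cis2pi (c * t)) x (2 * PI * Ci * c * cis2pi (c * x)).
Proof. unfold cis2pi. cder. ring. Qed.

Lemma Ccont_cis2pi (c : C) : Ccont (fun x => cis2pi (c * x)).
Proof. eapply CderAt_cont. apply CderAt_cis2pi. Qed.

#[local] Hint Resolve CderAt_cis2pi : cder.
#[local] Hint Resolve Ccont_cis2pi : ccont.

Lemma CInt_dirichlet f a b N : Ccont f ->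
  CInt (fun x => RtoC (dirichlet N x) * f x) a b =
  CInt f a b + Csum (fun i => CInt (fun x => cis2pi (INR (S i) * x) * f x) a b +
                              CInt (fun x => cis2pi (- INR (S i) * x) * f x) a b) N.
Proof.
  intros Hf. induction N as [|N IH].
  - rewrite (CInt_ext _ f) by (intros; simpl; ring). simpl; ring.
  - rewrite (CInt_ext _ (fun x => RtoC (dirichlet N x) * f x +
        (cis2pi (INR (S N) * x) * f x + cis2pi (- INR (S N) * x) * f x))).
    + pose proof (Ccont_RtoC _ (dirichlet_continuous N)) as HD.
      assert (H0 : Ccont (fun x => RtoC (dirichlet N x) * f x)) by auto with ccont.
      assert (H1 : Ccont (fun x => cis2pi (INR (S N) * x) * f x)) by auto with ccont.
      assert (H2 : Ccont (fun x => cis2pi (- INR (S N) * x) * f x)) by auto with ccont.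
      rewrite (CInt_plus _ _ a b H0 (Ccont_plus _ _ H1 H2)), (CInt_plus _ _ a b H1 H2), IH.
      cbn [Csum]. ring.
    + intros x. rewrite !dirichlet_cis. cbn [Csum].
      replace (- INR (S N) * x) with (- (INR (S N) * x)) by ring. ring.
Qed.

(** * Gaussian integrals *)

Lemma is_lim_seq_div_INR (c : R) : is_lim_seq (fun n => (c / INR n)%R) 0%R.
Proof.
  replace (Finite 0) with (Rbar_mult c 0%R) by (simpl; f_equal; ring).
  apply is_lim_seq_scal_l. replace (Finite 0) with (Rbar_inv p_infty) by reflexivity.
  apply is_lim_seq_inv; [apply is_lim_seq_INR|discriminate].
Qed.

Definition Ccont2 (F : R -> R -> C) (y x : R) : Prop :=
  continuity_2d_pt (fun u v => Re (F u v)) y x /\ continuity_2d_pt (fun u v => Im (F u v)) y x.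

Lemma Ccont2_const c y x : Ccont2 (fun _ _ => c) y x.
Proof. split; apply continuity_2d_pt_const. Qed.

Lemma Ccont2_fst y x : Ccont2 (fun u _ => RtoC u) y x.
Proof. split; [exact (continuity_2d_pt_id1 y x)|exact (continuity_2d_pt_const y x 0)]. Qed.

Lemma Ccont2_snd y x : Ccont2 (fun _ v => RtoC v) y x.
Proof. split; [exact (continuity_2d_pt_id2 y x)|exact (continuity_2d_pt_const y x 0)]. Qed.

Lemma Ccont2_plus F G y x : Ccont2 F y x -> Ccont2 G y x -> Ccont2 (fun u v => F u v + G u v) y x.
Proof. intros [H1 H2] [H3 H4]. split; apply continuity_2d_pt_plus; assumption. Qed.

Lemma Ccont2_mult F G y x : Ccont2 F y x -> Ccont2 G y x -> Ccont2 (fun u v => F u v * G u v) y x.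
Proof.
  intros [H1 H2] [H3 H4]. split; simpl.
  - apply continuity_2d_pt_minus; apply continuity_2d_pt_mult; assumption.
  - apply continuity_2d_pt_plus; apply continuity_2d_pt_mult; assumption.
Qed.

Lemma Ccont2_opp F y x : Ccont2 F y x -> Ccont2 (fun u v => - F u v) y x.
Proof. intros [H1 H2]. split; apply continuity_2d_pt_opp; assumption. Qed.

Lemma Ccont2_Cexp F y x : Ccont2 F y x -> Ccont2 (fun u v => Cexp (F u v)) y x.
Proof.
  intros [H1 H2]. split.
  - eapply continuity_2d_pt_ext; [intros; symmetry; apply Re_Cexp|].
    apply continuity_2d_pt_mult; apply continuity_1d_2d_pt_comp; try assumption;
      apply derivable_continuous_pt; [apply derivable_pt_exp|apply derivable_pt_cos].
  - eapply continuity_2d_pt_ext; [intros; symmetry; apply Im_Cexp|].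
    apply continuity_2d_pt_mult; apply continuity_1d_2d_pt_comp; try assumption;
      apply derivable_continuous_pt; [apply derivable_pt_exp|apply derivable_pt_sin].
Qed.

#[local] Hint Constants Opaque : ccont2.
#[local] Hint Resolve Ccont2_const Ccont2_fst Ccont2_snd Ccont2_plus Ccont2_mult Ccont2_opp Ccont2_Cexp : ccont2.

Lemma RInt_param_derive (F F' : R -> R -> R) (a b y : R) :
  (forall y x, is_derive (fun s => F s x) y (F' y x)) -> (forall y x, continuous (F y) x) ->
  (forall y x, continuity_2d_pt F' y x) ->
  is_derive (fun s => RInt (F s) a b) y (RInt (F' y) a b).
Proof.
  intros HD HC H2.
  assert (E : forall y x, Derive (fun s => F s x) y = F' y x) by (intros; apply is_derive_unique, HD).
  rewrite <- (RInt_extR (fun t => Derive (fun s => F s t) y) (F' y)) by (intros; apply E).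
  apply is_derive_RInt_param.
  - exists (mkposreal 1 Rlt_0_1). intros s _ t _. eexists. apply HD.
  - intros t _. eapply continuity_2d_pt_ext; [intros; symmetry; apply E|]. apply H2.
  - exists (mkposreal 1 Rlt_0_1). intros s _. apply ex_RInt_cont, HC.
Qed.

Lemma CInt_param_derive (F F' : R -> R -> C) (a b y : R) :
  (forall y x, CderAt (fun s => F s x) y (F' y x)) -> (forall y, Ccont (F y)) ->
  (forall y x, Ccont2 F' y x) ->
  CderAt (fun s => CInt (F s) a b) y (CInt (F' y) a b).
Proof.
  intros HD HC H2. split.
  - apply (RInt_param_derive (fun s x => Re (F s x)) (fun s x => Re (F' s x))).
    + intros t x; exact (proj1 (HD t x)). + intros t x; exact (proj1 (HC t x)). + intros t x; exact (proj1 (H2 t x)).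
  - apply (RInt_param_derive (fun s x => Im (F s x)) (fun s x => Im (F' s x))).
    + intros t x; exact (proj2 (HD t x)). + intros t x; exact (proj2 (HC t x)). + intros t x; exact (proj2 (H2 t x)).
Qed.

(** Of the two factors [1 + x ^ 2], one will absorb the quadratic polynomial in the second
    derivative of the Gaussian, and the other is the decay required by [poisson_complex]. *)
Lemma exp_gauss_bound (a b c : R) : (0 < a)%R ->
  exists B, (0 <= B)%R /\ forall x, (exp (- (a * x ^ 2) + b * x + c) * (1 + x ^ 2) ^ 2 <= B)%R.
Proof.
  (* With this [m], [m * (1 + x ^ 2) <= 1 + a * x ^ 2 / 4 <= exp (a * x ^ 2 / 4)]. Half of the
     quadratic exponent absorbs the linear term; the other half supplies this exponential twice. *)
  intros Ha. set (m := Rmin 1 (a / 4)).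
  assert (Hm : (0 < m)%R) by (apply Rmin_glb_lt; lra).
  assert (Hm1 : (m <= 1)%R) by apply Rmin_l. assert (Hm2 : (m <= a / 4)%R) by apply Rmin_r.
  exists (exp (b ^ 2 / (2 * a) + c) * (/ m) ^ 2)%R. split.
  - apply Rmult_le_pos; [left; apply exp_pos|apply pow2_ge_0].
  - intros x. set (u := (a * x ^ 2 / 4)%R).
    assert (H1 : (exp (- (a * x ^ 2) + b * x + c) <= exp (b ^ 2 / (2 * a) + c) * exp (- u) ^ 2)%R).
    { replace (exp (- u) ^ 2)%R with (exp (- u + - u)) by (rewrite exp_plus; ring).
      rewrite <- exp_plus. apply exp_le. unfold u.
      assert (0 <= a / 2 * (x - b / a) ^ 2)%R by (apply Rmult_le_pos; [lra|apply pow2_ge_0]).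
      replace (a / 2 * (x - b / a) ^ 2)%R with (a / 2 * x ^ 2 - b * x + b ^ 2 / (2 * a))%R in H by (field; lra). lra. }
    assert (H2 : (exp (- u) * (1 + x ^ 2) <= / m)%R).
    { apply Rmult_le_reg_l with (m * exp u)%R; [apply Rmult_lt_0_compat; [exact Hm|apply exp_pos]|].
      replace (m * exp u * (exp (- u) * (1 + x ^ 2)))%R with (m * (1 + x ^ 2) * (exp u * exp (- u)))%R by ring.
      rewrite <- exp_plus, Rplus_opp_r, exp_0, Rmult_1_r.
      replace (m * exp u * / m)%R with (exp u) by (field; lra).
      eapply Rle_trans; [|apply exp_ineq1_le]. unfold u. pose proof (pow2_ge_0 x). nra. }
    eapply Rle_trans; [apply Rmult_le_compat_r; [apply pow2_ge_0|exact H1]|].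
    rewrite Rmult_assoc. apply Rmult_le_compat_l; [left; apply exp_pos|].
    rewrite <- Rpow_mult_distr. apply pow_incr. split; [|exact H2].
    apply Rmult_le_pos; [left; apply exp_pos|]. pose proof (pow2_ge_0 x). lra.
Qed.

Lemma exp_gauss_lim (a b c : R) : (0 < a)%R ->
  is_lim_seq (fun n => exp (- (a * INR n ^ 2) + b * INR n + c)) 0%R.
Proof.
  intros Ha. destruct (exp_gauss_bound a b c Ha) as [B [HB H]].
  apply is_lim_seq_incr_1.
  apply is_lim_seq_0_le with (fun n => (B / INR (S n))%R).
  - intros n. split; [left; apply exp_pos|]. specialize (H (INR (S n))).
    assert (Hn : (1 <= INR (S n))%R) by (apply (le_INR 1); lia). set (x := INR (S n)) in *.
    apply Rmult_le_reg_r with x; [lra|]. unfold Rdiv. rewrite Rmult_assoc, Rinv_l, Rmult_1_r by lra.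
    eapply Rle_trans; [|exact H]. apply Rmult_le_compat_l; [left; apply exp_pos|]. nra.
  - apply (is_lim_seq_incr_1 (fun n => (B / INR n)%R)), is_lim_seq_div_INR.
Qed.

Section Gauss.
Context (alpha : C) (Halpha : (0 < Re alpha)%R).

Lemma alpha_neq_0 : alpha <> 0.
Proof. intros E. rewrite E in Halpha. simpl in Halpha. lra. Qed.

Definition gauss (w : C) : C := Cexp (- (alpha * (w * w))).

(** The bound is uniform in [y]: it controls the Gaussian at the ends of the window during the whole
    shift from [x] to [x + z]. *)
Lemma Cmod_gauss_line (x y : R) (z : C) : (0 <= y <= 1)%R ->
  (Cmod (gauss (x + y * z)) <=
   exp (- (Re alpha * Rabs x ^ 2) + 2 * (Cmod alpha * Cmod z) * Rabs x + Cmod alpha * Cmod z ^ 2))%R.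
Proof.
  intros Hy. unfold gauss. rewrite Cmod_Cexp. apply exp_le.
  replace (- (alpha * ((x + y * z) * (x + y * z)))) with
    (RtoC (- x ^ 2) * alpha + RtoC (- 2 * x * y) * (alpha * z) + RtoC (- y ^ 2) * (alpha * (z * z))).
  2: { rewrite !RtoC_mult, !RtoC_opp, !RtoC_pow. ring. }
  change (Re (?a + ?b + ?c)) with (Re a + Re b + Re c)%R. rewrite !Re_RtoC_mult.
  rewrite pow2_abs.
  assert (H1 : (- 2 * x * y * Re (alpha * z) <= 2 * (Cmod alpha * Cmod z) * Rabs x)%R).
  { eapply Rle_trans; [apply Rle_abs|]. rewrite !Rabs_mult, (Rabs_pos_eq y) by lra.
    replace (Rabs (- 2)) with 2%R by (rewrite Rabs_left; lra).
    pose proof (re_le_Cmod (alpha * z)) as H. rewrite Cmod_mult in H.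
    set (A := (Cmod alpha * Cmod z)%R) in *. pose proof (Rabs_pos x). pose proof (Rabs_pos (Re (alpha * z))).
    assert (y * Rabs (Re (alpha * z)) <= A)%R by nra. nra. }
  assert (H2 : (- y ^ 2 * Re (alpha * (z * z)) <= Cmod alpha * Cmod z ^ 2)%R).
  { eapply Rle_trans; [apply Rle_abs|]. rewrite Rabs_mult, Rabs_Ropp, (Rabs_pos_eq (y ^ 2)) by nra.
    pose proof (re_le_Cmod (alpha * (z * z))) as H. rewrite !Cmod_mult in H.
    pose proof (Rabs_pos (Re (alpha * (z * z)))).
    assert (0 <= (1 - y ^ 2) * Rabs (Re (alpha * (z * z))))%R by (apply Rmult_le_pos; [simpl; nra|assumption]).
    simpl in *. lra. }
  lra.
Qed.

Lemma Ccont_gauss_shift (z : C) : Ccont (fun x => gauss (x + z)).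
Proof. eapply CderAt_cont. intros x. unfold gauss. cder. reflexivity. Qed.
#[local] Hint Resolve Ccont_gauss_shift : ccont.

Definition gint (M : nat) (z : C) : C := CInt (fun x => gauss (x + z)) (- INR M) (INR M).

(** A contour shift without Cauchy's theorem: in the family [x + y * z] the derivative in [y] is [z]
    times the derivative in [x], so the integral over the window changes only by boundary values,
    which decay like a Gaussian. *)
Lemma gint_shift (z : C) : Clim (fun M => gint M z - gint M 0) 0.
Proof.
  set (e := fun M => exp (- (Re alpha * INR M ^ 2) + 2 * (Cmod alpha * Cmod z) * INR M + Cmod alpha * Cmod z ^ 2)).
  apply Clim_bound with (fun M => (4 * Cmod z * e M)%R).
  - intros M. rewrite Cminus_0_r.
    pose (F := fun y x : R => gauss (x + y * z)).
    pose (F' := fun y x : R => (- (2 * alpha * (z * (x + y * z)))) * gauss (x + y * z)).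
    assert (HD : forall y x, CderAt (fun s => F s x) y (F' y x)).
    { intros y x. unfold F, F', gauss. cder. ring. }
    assert (HX : forall y x, CderAt (F y) x ((- (2 * alpha * (x + y * z))) * gauss (x + y * z))).
    { intros y x. unfold F, gauss. cder. ring. }
    assert (H2 : forall y x, Ccont2 F' y x).
    { intros y x. unfold F', gauss. auto 20 with ccont2. }
    assert (HP : forall y, CderAt (fun s => CInt (F s) (- INR M) (INR M)) y
        (z * (gauss (INR M + y * z) - gauss ((- INR M)%R + y * z)))).
    { intros y. eapply CderAt_eq.
      - apply CInt_param_derive; [exact HD|intros s; eapply CderAt_cont; apply HX|exact H2].
      - change (gauss (INR M + y * z)) with (F y (INR M)). change (gauss ((- INR M)%R + y * z)) with (F y (- INR M)%R).
        rewrite (CInt_ext _ (fun x => z * ((- (2 * alpha * (x + y * z))) * gauss (x + y * z)))) by (intros; unfold F'; ring).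
        rewrite CInt_scal.
        + f_equal. apply CInt_derive; [apply HX|auto 20 with ccont].
        + auto 20 with ccont. }
    assert (HC : Ccont (fun y => z * (gauss (INR M + y * z) - gauss ((- INR M)%R + y * z)))).
    { eapply CderAt_cont. intros y. unfold gauss. cder. reflexivity. }
    pose proof (CInt_derive _ _ 0 1 HP HC) as E. cbv beta in E.
    replace (gint M z) with (CInt (F 1%R) (- INR M) (INR M)) by (apply CInt_ext; intros; unfold F; f_equal; ring).
    replace (gint M 0) with (CInt (F 0%R) (- INR M) (INR M)) by (apply CInt_ext; intros; unfold F; f_equal; ring).
    rewrite <- E.
    eapply Rle_trans; [apply (CInt_bound _ 0 1 (Cmod z * (2 * e M)))|].
    + lra.
    + exact HC.
    + intros y Hy. rewrite Cmod_mult. apply Rmult_le_compat_l; [apply Cmod_ge_0|].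
      assert (B : forall x : R, Rabs x = INR M -> (Cmod (gauss (x + y * z)) <= e M)%R).
      { intros x Hx. unfold e. rewrite <- Hx. apply Cmod_gauss_line, Hy. }
      unfold Cminus. eapply Rle_trans; [apply Cmod_triangle|]. rewrite Cmod_opp.
      pose proof (B (INR M) (Rabs_pos_eq _ (pos_INR M))).
      pose proof (B (- INR M)%R) as B2. rewrite Rabs_Ropp, (Rabs_pos_eq _ (pos_INR M)) in B2. specialize (B2 eq_refl). lra.
    + right. ring.
  - replace (Finite 0) with (Rbar_mult (4 * Cmod z)%R 0%R) by (simpl; f_equal; ring).
    apply is_lim_seq_scal_l. apply exp_gauss_lim, Halpha.
Qed.

Lemma Ccont_gauss : Ccont (fun x => gauss x).
Proof. eapply CderAt_cont. intros x. unfold gauss. cder. reflexivity. Qed.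

Definition half_gint (t : R) : C := CInt (fun x => gauss x) 0 t.

Lemma CderAt_half_gint t : CderAt half_gint t (gauss t).
Proof. apply (CInt_primitive (fun x => gauss x) 0 t Ccont_gauss). Qed.

Lemma half_gint_odd t : half_gint (- t) = - half_gint t.
Proof.
  assert (HD : forall x, CderAt (fun t => half_gint ((-1) * t)%R + half_gint t) x 0).
  { intros x. eapply CderAt_eq.
    - apply CderAt_plus; [apply (CderAt_comp_scal half_gint (-1)), CderAt_half_gint|apply CderAt_half_gint].
    - rewrite RtoC_mult. unfold gauss. replace (RtoC (-1)) with (- RtoC 1) by (rewrite <- RtoC_opp; reflexivity).
      replace (- (1) * x * (- (1) * x)) with (x * x) by ring. ring. }
  pose proof (CderAt_0_const _ 0 t HD) as E. cbv beta in E. rewrite Rmult_0_r in E.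
  unfold half_gint in E at 3 4. rewrite !CInt_point in E.
  replace ((-1) * t)%R with (- t)%R in E by ring.
  replace (half_gint (- t)) with ((half_gint (- t) + half_gint t) - half_gint t) by ring.
  rewrite E. ring.
Qed.

Lemma gint_half M : gint M 0 = 2 * half_gint (INR M).
Proof.
  unfold gint. rewrite (CInt_ext _ (fun x => gauss x)) by (intros; f_equal; ring).
  pose proof (CInt_Chasles (fun x => gauss x) 0 (- INR M) (INR M) Ccont_gauss) as E.
  fold (half_gint (- INR M)) in E. fold (half_gint (INR M)) in E. rewrite half_gint_odd in E.
  replace (CInt _ _ _) with ((- half_gint (INR M) + CInt (fun x => gauss x) (- INR M) (INR M)) + half_gint (INR M)) by ring.
  rewrite E. ring.
Qed.

(* [half_gint t ^ 2 + gtail t / alpha] does not depend on [t]; its value at [t = 0]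
   is [PI / (4 alpha)], and [gtail t] tends to 0. *)
Definition gtail (t : R) : C :=
  CInt (fun x => RtoC (/ (1 + x ^ 2)) * Cexp (- (alpha * (t * t * RtoC (1 + x ^ 2))))) 0 1.

Lemma one_sqr_pos x : (0 < 1 + x ^ 2)%R.
Proof. pose proof (pow2_ge_0 x). lra. Qed.

Lemma Ccont_inv_sqr : Ccont (fun x => RtoC (/ (1 + x ^ 2))).
Proof.
  apply Ccont_RtoC. intros x. apply continuous_ex_derive.
  auto_derive. pose proof (one_sqr_pos x). simpl in H. lra.
Qed.

Lemma CderAt_one_sqr x : CderAt (fun x => RtoC (1 + x ^ 2)) x (2 * x).
Proof.
  apply (CderAt_ext (fun t => 1 + t * t)); [intros t; simpl; rewrite !RtoC_plus, !RtoC_mult; ring|].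
  cder. ring.
Qed.
#[local] Hint Resolve CderAt_one_sqr : cder.

Lemma Ccont_gtail (t : R) : Ccont (fun x => Cexp (- (alpha * (t * t * RtoC (1 + x ^ 2))))).
Proof. eapply CderAt_cont. intros x. unfold gauss. cder. reflexivity. Qed.
#[local] Hint Resolve Ccont_inv_sqr Ccont_gtail : ccont.

(** Differentiation under the integral cancels the denominator [1 + x ^ 2]. The exponential then
    splits into [gauss t] and a Gaussian in [t * x], which the substitution [t * x] integrates to
    [half_gint t]. *)
Lemma CderAt_gtail t : CderAt gtail t (- (2 * alpha * (gauss t * half_gint t))).
Proof.
  pose (F := fun t x : R => RtoC (/ (1 + x ^ 2)) * Cexp (- (alpha * (t * t * RtoC (1 + x ^ 2))))).
  pose (F' := fun t x : R => (- (2 * alpha * t)) * Cexp (- (alpha * (t * t * (1 + x * x))))).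
  eapply CderAt_eq.
  - apply (CInt_param_derive F F' 0 1 t).
    + intros y x. unfold F, F'. cder.
      replace (1 + x * x) with (RtoC (1 + x ^ 2)) by (simpl; rewrite RtoC_plus, !RtoC_mult; ring).
      rewrite RtoC_inv by (apply Rgt_not_eq, one_sqr_pos).
      field. apply RtoC_neq_0, Rgt_not_eq, one_sqr_pos.
    + intros y. unfold F. auto with ccont.
    + intros y x. unfold F'. auto 20 with ccont2.
  - unfold F'.
    assert (HC : Ccont (fun x => t * gauss (RtoC (t * x)))).
    { eapply CderAt_cont. intros x. apply (CderAt_ext (fun x => t * gauss (t * x))).
      - intros y. rewrite RtoC_mult. reflexivity.
      - unfold gauss. cder. reflexivity. }
    rewrite (CInt_ext _ (fun x => (- (2 * alpha * gauss t)) * (t * gauss (RtoC (t * x))))).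
    + rewrite CInt_scal by exact HC.
      rewrite (CInt_derive (fun x => half_gint (t * x)) (fun x => t * gauss (RtoC (t * x))) 0 1).
      * rewrite Rmult_0_r, Rmult_1_r. unfold half_gint at 2. rewrite CInt_point. ring.
      * intros x. apply CderAt_comp_scal, CderAt_half_gint.
      * exact HC.
    + intros x. unfold gauss. rewrite RtoC_mult.
      replace (- (alpha * (t * t * (1 + x * x)))) with (- (alpha * (t * t)) + - (alpha * (t * x * (t * x)))) by ring.
      rewrite Cexp_plus. ring.
Qed.

Lemma gtail_0 : gtail 0 = PI / 4.
Proof.
  unfold gtail. rewrite (CInt_ext _ (fun x => RtoC (/ (1 + x ^ 2)))).
  - rewrite (CInt_derive (fun x => RtoC (atan x)) (fun x => RtoC (/ (1 + x ^ 2)))).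
    + rewrite atan_1, atan_0, RtoC_div by lra. ring.
    + intros x. split; simpl; [|apply is_derive_const_R].
      apply is_derive_Reals. exact (derivable_pt_lim_atan x).
    + apply Ccont_inv_sqr.
  - intros x. replace (- (alpha * (0 * 0 * RtoC (1 + x ^ 2)))) with (RtoC 0) by ring. rewrite Cexp_0. ring.
Qed.

Lemma gauss_invariant t : half_gint t * half_gint t + / alpha * gtail t = PI / (4 * alpha).
Proof.
  pose proof alpha_neq_0 as Ha.
  assert (HD : forall x, CderAt (fun t => half_gint t * half_gint t + / alpha * gtail t) x 0).
  { intros x. eapply CderAt_eq.
    - apply CderAt_plus; [apply CderAt_mult; apply CderAt_half_gint|apply CderAt_mult; [apply CderAt_const|apply CderAt_gtail]].
    - cbv beta. field. exact Ha. }
  rewrite (CderAt_0_const _ 0 t HD), gtail_0. unfold half_gint. rewrite CInt_point. field. exact Ha.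
Qed.

Lemma gtail_bound t : (Cmod (gtail t) <= 2 * exp (- (Re alpha * t ^ 2)))%R.
Proof.
  eapply Rle_trans; [apply (CInt_bound _ 0 1 (exp (- (Re alpha * t ^ 2))))|right; ring].
  - lra.
  - auto with ccont.
  - intros x Hx. rewrite Cmod_mult, Cmod_R, Cmod_Cexp.
    rewrite Rabs_pos_eq by (left; apply Rinv_0_lt_compat, one_sqr_pos).
    rewrite <- (Rmult_1_l (exp (- (Re alpha * t ^ 2)))).
    apply Rmult_le_compat; [left; apply Rinv_0_lt_compat, one_sqr_pos|left; apply exp_pos| |].
    + rewrite <- Rinv_1. apply Rinv_le_contravar; [lra|]. pose proof (pow2_ge_0 x). lra.
    + apply exp_le.
      replace (- (alpha * (t * t * RtoC (1 + x ^ 2)))) with (RtoC (- (t ^ 2 * (1 + x ^ 2))) * alpha)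
        by (rewrite RtoC_opp, RtoC_mult, RtoC_pow; ring).
      rewrite Re_RtoC_mult. pose proof (pow2_ge_0 x). pose proof (pow2_ge_0 t).
      assert (0 <= Re alpha * (t ^ 2 * x ^ 2))%R by (apply Rmult_le_pos; [lra|apply Rmult_le_pos; assumption]). lra.
Qed.

Lemma gint_sqr_lim : Clim (fun M => gint M 0 * gint M 0) (PI / alpha).
Proof.
  pose proof alpha_neq_0 as Ha.
  apply Clim_ext with (fun M => PI / alpha + (- (4 / alpha)) * gtail (INR M)).
  - intros M. rewrite gint_half. pose proof (gauss_invariant (INR M)) as E.
    replace (PI / alpha) with (4 * (PI / (4 * alpha))) by (field; exact Ha). rewrite <- E. field. exact Ha.
  - apply Clim_eq with (PI / alpha + (- (4 / alpha)) * 0); [|ring].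
    apply Clim_plus; [apply Clim_const|apply Clim_scal].
    apply Clim_bound with (fun M => (2 * exp (- (Re alpha * INR M ^ 2) + 0 * INR M + 0))%R).
    + intros M. rewrite Cminus_0_r. eapply Rle_trans; [apply gtail_bound|]. right. f_equal. f_equal. ring.
    + replace (Finite 0) with (Rbar_mult 2%R 0%R) by (simpl; f_equal; ring).
      apply is_lim_seq_scal_l, exp_gauss_lim, Halpha.
Qed.
End Gauss.

Lemma Clim_Csum (u : nat -> nat -> C) (s : nat -> C) (N : nat) :
  (forall i, Clim (u i) (s i)) -> Clim (fun M => Csum (fun i => u i M) N) (Csum s N).
Proof.
  intros H. induction N as [|N IH]; [exact (Clim_const 0)|]. cbn [Csum]. apply Clim_plus; [exact IH|apply H].
Qed.

(** * Poisson summation for a Gaussian *)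

Section GaussPoisson.
Context (alpha beta gamma : C) (Halpha : (0 < Re alpha)%R).

Definition gauss_fun (x : R) : C := Cexp (- (alpha * (x * x)) + beta * x + gamma).

(* Completing the square: [gauss_fun x * e^{2 pi i c x}] is [gauss_coeff c] times a shifted Gaussian. *)
Definition gauss_coeff (c : C) : C := Cexp (gamma + (beta + 2 * PI * Ci * c) * (beta + 2 * PI * Ci * c) / (4 * alpha)).

Lemma gauss_fun_shift (c : C) (x : R) :
  cis2pi (c * x) * gauss_fun x =
  gauss_coeff c * gauss alpha (x + - ((beta + 2 * PI * Ci * c) / (2 * alpha))).
Proof.
  pose proof (alpha_neq_0 alpha Halpha) as Ha.
  unfold cis2pi, gauss_fun, gauss_coeff, gauss. rewrite <- !Cexp_plus. f_equal. field. exact Ha.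
Qed.

Lemma CderAt_gauss_fun x : CderAt gauss_fun x ((beta - 2 * alpha * x) * gauss_fun x).
Proof. unfold gauss_fun. cder. ring. Qed.
#[local] Hint Resolve CderAt_gauss_fun : cder.

Lemma Ccont_gauss_fun : Ccont gauss_fun.
Proof. eapply CderAt_cont. apply CderAt_gauss_fun. Qed.

Definition gauss_fun'' (x : R) : C :=
  ((beta - 2 * alpha * x) * (beta - 2 * alpha * x) - 2 * alpha) * gauss_fun x.

Lemma CderAt_gauss_fun' x : CderAt (fun x => (beta - 2 * alpha * x) * gauss_fun x) x (gauss_fun'' x).
Proof. unfold gauss_fun''. cder. ring. Qed.

Lemma Ccont_gauss_fun'' : Ccont gauss_fun''.
Proof. unfold gauss_fun''. pose proof Ccont_gauss_fun. auto 20 with ccont. Qed.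

Lemma Cmod_gauss_fun x : Cmod (gauss_fun x) = exp (- (Re alpha * x ^ 2) + Re beta * x + Re gamma).
Proof.
  unfold gauss_fun. rewrite Cmod_Cexp. f_equal.
  destruct alpha, beta, gamma; simpl. ring.
Qed.

Lemma gauss_fun_bounds : exists K, (0 <= K)%R /\ forall x,
  (Cmod (gauss_fun x) <= K / (1 + x ^ 2))%R /\ (Cmod (gauss_fun'' x) <= K / (1 + x ^ 2))%R.
Proof.
  destruct (exp_gauss_bound (Re alpha) (Re beta) (Re gamma) Halpha) as [B [HB HE]].
  set (A := (Cmod beta + 2 * Cmod alpha)%R).
  assert (HA : (0 <= A)%R) by (unfold A; pose proof (Cmod_ge_0 alpha); pose proof (Cmod_ge_0 beta); lra).
  (* [D] is chosen so that both 1 and the polynomial factor of [gauss_fun''] are at most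
     [D * (1 + x ^ 2)] in modulus. *)
  set (D := (2 * A ^ 2 + 2 * Cmod alpha + 1)%R).
  assert (HD : (1 <= D)%R) by (unfold D; pose proof (Cmod_ge_0 alpha); pose proof (pow2_ge_0 A); lra).
  exists (D * B)%R. split; [apply Rmult_le_pos; lra|]. intros x. specialize (HE x).
  rewrite <- Cmod_gauss_fun in HE. set (g := Cmod (gauss_fun x)) in *.
  assert (Hg : (0 <= g)%R) by apply Cmod_ge_0. pose proof (pow2_ge_0 x) as Hx.
  set (y := (1 + x ^ 2)%R) in *. assert (Hy : (1 <= y)%R) by (unfold y; lra).
  assert (Hgy : (g * y <= B / y)%R).
  { apply Rmult_le_reg_r with y; [lra|]. unfold Rdiv. rewrite Rmult_assoc, Rmult_assoc, Rinv_l by lra. simpl in HE. lra. }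
  assert (HBy : (0 <= B / y)%R) by (apply Rmult_le_pos; [exact HB|left; apply Rinv_0_lt_compat; lra]).
  replace (D * B / y)%R with (D * (B / y))%R by (unfold Rdiv; ring).
  split; [nra|]. unfold gauss_fun''. rewrite Cmod_mult. fold g.
  assert (HQ : (Cmod ((beta - 2 * alpha * x) * (beta - 2 * alpha * x) - 2 * alpha) <= D * y)%R).
  { unfold Cminus at 1. eapply Rle_trans; [apply Cmod_triangle|]. rewrite Cmod_opp, !Cmod_mult, Cmod_R.
    rewrite (Rabs_pos_eq 2) by lra.
    assert (HL : (Cmod (beta - 2 * alpha * x) <= A * (1 + Rabs x))%R).
    { unfold Cminus. eapply Rle_trans; [apply Cmod_triangle|]. rewrite Cmod_opp, !Cmod_mult, !Cmod_R, (Rabs_pos_eq 2) by lra.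
      unfold A. pose proof (Cmod_ge_0 alpha). pose proof (Cmod_ge_0 beta). pose proof (Rabs_pos x). nra. }
    pose proof (Cmod_ge_0 (beta - 2 * alpha * x)) as HL0. set (L := Cmod (beta - 2 * alpha * x)) in *.
    assert (HL2 : (L * L <= (A * (1 + Rabs x)) * (A * (1 + Rabs x)))%R) by (apply Rmult_le_compat; assumption).
    assert (Ha : ((1 + Rabs x) * (1 + Rabs x) <= 2 * y)%R).
    { unfold y. rewrite <- (pow2_abs x). pose proof (pow2_ge_0 (1 - Rabs x)). simpl in *. lra. }
    assert (Hc : (A ^ 2 * ((1 + Rabs x) * (1 + Rabs x)) <= A ^ 2 * (2 * y))%R)
      by (apply Rmult_le_compat_l; [apply pow2_ge_0|exact Ha]).
    unfold D. pose proof (Cmod_ge_0 alpha). pose proof (pow2_ge_0 A). simpl in *. nra. }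
  eapply Rle_trans; [apply Rmult_le_compat_r; [exact Hg|exact HQ]|].
  replace (D * y * g)%R with (D * (g * y))%R by ring. apply Rmult_le_compat_l; [lra|exact Hgy].
Qed.

Lemma gauss_fun_ends : Clim (fun M => gauss_fun (INR M) - gauss_fun (- INR M)%R) 0.
Proof.
  destruct gauss_fun_bounds as [K [HK HB]].
  apply (Clim_ext (fun M => gauss_fun (INR M) + (- (1)) * gauss_fun (- INR M)%R)); [intros; ring|].
  apply Clim_eq with (0 + (- (1)) * 0); [|ring].
  assert (L : forall g : nat -> R, (forall M, Rabs (g M) = INR M) -> Clim (fun M => gauss_fun (g M)) 0).
  { intros g Hg. apply Clim_bound with (fun M => (2 * K / INR (S M))%R).
    - intros M. rewrite Cminus_0_r. eapply Rle_trans; [apply HB|]. rewrite <- (pow2_abs (g M)), Hg.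
      unfold Rdiv. rewrite (Rmult_comm 2 K), Rmult_assoc. apply Rmult_le_compat_l; [exact HK|].
      rewrite S_INR. set (x := INR M). assert (Hx : (0 <= x)%R) by apply pos_INR.
      apply Rmult_le_reg_l with ((1 + x ^ 2) * (x + 1))%R; [simpl; nra|].
      replace ((1 + x ^ 2) * (x + 1) * / (1 + x ^ 2))%R with (x + 1)%R by (field; simpl; nra).
      replace ((1 + x ^ 2) * (x + 1) * (2 * / (x + 1)))%R with (2 * (1 + x ^ 2))%R by (field; lra).
      pose proof (pow2_ge_0 (x - 1)). simpl in *. nra.
    - apply (is_lim_seq_incr_1 (fun n => (2 * K / INR n)%R)), is_lim_seq_div_INR. }
  apply Clim_plus; [|apply Clim_scal]; apply L; intros M.
  - apply Rabs_pos_eq, pos_INR.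
  - rewrite Rabs_Ropp. apply Rabs_pos_eq, pos_INR.
Qed.

Definition gauss_coeff_sum (N : nat) : C :=
  gauss_coeff 0 + Csum (fun i => gauss_coeff (INR (S i)) + gauss_coeff (- INR (S i))) N.

Lemma CInt_gauss_fun (c : C) (M : nat) :
  CInt (fun x => cis2pi (c * x) * gauss_fun x) (- INR M) (INR M) =
  gauss_coeff c * gint alpha M (- ((beta + 2 * PI * Ci * c) / (2 * alpha))).
Proof.
  rewrite (CInt_ext _ (fun x => gauss_coeff c * gauss alpha (x + - ((beta + 2 * PI * Ci * c) / (2 * alpha)))))
    by (intros; apply gauss_fun_shift).
  apply CInt_scal. apply Ccont_gauss_shift.
Qed.

(** For fixed [N] the kernel is a finite sum of exponentials. Each of them produces a shifted
    Gaussian, and [gint_shift] replaces all shifts by the common factor [gint alpha M 0] as the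
    window grows. *)
Lemma CInt_gauss_dirichlet_lim (N : nat) :
  Clim (fun M => CInt (fun x => RtoC (dirichlet N x) * gauss_fun x) (- INR M) (INR M)
                 - gint alpha M 0 * gauss_coeff_sum N) 0.
Proof.
  pose (z := fun c => - ((beta + 2 * PI * Ci * c) / (2 * alpha))).
  pose (d := fun c M => gauss_coeff c * (gint alpha M (z c) - gint alpha M 0)).
  assert (Hd : forall c, Clim (d c) 0).
  { intros c. apply Clim_eq with (gauss_coeff c * 0); [|ring]. apply Clim_scal, gint_shift, Halpha. }
  apply (Clim_ext (fun M => d 0 M + Csum (fun i => d (INR (S i)) M + d (- INR (S i)) M) N)).
  - intros M. rewrite CInt_dirichlet by apply Ccont_gauss_fun.
    rewrite (CInt_ext gauss_fun (fun x => cis2pi (0 * x) * gauss_fun x))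
      by (intros; rewrite Cmult_0_l, cis2pi_0; ring).
    rewrite CInt_gauss_fun.
    rewrite (Csum_ext (fun i => CInt _ _ _ + _)
      (fun i => (d (INR (S i)) M + d (- INR (S i)) M) +
        gint alpha M 0 * (gauss_coeff (INR (S i)) + gauss_coeff (- INR (S i))))).
    + rewrite (Csum_plus (fun i => d (INR (S i)) M + d (- INR (S i)) M)), (Csum_scal (gint alpha M 0)).
      unfold gauss_coeff_sum, d, z. ring.
    + intros i _. rewrite !CInt_gauss_fun. unfold d, z. ring.
  - apply Clim_eq with (0 + Csum (fun _ => 0) N).
    + apply Clim_plus; [apply Hd|]. apply (Clim_Csum (fun i M => d (INR (S i)) M + d (- INR (S i)) M)).
      intros i. apply Clim_eq with (0 + 0); [|ring]. apply Clim_plus; apply Hd.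
    + assert (E : Csum (fun _ => 0) N = 0) by (clear; induction N as [|N IH]; simpl; [reflexivity|rewrite IH; ring]).
      rewrite E. ring.
Qed.

(* The Gaussian integral enters only through its square, which avoids choosing a
   square root of [alpha]. *)
Lemma gauss_poisson (T S : C) :
  Clim (Zsum (fun n => gauss_fun (IZR n))) T -> Clim gauss_coeff_sum S ->
  T * T = PI / alpha * (S * S).
Proof.
  intros HT HS.
  destruct gauss_fun_bounds as [K [HK HB]].
  pose (T' := fun M => Ctrapezoid gauss_fun (- INR M) (2 * M)).
  assert (HT' : Clim T' T).
  { apply (Clim_ext (fun M => Zsum (fun n => gauss_fun (IZR n)) M + / 2 * (gauss_fun (INR M) - gauss_fun (- INR M)%R))).
    - intros M. unfold T'. rewrite Ctrapezoid_Zsum. field.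
    - apply Clim_eq with (T + / 2 * 0); [|ring]. apply Clim_plus; [exact HT|apply Clim_scal, gauss_fun_ends]. }
  pose proof (gint_sqr_lim alpha Halpha) as HG.
  destruct (Clim_bounded _ _ HT') as [BT HBT]. destruct (Clim_bounded _ _ HS) as [BS HBS].
  destruct (Clim_bounded _ _ HG) as [BG HBG].
  assert (HBG' : forall M, (Cmod (gint alpha M 0) <= 1 + BG)%R).
  { intros M. specialize (HBG M). rewrite Cmod_mult in HBG. pose proof (Cmod_ge_0 (gint alpha M 0)). nra. }
  assert (BG0 : (0 <= 1 + BG)%R) by (pose proof (HBG' O); pose proof (Cmod_ge_0 (gint alpha 0 0)); lra).
  set (B := (BT + (1 + BG) * BS)%R).
  (* With [g = gint alpha M 0], the difference of squares factors as
     [(T' M - g * SN) * (T' M + g * SN)]. The first factor is at most [24 * K / N] up to a term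
     vanishing in [M], the second is bounded, and [M] tends to infinity before [N]. *)
  assert (Hineq : forall N, (0 < N)%nat ->
    (Cmod (T * T - PI / alpha * (gauss_coeff_sum N * gauss_coeff_sum N)) <= (24 * K / INR N) * B)%R).
  { intros N HN. set (SN := gauss_coeff_sum N).
    pose (I := fun M => CInt (fun x => RtoC (dirichlet N x) * gauss_fun x) (- INR M) (INR M)).
    assert (L1 : is_lim_seq (fun M => Cmod (T' M * T' M - gint alpha M 0 * gint alpha M 0 * (SN * SN)))
                   (Cmod (T * T - PI / alpha * (SN * SN)))).
    { assert (L : Clim (fun M => T' M * T' M + (- (SN * SN)) * (gint alpha M 0 * gint alpha M 0)) (T * T - PI / alpha * (SN * SN))).
      { apply Clim_eq with (T * T + (- (SN * SN)) * (PI / alpha)); [|ring].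
        apply Clim_plus; [apply Clim_mult; assumption|apply Clim_scal, HG]. }
      apply is_lim_seq_spec. intros eps. apply is_lim_seq_spec in L. destruct (L eps) as [M0 HM0].
      exists M0. intros M HM. specialize (HM0 M HM). rewrite Rminus_0_r, Rabs_pos_eq in HM0 by apply Cmod_ge_0.
      set (A := T * T - _) in *.
      replace (T' M * T' M + - (SN * SN) * (gint alpha M 0 * gint alpha M 0)) with
        (T' M * T' M - gint alpha M 0 * gint alpha M 0 * (SN * SN)) in HM0 by ring.
      set (D := T' M * T' M - _) in *. clearbody A D.
      assert (H1 : (Cmod D <= Cmod (D - A) + Cmod A)%R) by (replace D with ((D - A) + A) at 1 by ring; apply Cmod_triangle).
      assert (H2 : (Cmod A <= Cmod (D - A) + Cmod D)%R).
      { rewrite Cmod_sub_sym. replace A with ((A - D) + D) at 1 by ring. apply Cmod_triangle. }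
      apply Rabs_def1; lra. }
    pose proof (CInt_gauss_dirichlet_lim N) as L2.
    apply (is_lim_seq_le _ (fun M => (24 * K / INR N + Cmod (I M - gint alpha M 0 * SN - 0)) * B)%R
             (Finite _) (Finite ((24 * K / INR N + 0) * B))) in L1.
    - rewrite Rplus_0_r in L1. exact L1.
    - intros M. rewrite Cminus_0_r.
      replace (T' M * T' M - gint alpha M 0 * gint alpha M 0 * (SN * SN)) with
        ((T' M - gint alpha M 0 * SN) * (T' M + gint alpha M 0 * SN)) by ring.
      rewrite Cmod_mult. apply Rmult_le_compat; [apply Cmod_ge_0|apply Cmod_ge_0| |].
      + eapply Rle_trans; [apply (Cmod_sub_triangle _ (I M))|]. apply Rplus_le_compat_r.
        apply (poisson_complex gauss_fun (fun x => (beta - 2 * alpha * x) * gauss_fun x) gauss_fun'' K M N).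
        * apply CderAt_gauss_fun. * apply CderAt_gauss_fun'. * apply Ccont_gauss_fun''. * apply HB. * exact HN.
      + eapply Rle_trans; [apply Cmod_triangle|]. unfold B. rewrite Cmod_mult.
        apply Rplus_le_compat; [apply HBT|].
        apply Rmult_le_compat; [apply Cmod_ge_0|apply Cmod_ge_0|apply HBG'|apply HBS].
    - apply (is_lim_seq_scal_r _ B (Finite (24 * K / INR N + 0))).
      apply is_lim_seq_plus'; [apply is_lim_seq_const|exact L2]. }
  assert (L : Clim (fun N => PI / alpha * (gauss_coeff_sum N * gauss_coeff_sum N)) (PI / alpha * (S * S)))
    by (apply Clim_scal, Clim_mult; exact HS).
  apply (Clim_unique (fun N => PI / alpha * (gauss_coeff_sum (Datatypes.S N) * gauss_coeff_sum (Datatypes.S N)))).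
  - apply Clim_bound with (fun N => (24 * K * B / INR (Datatypes.S N))%R).
    + intros N. rewrite Cmod_sub_sym. eapply Rle_trans; [apply Hineq; lia|]. right. field. apply not_0_INR. lia.
    + apply (is_lim_seq_incr_1 (fun n => (24 * K * B / INR n)%R)), is_lim_seq_div_INR.
  - apply (Clim_sub (fun N => PI / alpha * (gauss_coeff_sum N * gauss_coeff_sum N)) _ Datatypes.S); [intros; lia|exact L].
Qed.
End GaussPoisson.

(** * The eta function *)

Lemma Csum_geom_bound (u : nat -> C) (b r : R) (n : nat) :
  (0 <= b)%R -> (0 <= r < 1)%R -> (forall i, (Cmod (u i) <= b * r ^ i)%R) ->
  (Cmod (Csum u n) <= b / (1 - r))%R.
Proof.
  intros Hb Hr H. assert (E : (Cmod (Csum u n) <= b * ((1 - r ^ n) / (1 - r)))%R).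
  { induction n as [|n IH].
    - simpl. rewrite Cmod_0. right. field. lra.
    - cbn [Csum]. eapply Rle_trans; [apply Cmod_triangle|]. specialize (H n).
      replace (b * ((1 - r ^ S n) / (1 - r)))%R with (b * ((1 - r ^ n) / (1 - r)) + b * r ^ n)%R
        by (simpl; field; lra). lra. }
  eapply Rle_trans; [exact E|]. unfold Rdiv. apply Rmult_le_compat_l; [exact Hb|].
  rewrite <- (Rmult_1_l (/ (1 - r))) at 2. apply Rmult_le_compat_r; [left; apply Rinv_0_lt_compat; lra|].
  pose proof (pow_le r n (proj1 Hr)). lra.
Qed.

Lemma pow_range (r : R) (n : nat) : (0 <= r <= 1)%R -> (0 <= r ^ n <= 1)%R.
Proof.
  intros H. split; [apply pow_le; lra|]. rewrite <- (pow1 n). apply pow_incr. exact H.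
Qed.

(** * Shanks's identity and convergence of the Euler product *)

Section Shanks.
Context (q : C).

(** The q-Pochhammer symbol (q^{s+1}; q)_k. *)
Fixpoint qprod (s k : nat) : C :=
  match k with O => 1 | S k' => qprod s k' * (1 - q ^ (s + k' + 1)) end.

Fixpoint tri (n : nat) : nat := match n with O => O | S m => (tri m + S m)%nat end.

Lemma qprod_head s k : qprod s (S k) = (1 - q ^ (s + 1)) * qprod (S s) k.
Proof.
  induction k as [|k IH]; [simpl; rewrite Nat.add_0_r; ring|].
  change (qprod s (S (S k))) with (qprod s (S k) * (1 - q ^ (s + S k + 1))). rewrite IH.
  cbn [qprod]. replace (s + S k + 1)%nat with (S s + k + 1)%nat by lia. ring.
Qed.

Definition shanks_term (n s : nat) : C := (- (1)) ^ s * qprod s (n - s) * q ^ (s * n + tri s).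

Definition shanks_sum (n : nat) : C := Csum (shanks_term n) (S n).

(** The difference of the terms for [n + 1] and [n] telescopes in [s]: it is [g (s + 1) - g s] with
    [g s = shanks_term n s * (1 - q ^ s)], which vanishes at 0. What remains at the upper end are
    the two new pentagonal terms, of index [n + 1] and [- (n + 1)]. *)
Lemma shanks_step (n : nat) :
  shanks_sum (S n) = shanks_sum n +
    (- (1)) ^ S n * (q ^ (S n * S n + tri (S n)) + q ^ (S n * S n + tri n)).
Proof.
  pose (g := fun s => shanks_term n s * (1 - q ^ s)).
  assert (Hs : forall s, (s < n)%nat -> shanks_term (S n) s - shanks_term n s = g (S s) - g s).
  { intros s Hs. unfold g, shanks_term. replace (n - s)%nat with (S (n - S s)) by lia.
    replace (S n - s)%nat with (S (S (n - S s))) by lia.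
    change (qprod s (S (S (n - S s)))) with (qprod s (S (n - S s)) * (1 - q ^ (s + S (n - S s) + 1))).
    rewrite qprod_head. replace (s + S (n - S s) + 1)%nat with (S n) by lia.
    replace (S s * n + tri (S s))%nat with ((s * n + tri s) + (S n + s))%nat by (simpl; lia).
    replace (s * S n + tri s)%nat with ((s * n + tri s) + s)%nat by lia.
    replace (s + 1)%nat with (S s) by lia. rewrite !Cpow_add_r. cbn [Cpow]. ring. }
  assert (Hk : forall k, (k <= n)%nat -> Csum (shanks_term (S n)) k - Csum (shanks_term n) k = g k).
  { induction k as [|k IH]; intros Hk.
    - unfold g. simpl. ring.
    - cbn [Csum]. specialize (Hs k ltac:(lia)). specialize (IH ltac:(lia)).
      replace (g (S k)) with ((g (S k) - g k) + g k) by ring. rewrite <- Hs, <- IH. ring. }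
  unfold shanks_sum. cbn [Csum]. specialize (Hk n (le_n n)).
  replace (Csum (shanks_term (S n)) n) with ((Csum (shanks_term (S n)) n - Csum (shanks_term n) n) + Csum (shanks_term n) n) by ring.
  rewrite Hk. unfold g, shanks_term. rewrite !Nat.sub_diag. replace (S n - n)%nat with 1%nat by lia.
  cbn [qprod]. replace (n + 0 + 1)%nat with (S n) by lia.
  replace (S n * S n + tri n)%nat with ((n * n + tri n) + (n + S n))%nat by lia.
  replace (n * S n + tri n)%nat with ((n * n + tri n) + n)%nat by lia.
  rewrite (Cpow_add_r q (n * n + tri n) (n + S n)), (Cpow_add_r q (n * n + tri n) n), (Cpow_add_r q n (S n)).
  cbn [Cpow]. ring.
Qed.

Context (Hq : (Cmod q < 1)%R).
Let r := Cmod q.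

Lemma Cmod_q_range : (0 <= r < 1)%R.
Proof. split; [apply Cmod_ge_0|exact Hq]. Qed.

Lemma qprod_bound s k : (Cmod (qprod s k) <= exp (1 / (1 - r)))%R.
Proof.
  pose proof Cmod_q_range as Hr.
  assert (E : (Cmod (qprod s k) <= exp ((1 - r ^ k) / (1 - r)))%R).
  { induction k as [|k IH].
    - simpl. rewrite Cmod_1. replace ((1 - 1) / (1 - r))%R with 0%R by (field; lra). rewrite exp_0. lra.
    - cbn [qprod]. rewrite Cmod_mult.
      replace ((1 - r ^ S k) / (1 - r))%R with ((1 - r ^ k) / (1 - r) + r ^ k)%R by (simpl; field; lra).
      rewrite exp_plus. apply Rmult_le_compat; try apply Cmod_ge_0; [exact IH|].
      eapply Rle_trans; [apply Cmod_triangle|]. rewrite Cmod_1, Cmod_opp, Cmod_pow. fold r.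
      replace (s + k + 1)%nat with (k + (s + 1))%nat by lia. rewrite pow_add.
      pose proof (pow_le r k (proj1 Hr)) as H1.
      assert (H2 : (r ^ (s + 1) <= 1)%R) by (rewrite <- (pow1 (s + 1)); apply pow_incr; lra).
      pose proof (exp_ineq1_le (r ^ k)). nra. }
  eapply Rle_trans; [exact E|]. apply exp_le. unfold Rdiv. apply Rmult_le_compat_r; [left; apply Rinv_0_lt_compat; lra|].
  pose proof (pow_le r k (proj1 Hr)). lra.
Qed.

Lemma euler_prod_qprod n : euler_prod q n = qprod 0 n.
Proof. induction n as [|n IH]; [reflexivity|]. cbn [euler_prod qprod]. rewrite IH. replace (0 + n + 1)%nat with (S n) by lia. reflexivity. Qed.

(** By [1 + y <= exp y], one has [exp (- y) <= 1 - x] as soon as [y >= x / (1 - x)]. For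
    [x = r ^ (n + 1)] this allows [y = r ^ n / (1 - r)], and the exponents add up to a geometric
    sum. The bound is uniform in [n], so the infinite product does not vanish. *)
Lemma euler_prod_lower n : (exp (- (1 / (1 - r) / (1 - r))) <= Cmod (euler_prod q n))%R.
Proof.
  pose proof Cmod_q_range as Hr.
  assert (E : (exp (- ((1 - r ^ n) / (1 - r) / (1 - r))) <= Cmod (euler_prod q n))%R).
  { induction n as [|n IH].
    - simpl. rewrite Cmod_1. replace (- ((1 - 1) / (1 - r) / (1 - r)))%R with 0%R by (field; lra). rewrite exp_0. lra.
    - cbn [euler_prod]. rewrite Cmod_mult.
      replace (- ((1 - r ^ S n) / (1 - r) / (1 - r)))%R with
        (- ((1 - r ^ n) / (1 - r) / (1 - r)) + - (r ^ n / (1 - r)))%R by (simpl; field; lra).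
      rewrite exp_plus. apply Rmult_le_compat; try (left; apply exp_pos); [exact IH|].
      set (x := (r ^ S n)%R).
      assert (Hx : (0 <= x <= r)%R).
      { unfold x. simpl. pose proof (pow_range r n ltac:(lra)). nra. }
      apply Rle_trans with (1 - x)%R.
      + assert (H1 : (exp (r ^ n / (1 - r)) * (1 - x) >= 1)%R).
        { assert (Hy : (x / (1 - x) <= r ^ n / (1 - r))%R).
          { unfold Rdiv. apply Rmult_le_compat; [lra|left; apply Rinv_0_lt_compat; lra| |apply Rinv_le_contravar; lra].
            unfold x. simpl. rewrite <- (Rmult_1_l (r ^ n)) at 2. apply Rmult_le_compat_r; [apply pow_le; lra|lra]. }
          pose proof (exp_ineq1_le (r ^ n / (1 - r))).
          assert (E : (1 + x / (1 - x) = / (1 - x))%R) by (field; lra).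
          assert (E2 : (/ (1 - x) * (1 - x) = 1)%R) by (field; lra).
          assert (H2 : (/ (1 - x) <= exp (r ^ n / (1 - r)))%R) by lra.
          apply (Rmult_le_compat_r (1 - x)) in H2; lra. }
        rewrite exp_Ropp. apply Rmult_le_reg_l with (exp (r ^ n / (1 - r))); [apply exp_pos|].
        rewrite Rinv_r by (apply Rgt_not_eq, exp_pos). lra.
      + replace (1 - x)%R with (Cmod 1 - Cmod (q ^ S n))%R by (rewrite Cmod_1, Cmod_pow; reflexivity).
        assert (H : (Cmod 1 <= Cmod (1 - q ^ S n) + Cmod (q ^ S n))%R).
        { replace (RtoC 1) with ((1 - q ^ S n) + q ^ S n) at 1 by ring. apply Cmod_triangle. }
        lra. }
  eapply Rle_trans; [|exact E]. apply exp_le, Ropp_le_contravar. unfold Rdiv. rewrite !Rmult_assoc.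
  apply Rmult_le_compat_r; [left; apply Rmult_lt_0_compat; apply Rinv_0_lt_compat; lra|].
  pose proof (pow_le r n (proj1 Hr)). lra.
Qed.

Lemma ex_series_geom_scal (b : R) : ex_series (fun n => (b * r ^ n)%R).
Proof.
  pose proof Cmod_q_range as Hr. exists (b * / (1 - r))%R.
  apply (is_series_scal (K := R_AbsRing) (V := R_NormedModule) b). apply is_series_geom. rewrite Rabs_pos_eq; lra.
Qed.

(** The product is the series of its increments, dominated by a geometric series because the partial
    products are bounded. *)
Lemma euler_prod_lim : exists P, Clim (euler_prod q) P /\ P <> 0.
Proof.
  pose proof Cmod_q_range as Hr.
  destruct (ex_Clim_Csum (fun n => - (euler_prod q n * q ^ S n)) (fun n => (exp (1 / (1 - r)) * r ^ n)%R)) as [s Hs].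
  - intros n. rewrite Cmod_opp, Cmod_mult, euler_prod_qprod, Cmod_pow. fold r.
    apply Rmult_le_compat; [apply Cmod_ge_0|apply pow_le; lra|apply qprod_bound|].
    simpl. rewrite <- (Rmult_1_l (r ^ n)) at 2. apply Rmult_le_compat_r; [apply pow_le|]; lra.
  - apply ex_series_geom_scal.
  - assert (L : Clim (euler_prod q) (1 + s)).
    { apply Clim_ext with (fun n => 1 + Csum (fun n => - (euler_prod q n * q ^ S n)) n).
      - induction n as [|n IH]; [simpl; ring|]. cbn [Csum]. rewrite Cplus_assoc, IH. cbn [euler_prod]. ring.
      - apply Clim_plus; [apply Clim_const|exact Hs]. }
    exists (1 + s). split; [exact L|]. intros E. rewrite E in L.
    apply (is_lim_seq_le (fun _ => exp (- (1 / (1 - r) / (1 - r)))) _ (Finite (exp (- (1 / (1 - r) / (1 - r))))) (Finite 0)) in L.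
    + simpl in L. pose proof (exp_pos (- (1 / (1 - r) / (1 - r)))). lra.
    + intros n. rewrite Cminus_0_r. apply euler_prod_lower.
    + apply is_lim_seq_const.
Qed.

(** The term [s = 0] of Shanks's sum is the Euler product itself. Every other term carries at least
    the power [q ^ n], with further geometric decay in [s], so together they are of order
    [r ^ n]. *)
Lemma shanks_lim P : Clim (euler_prod q) P -> Clim shanks_sum P.
Proof.
  pose proof Cmod_q_range as Hr. intros HP.
  apply Clim_ext with (fun n => euler_prod q n + Csum (fun s => shanks_term n (S s)) n).
  - intros n. unfold shanks_sum. rewrite Csum_head, euler_prod_qprod. unfold shanks_term at 2.
    rewrite Nat.sub_0_r. simpl. ring.
  - apply Clim_eq with (P + 0); [|ring]. apply Clim_plus; [exact HP|].
    apply Clim_bound with (fun n => (exp (1 / (1 - r)) / (1 - r) * r ^ n)%R).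
    + intros n. rewrite Cminus_0_r.
      replace (exp (1 / (1 - r)) / (1 - r) * r ^ n)%R with ((exp (1 / (1 - r)) * r ^ n) / (1 - r))%R by (field; lra).
      apply Csum_geom_bound; [apply Rmult_le_pos; [left; apply exp_pos|apply pow_le; lra]|exact Hr|].
      intros s. unfold shanks_term. rewrite !Cmod_mult, !Cmod_pow, Cmod_opp, Cmod_1, pow1. fold r.
      rewrite Rmult_1_l, Rmult_assoc.
      apply Rmult_le_compat; [apply Cmod_ge_0|apply pow_le; lra|apply qprod_bound|].
      rewrite <- pow_add. replace (S s * n + tri (S s))%nat with (n + s + (s * n + tri s + 1))%nat by (simpl; lia).
      rewrite (pow_add r (n + s)). rewrite <- (Rmult_1_r (r ^ (n + s))) at 2.
      apply Rmult_le_compat_l; [apply pow_le; lra|]. rewrite <- (pow1 (s * n + tri s + 1)). apply pow_incr. lra.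
    + replace (Finite 0) with (Rbar_mult (exp (1 / (1 - r)) / (1 - r))%R 0%R) by (simpl; f_equal; ring).
      apply is_lim_seq_scal_l. apply is_lim_seq_geom. rewrite Rabs_pos_eq; lra.
Qed.
End Shanks.

(** The term (-1)^k q^{k(3k+1)/2 + 1/24} of Euler's series: the 1/24 of eta completes the square,
    and the sign is written as an exponential so that the term is a Gaussian in [k]. *)
Definition pent (tau : C) (k : Z) : C :=
  cis2pi (ZtoC k / 2) * cis2pi (tau * (ZtoC (6 * k + 1) * ZtoC (6 * k + 1)) / 24).

Lemma cis2pi_half : cis2pi (/ 2) = - (1).
Proof.
  rewrite <- RtoC_inv by lra. rewrite cis2pi_R. replace (2 * PI * / 2)%R with PI by field.
  rewrite cos_PI, sin_PI. apply C_ext; simpl; ring.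
Qed.

Lemma cis2pi_half_nat n : cis2pi (ZtoC (Z.of_nat n) / 2) = (- (1)) ^ n.
Proof.
  rewrite ZtoC_nat. replace (INR n / 2) with (INR n * / 2) by (unfold Cdiv; ring).
  rewrite <- cis2pi_pow, cis2pi_half. reflexivity.
Qed.

Lemma cis2pi_half_opp k : cis2pi (ZtoC (- k) / 2) = cis2pi (ZtoC k / 2).
Proof.
  rewrite <- (Cmult_1_r (cis2pi (ZtoC (- k) / 2))), <- (cis2pi_Z k), <- cis2pi_plus. f_equal.
  rewrite ZtoC_opp. field.
Qed.

Lemma INR_tri n : RtoC (INR (tri n)) = INR n * (INR n + 1) / 2.
Proof.
  induction n as [|n IH]; [simpl; field|]. cbn [tri]. rewrite plus_INR, RtoC_plus, IH, S_INR, RtoC_plus. field.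
Qed.

Lemma Cmod_nome tau : (0 < Im tau)%R -> (Cmod (cis2pi tau) < 1)%R.
Proof.
  intros H. rewrite Cmod_cis2pi, <- exp_0. apply exp_increasing. pose proof PI_RGT_0. nra.
Qed.

Lemma pent_nonneg tau n : pent tau (Z.of_nat n) =
  cis2pi (tau / 24) * ((- (1)) ^ n * cis2pi tau ^ (n * n + tri n)).
Proof.
  unfold pent. rewrite cis2pi_half_nat, cis2pi_pow.
  transitivity ((- (1)) ^ n * (cis2pi (tau / 24) * cis2pi (INR (n * n + tri n) * tau))); [|ring].
  rewrite <- cis2pi_plus. f_equal. f_equal. rewrite ZtoC_plus, ZtoC_mult, ZtoC_nat, plus_INR, mult_INR, RtoC_plus, RtoC_mult, INR_tri.
  unfold ZtoC. simpl. field.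
Qed.

Lemma pent_neg tau n : pent tau (- Z.of_nat (S n)) =
  cis2pi (tau / 24) * ((- (1)) ^ S n * cis2pi tau ^ (S n * S n + tri n)).
Proof.
  unfold pent. rewrite cis2pi_half_opp, cis2pi_half_nat, cis2pi_pow.
  transitivity ((- (1)) ^ S n * (cis2pi (tau / 24) * cis2pi (INR (S n * S n + tri n) * tau))); [|ring].
  rewrite <- cis2pi_plus. f_equal. f_equal. rewrite ZtoC_plus, ZtoC_mult, ZtoC_opp, ZtoC_nat, plus_INR, mult_INR, RtoC_plus, RtoC_mult, INR_tri.
  rewrite S_INR, RtoC_plus. unfold ZtoC. simpl. field.
Qed.

Lemma eta_euler tau P : Clim (euler_prod (cis2pi tau)) P -> dedekind_eta tau = cis2pi (tau / 24) * P.
Proof. intros H. unfold dedekind_eta. rewrite (CLim_eq _ _ H). reflexivity. Qed.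

Lemma Cmod_pent_lim tau : (0 < Im tau)%R -> Clim (fun n => pent tau (Z.of_nat n)) 0.
Proof.
  intros H. pose proof (Cmod_nome tau H) as Hq. set (q := cis2pi tau) in *.
  apply Clim_bound with (fun n => (Cmod (cis2pi (tau / 24)) * Cmod q ^ n)%R).
  - intros n. rewrite Cminus_0_r, pent_nonneg, !Cmod_mult, !Cmod_pow, Cmod_opp, Cmod_1, pow1, Rmult_1_l. fold q.
    apply Rmult_le_compat_l; [apply Cmod_ge_0|].
    assert (E : exists m, (n * n + tri n = n + m)%nat).
    { destruct n as [|n]; [exists O; reflexivity|]. exists (S n * n + tri (S n))%nat. lia. }
    destruct E as [m ->]. rewrite pow_add. pose proof (Cmod_ge_0 q).
    rewrite <- (Rmult_1_r (Cmod q ^ n)) at 2. apply Rmult_le_compat_l; [apply pow_le; lra|].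
    rewrite <- (pow1 m). apply pow_incr. lra.
  - replace (Finite 0) with (Rbar_mult (Cmod (cis2pi (tau / 24))) 0%R) by (simpl; f_equal; ring).
    apply is_lim_seq_scal_l, is_lim_seq_geom. rewrite Rabs_pos_eq; [exact Hq|apply Cmod_ge_0].
Qed.

Lemma eta_pentagonal tau : (0 < Im tau)%R -> Clim (Zsum (pent tau)) (dedekind_eta tau).
Proof.
  intros H. pose proof (Cmod_nome tau H) as Hq. set (q := cis2pi tau) in *.
  destruct (euler_prod_lim q Hq) as [P [HP _]]. rewrite (eta_euler tau P HP).
  (* Shanks's sum runs over |k| <= n and [Zsum] over -n <= k < n, whence the extra term. *)
  assert (E : forall n, cis2pi (tau / 24) * shanks_sum q n = Zsum (pent tau) n + pent tau (Z.of_nat n)).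
  { induction n as [|n IH].
    - rewrite pent_nonneg. unfold shanks_sum, shanks_term. simpl. unfold Zsum; simpl. ring.
    - rewrite shanks_step, Cmult_plus_distr_l, IH. unfold Zsum. cbn [Csum].
      rewrite pent_neg, (pent_nonneg tau (S n)). fold q. ring. }
  apply Clim_ext with (fun n => cis2pi (tau / 24) * shanks_sum q n + (- (1)) * pent tau (Z.of_nat n)).
  - intros n. rewrite E. ring.
  - apply Clim_eq with (cis2pi (tau / 24) * P + (- (1)) * 0); [|ring].
    apply Clim_plus; apply Clim_scal; [apply shanks_lim; assumption|apply Cmod_pent_lim, H].
Qed.

(** * Inversion of the square of eta *)

Section Inversion.
Context (tau : C) (Htau : (0 < Im tau)%R).

(** The terms of the dual series: the Gaussian coefficient of frequency [c] will be
    [kappa (2 * c + 1)], so Poisson summation yields a sum over odd integers. *)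
Definition kappa (k : C) : C := cis2pi (tau * (k * k) / 24) * cis2pi (- (k / 12)).

(** This is 2 cos (pi / 6), in the exponential form in which it arises from pairing [kappa] at
    opposite arguments. *)
Definition sqrt3 : C := cis2pi (/ 12) + cis2pi (- / 12).

Lemma sqrt3_sqr : sqrt3 * sqrt3 = 3.
Proof.
  unfold sqrt3. replace (_ * _) with (cis2pi (/ 12) * cis2pi (/ 12) + cis2pi (- / 12) * cis2pi (- / 12)
    + 2 * (cis2pi (/ 12) * cis2pi (- / 12))) by ring.
  rewrite <- !cis2pi_plus. replace (/ 12 + - / 12) with (RtoC 0) by ring. rewrite cis2pi_0.
  replace (/ 12 + / 12) with (RtoC (/ 6)) by (rewrite RtoC_inv by lra; field).
  replace (- / 12 + - / 12) with (RtoC (- / 6)) by (rewrite RtoC_opp, RtoC_inv by lra; field).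
  rewrite !cis2pi_R. replace (2 * PI * - / 6)%R with (- (2 * PI * / 6))%R by field.
  rewrite cos_neg, sin_neg. replace (2 * PI * / 6)%R with (PI / 3)%R by field. rewrite cos_PI3.
  apply C_ext; simpl; field.
Qed.

Lemma kappa_pair (j : nat) (c d : C) :
  kappa (6 * INR j + c) + kappa (- (6 * INR j + c)) =
  cis2pi (tau * ((6 * INR j + c) * (6 * INR j + c)) / 24) * (- (1)) ^ j * (cis2pi (c / 12) + cis2pi (- (c / 12))).
Proof.
  unfold kappa. replace (- (6 * INR j + c) * - (6 * INR j + c)) with ((6 * INR j + c) * (6 * INR j + c)) by ring.
  replace (- ((6 * INR j + c) / 12)) with (ZtoC (- Z.of_nat j) / 2 + - (c / 12))
    by (rewrite ZtoC_opp, ZtoC_nat; field).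
  replace (- (- (6 * INR j + c) / 12)) with (ZtoC (Z.of_nat j) / 2 + c / 12) by (rewrite ZtoC_nat; field).
  rewrite !cis2pi_plus, cis2pi_half_opp, cis2pi_half_nat. ring.
Qed.

Definition kappa_odd (i : nat) : C := kappa (2 * INR i + 1) + kappa (- (2 * INR i + 1)).

(** The odd numbers 6n + 1, 6n + 3, 6n + 5 are grouped. The middle pair cancels because cos (pi / 2)
    = 0; the outer ones carry the factor 2 cos (pi / 6) up to sign and are the pentagonal terms of
    index [n] and [- (n + 1)]. *)
Lemma kappa_odd_sum n : Csum kappa_odd (3 * n) = sqrt3 * Zsum (pent tau) n.
Proof.
  induction n as [|n IH]; [simpl; unfold Zsum; simpl; ring|].
  replace (3 * S n)%nat with (S (S (S (3 * n)))) by lia. unfold Zsum in *. cbn [Csum]. rewrite IH.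
  assert (E0 : kappa_odd (3 * n) = sqrt3 * pent tau (Z.of_nat n)).
  { unfold kappa_odd. replace (2 * INR (3 * n) + 1) with (6 * INR n + 1)
      by (rewrite mult_INR, RtoC_mult; simpl; rewrite !RtoC_plus; ring).
    rewrite (kappa_pair n 1 1). unfold pent. rewrite cis2pi_half_nat, ZtoC_plus, ZtoC_mult, ZtoC_nat.
    unfold sqrt3, ZtoC. replace (1 / 12) with (/ 12) by (field). ring. }
  assert (E1 : kappa_odd (S (3 * n)) = 0).
  { unfold kappa_odd. replace (2 * INR (S (3 * n)) + 1) with (6 * INR n + 3)
      by (rewrite S_INR, mult_INR, RtoC_plus, RtoC_mult; simpl; rewrite !RtoC_plus; ring).
    rewrite (kappa_pair n 3 1).
    replace (3 / 12) with (RtoC (/ 4)) by (rewrite RtoC_inv by lra; field).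
    replace (- RtoC (/ 4)) with (RtoC (- / 4)) by apply RtoC_opp. rewrite !cis2pi_R. replace (2 * PI * - / 4)%R with (- (PI / 2))%R by field.
    replace (2 * PI * / 4)%R with (PI / 2)%R by field. rewrite cos_neg, sin_neg, cos_PI2, sin_PI2.
    replace ((0, 1)%R + (0, - (1))%R) with (RtoC 0) by (apply C_ext; simpl; ring). ring. }
  assert (E2 : kappa_odd (S (S (3 * n))) = sqrt3 * pent tau (- Z.of_nat (S n))).
  { unfold kappa_odd. replace (2 * INR (S (S (3 * n))) + 1) with (6 * INR n + 5)
      by (rewrite !S_INR, mult_INR, !RtoC_plus, RtoC_mult; simpl; rewrite !RtoC_plus; ring).
    rewrite (kappa_pair n 5 1). unfold pent. rewrite cis2pi_half_opp, cis2pi_half_nat, ZtoC_plus, ZtoC_mult, ZtoC_opp, ZtoC_nat.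
    replace (5 / 12) with (/ 2 + - / 12) by field.
    replace (- (/ 2 + - / 12)) with (- / 2 + / 12) by ring.
    rewrite (cis2pi_plus (/ 2)), (cis2pi_plus (- / 2)), (cis2pi_opp (/ 2)), cis2pi_half.
    replace (ZtoC 6 * - RtoC (INR (S n)) + ZtoC 1) with (- (6 * INR n + 5)) by (rewrite S_INR, RtoC_plus; unfold ZtoC; ring).
    replace (- (6 * INR n + 5) * - (6 * INR n + 5)) with ((6 * INR n + 5) * (6 * INR n + 5)) by ring.
    unfold sqrt3. cbn [Cpow]. field. }
  rewrite E0, E1, E2. ring.
Qed.

Lemma Cmod_kappa (x : R) : Cmod (kappa x) = exp (- (PI * Im tau / 12 * x ^ 2)).
Proof.
  unfold kappa. rewrite Cmod_mult, !Cmod_cis2pi, <- exp_plus. f_equal.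
  replace (tau * (x * x) / 24) with (RtoC (x ^ 2 / 24) * tau) by (rewrite RtoC_div, RtoC_pow by lra; field).
  replace (- (x / 12)) with (RtoC (- (x / 12))) by (rewrite RtoC_opp, RtoC_div by lra; reflexivity).
  rewrite Im_RtoC_mult. simpl. field.
Qed.

Lemma kappa_lim : Clim (fun n => kappa (2 * INR n + 1)) 0.
Proof.
  assert (Ha : (0 < PI * Im tau / 12)%R) by (pose proof PI_RGT_0; apply Rdiv_lt_0_compat; nra).
  apply Clim_bound with (fun n => exp (- (PI * Im tau / 12 * INR n ^ 2) + 0 * INR n + 0)); [|apply exp_gauss_lim, Ha].
  intros n. rewrite Cminus_0_r. replace (2 * INR n + 1) with (RtoC (2 * INR n + 1)) by (rewrite RtoC_plus, RtoC_mult; reflexivity).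
  rewrite Cmod_kappa. apply exp_le. pose proof (pos_INR n). simpl. nra.
Qed.

(** Only every third partial sum is identified by [kappa_odd_sum]. Absolute convergence provides a
    limit of the full sequence, and uniqueness along the subsequence identifies it. *)
Lemma kappa_odd_lim : Clim (Csum kappa_odd) (sqrt3 * dedekind_eta tau).
Proof.
  assert (Ha : (0 < PI * Im tau / 12)%R) by (pose proof PI_RGT_0; apply Rdiv_lt_0_compat; nra).
  set (a := (PI * Im tau / 12)%R) in *.
  destruct (ex_Clim_Csum kappa_odd (fun n => (2 * exp (- a) ^ n)%R)) as [s Hs].
  - intros n. unfold kappa_odd. eapply Rle_trans; [apply Cmod_triangle|].
    replace (2 * INR n + 1) with (RtoC (2 * INR n + 1)) by (rewrite RtoC_plus, RtoC_mult; reflexivity).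
    rewrite <- RtoC_opp, !Cmod_kappa. fold a.
    replace ((- (2 * INR n + 1)) ^ 2)%R with ((2 * INR n + 1) ^ 2)%R by ring.
    assert (E : (exp (- a) ^ n = exp (- a * INR n))%R).
    { induction n as [|n IH]; [simpl; rewrite Rmult_0_r, exp_0; reflexivity|].
      rewrite S_INR. simpl. rewrite IH, <- exp_plus. f_equal. ring. }
    rewrite E. assert (exp (- (a * (2 * INR n + 1) ^ 2)) <= exp (- a * INR n))%R; [|lra].
    apply exp_le. pose proof (pos_INR n). assert (INR n <= (2 * INR n + 1) ^ 2)%R by (simpl; nra). nra.
  - exists (2 * / (1 - exp (- a)))%R. apply (is_series_scal (K := R_AbsRing) (V := R_NormedModule) 2%R).
    apply is_series_geom. rewrite Rabs_pos_eq by (left; apply exp_pos). rewrite <- exp_0. apply exp_increasing. lra.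
  - replace (sqrt3 * dedekind_eta tau) with s; [exact Hs|].
    apply (Clim_unique (fun n => Csum kappa_odd (3 * n))).
    + apply (Clim_sub (Csum kappa_odd) s (fun n => (3 * n)%nat)); [intros; lia|exact Hs].
    + apply Clim_ext with (fun n => sqrt3 * Zsum (pent tau) n); [intros; symmetry; apply kappa_odd_sum|].
      apply Clim_scal, eta_pentagonal, Htau.
Qed.

Lemma eta_inversion_sqr :
  dedekind_eta (- (1 / tau)) * dedekind_eta (- (1 / tau)) = - Ci * tau * (dedekind_eta tau * dedekind_eta tau).
Proof.
  pose proof (upper_half_neq_0 tau Htau) as Ht.
  set (sigma := - (1 / tau)).
  assert (Hs : (0 < Im sigma)%R).
  { unfold sigma. replace (- (1 / tau)) with (RtoC (-1) * / tau) by (unfold Cdiv; replace (RtoC (-1)) with (- RtoC 1) by (rewrite <- RtoC_opp; reflexivity); ring).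
    rewrite Im_RtoC_mult, Im_inv by exact Ht.
    replace (-1 * (- Im tau / Cmod tau ^ 2))%R with (Im tau / Cmod tau ^ 2)%R by (field; apply Rgt_not_eq, Cmod_gt_0, Ht).
    apply Rdiv_lt_0_compat; [exact Htau|apply pow_lt, Cmod_gt_0, Ht]. }
  pose proof (upper_half_neq_0 sigma Hs) as Hs0.
  pose proof PI_neq0 as Hpi. apply RtoC_neq_0 in Hpi.
  assert (HCi : Ci <> 0) by (intros E; injection E; lra).
  assert (HCi2 : Ci * Ci = - (1)) by (apply C_ext; simpl; ring).
  (* The expansion of the exponent of [pent sigma] in powers of the index. It gives
     [PI / alpha = - Ci * tau / 3], whose 3 is cancelled by the square of [sqrt3]. *)
  set (alpha := - (3 * PI * Ci * sigma)). set (beta := PI * Ci + PI * Ci * sigma). set (gamma := PI * Ci * sigma / 12).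
  assert (Halpha : (0 < Re alpha)%R).
  { unfold alpha. replace (Re _) with (3 * PI * Im sigma)%R by (destruct sigma; simpl; ring).
    pose proof PI_RGT_0. nra. }
  assert (Hcoeff : forall c, gauss_coeff alpha beta gamma c = kappa (2 * c + 1)).
  { intros c. unfold gauss_coeff, kappa, cis2pi. rewrite <- Cexp_plus. f_equal.
    assert (Et : tau = - (1 / sigma)) by (unfold sigma; field; exact Ht).
    rewrite Et. unfold alpha, beta, gamma. field_simplify_eq; [|split; [exact Hs0|split; assumption]].
    ring [HCi2]. }
  pose proof (gauss_poisson alpha beta gamma Halpha (dedekind_eta sigma) (sqrt3 * dedekind_eta tau)) as H.
  rewrite H.
  - replace (sqrt3 * dedekind_eta tau * (sqrt3 * dedekind_eta tau)) with ((sqrt3 * sqrt3) * (dedekind_eta tau * dedekind_eta tau)) by ring.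
    rewrite sqrt3_sqr, Cmult_assoc. f_equal.
    transitivity (/ Ci * tau); [unfold alpha, sigma; field; repeat split; assumption|].
    f_equal. apply C_ext; simpl; field.
  - apply Clim_ext with (Zsum (pent sigma)); [|apply eta_pentagonal, Hs].
    intros n. apply Zsum_ext. intros k. unfold pent, gauss_fun, cis2pi. rewrite <- Cexp_plus. f_equal.
    rewrite ZtoC_plus, ZtoC_mult. fold (ZtoC k). unfold alpha, beta, gamma. change (ZtoC 6) with (RtoC 6). change (ZtoC 1) with (RtoC 1).
    field.
  (* The frequencies |c| <= N give the odd numbers from -(2N - 1) to 2N + 1, so 2N + 1 is left
     unpaired; its contribution tends to 0. *)
  - apply Clim_ext with (fun N => Csum kappa_odd N + kappa (2 * INR N + 1)).
    + intros N. unfold gauss_coeff_sum. rewrite Hcoeff.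
      induction N as [|N IH]; [simpl; rewrite Cplus_0_l, Cplus_0_r; f_equal; ring|].
      cbn [Csum]. rewrite !Hcoeff, Cplus_assoc, <- IH. unfold kappa_odd.
      replace (2 * - INR (S N) + 1) with (- (2 * INR N + 1)) by (rewrite S_INR, RtoC_plus; ring). ring.
    + apply Clim_eq with (sqrt3 * dedekind_eta tau + 0); [|ring].
      apply Clim_plus; [apply kappa_odd_lim|apply kappa_lim].
Qed.
End Inversion.

(** * Unconditional summation over Fock space monomials *)

Lemma list_sum_cons {J : Type} (f : J -> C) j L : list_sum f (j :: L) = f j + list_sum f L.
Proof. reflexivity. Qed.

Lemma list_sum_app {J : Type} (f : J -> C) L L' : list_sum f (L ++ L') = list_sum f L + list_sum f L'.
Proof.
  induction L as [|j L IH]; [unfold list_sum; simpl; ring|].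
  rewrite <- app_comm_cons, !list_sum_cons, IH. ring.
Qed.

Lemma list_sum_perm {J : Type} (f : J -> C) L L' : Permutation L L' -> list_sum f L = list_sum f L'.
Proof.
  induction 1; rewrite ?list_sum_cons; [reflexivity|congruence|ring|congruence].
Qed.

Lemma list_sum_map {I J : Type} (g : I -> J) (f : J -> C) L : list_sum f (map g L) = list_sum (fun i => f (g i)) L.
Proof. induction L as [|j L IH]; [reflexivity|]. simpl map. rewrite !list_sum_cons, IH. reflexivity. Qed.

Lemma list_sum_ext_in {J : Type} (f g : J -> C) L : (forall j, In j L -> f j = g j) -> list_sum f L = list_sum g L.
Proof.
  induction L as [|j L IH]; intros H; [reflexivity|].
  rewrite !list_sum_cons, IH, (H j (or_introl eq_refl)) by (intros; apply H; right; assumption). reflexivity.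
Qed.

Lemma list_sum_scal {J : Type} (c : C) (f : J -> C) L : list_sum (fun j => c * f j) L = c * list_sum f L.
Proof. induction L as [|j L IH]; [unfold list_sum; simpl; ring|]. rewrite !list_sum_cons, IH. ring. Qed.

Lemma list_sum_0 {J : Type} (f : J -> C) L : (forall j, In j L -> f j = 0) -> list_sum f L = 0.
Proof.
  intros H. rewrite (list_sum_ext_in f (fun _ => 0 * 0)) by (intros; rewrite H by assumption; ring).
  rewrite list_sum_scal. ring.
Qed.

Lemma list_sum_prod {I J : Type} (f : I -> C) (g : J -> C) L L' :
  list_sum (fun x => f (fst x) * g (snd x)) (list_prod L L') = list_sum f L * list_sum g L'.
Proof.
  induction L as [|i L IH]; [unfold list_sum; simpl; ring|].
  simpl list_prod. rewrite list_sum_app, IH, list_sum_map, list_sum_cons. simpl. rewrite list_sum_scal. ring.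
Qed.

Lemma list_sum_seq (u : nat -> C) n : list_sum u (seq 0 n) = Csum u n.
Proof.
  induction n as [|n IH]; [reflexivity|]. rewrite seq_S, list_sum_app, IH. unfold list_sum; simpl. ring.
Qed.

Definition abs_sum {J : Type} (f : J -> C) (L : list J) : R := fold_right (fun j s => (Cmod (f j) + s)%R) 0%R L.

Lemma abs_sum_list_sum {J : Type} (f : J -> C) L : list_sum (fun j => RtoC (Cmod (f j))) L = RtoC (abs_sum f L).
Proof. induction L as [|j L IH]; [reflexivity|]. rewrite list_sum_cons, IH. simpl. rewrite RtoC_plus. reflexivity. Qed.

Lemma abs_sum_nonneg {J : Type} (f : J -> C) L : (0 <= abs_sum f L)%R.
Proof. induction L as [|j L IH]; simpl; [lra|]. pose proof (Cmod_ge_0 (f j)). lra. Qed.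

Lemma Cmod_list_sum {J : Type} (f : J -> C) L : (Cmod (list_sum f L) <= abs_sum f L)%R.
Proof.
  induction L as [|j L IH]; [unfold list_sum; simpl; rewrite Cmod_0; lra|].
  rewrite list_sum_cons. eapply Rle_trans; [apply Cmod_triangle|]. simpl. lra.
Qed.

Lemma abs_sum_app {J : Type} (f : J -> C) L L' : abs_sum f (L ++ L') = (abs_sum f L + abs_sum f L')%R.
Proof. induction L as [|j L IH]; simpl; [lra|]. rewrite IH. lra. Qed.

Lemma abs_sum_perm {J : Type} (f : J -> C) L L' : Permutation L L' -> abs_sum f L = abs_sum f L'.
Proof. induction 1; simpl; lra. Qed.

Lemma incl_permutation {J : Type} (A : list J) : forall B, NoDup A -> incl A B -> exists D, Permutation B (A ++ D).
Proof.
  induction A as [|a A IH]; intros B HA HB; [exists B; reflexivity|].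
  destruct (in_split a B (HB a (or_introl eq_refl))) as [B1 [B2 ->]].
  inversion HA as [|? ? Ha HA']; subst.
  destruct (IH (B1 ++ B2) HA') as [D HD].
  - intros x Hx. specialize (HB x (or_intror Hx)). apply in_app_iff in HB. apply in_app_iff.
    destruct HB as [HB|[HB|HB]]; [left; exact HB|subst; contradiction|right; exact HB].
  - exists D. simpl. rewrite <- HD. symmetry. apply Permutation_middle.
Qed.

(** A finite list [L'] containing [L N] lies in some [L m], so what it adds to [L N] is bounded by
    the growth of the absolute sum from [N] to [m]. These sums increase and are bounded, hence
    Cauchy, and convergence along one exhaustion becomes unconditional. *)
Lemma has_sum_exhaust {J : Type} (f : J -> C) (L : nat -> list J) (B : R) (s : C) :
  (forall n, NoDup (L n)) -> (forall n m, (n <= m)%nat -> incl (L n) (L m)) -> (forall j, exists n, In j (L n)) ->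
  (forall n, (abs_sum f (L n) <= B)%R) -> Clim (fun n => list_sum f (L n)) s -> has_sum f s.
Proof.
  intros Hnd Hincl Hcov HB Hlim eps Heps.
  assert (Hincr : forall n m, (n <= m)%nat -> (abs_sum f (L n) <= abs_sum f (L m))%R).
  { intros n m H. destruct (incl_permutation (L n) (L m) (Hnd n) (Hincl n m H)) as [D HD].
    rewrite (abs_sum_perm f _ _ HD), abs_sum_app. pose proof (abs_sum_nonneg f D). lra. }
  destruct (ex_finite_lim_seq_incr (fun n => abs_sum f (L n)) B) as [a Ha];
    [intros n; apply Hincr; lia|exact HB|].
  apply is_lim_seq_spec in Ha. apply is_lim_seq_spec in Hlim.
  assert (He : (0 < eps / 3)%R) by lra.
  destruct (Ha (mkposreal _ He)) as [N1 H1]. destruct (Hlim (mkposreal _ He)) as [N2 H2]. simpl in H1, H2.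
  set (N := (N1 + N2)%nat). exists (L N). intros L' HL' HN.
  assert (Hm : exists m, (N <= m)%nat /\ incl L' (L m)).
  { clear HL' HN. induction L' as [|j L' [m [Hm IH]]]; [exists N; split; [lia|intros x []]|].
    destruct (Hcov j) as [n Hn]. exists (n + m)%nat. split; [lia|].
    intros x [<-|Hx]; [apply (Hincl n); [lia|exact Hn]|apply (Hincl m); [lia|apply IH, Hx]]. }
  destruct Hm as [m [Hm Hinc]].
  destruct (incl_permutation (L N) L' (Hnd N) HN) as [D HD].
  destruct (incl_permutation L' (L m) HL' Hinc) as [D' HD'].
  rewrite (list_sum_perm f _ _ HD), list_sum_app.
  assert (E : abs_sum f (L m) = (abs_sum f (L N) + abs_sum f D + abs_sum f D')%R).
  { rewrite (abs_sum_perm f _ _ HD'), abs_sum_app, (abs_sum_perm f _ _ HD), abs_sum_app. reflexivity. }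
  replace (list_sum f (L N) + list_sum f D - s) with ((list_sum f (L N) - s) + list_sum f D) by ring.
  eapply Rle_lt_trans; [apply Cmod_triangle|].
  pose proof (Cmod_list_sum f D). pose proof (abs_sum_nonneg f D').
  specialize (H2 N ltac:(unfold N; lia)). rewrite Rminus_0_r, Rabs_pos_eq in H2 by apply Cmod_ge_0.
  pose proof (H1 N ltac:(unfold N; lia)) as A1. pose proof (H1 m ltac:(unfold N in *; lia)) as A2.
  apply Rabs_def2 in A1. apply Rabs_def2 in A2. lra.
Qed.

Lemma NoDup_map_in {I J : Type} (f : I -> J) (L : list I) :
  (forall x y, In x L -> In y L -> f x = f y -> x = y) -> NoDup L -> NoDup (map f L).
Proof.
  intros Hf H. induction H as [|x L Hx HL IH]; [constructor|]. simpl. constructor.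
  - intros Hin. apply in_map_iff in Hin. destruct Hin as [y [E Hy]].
    apply Hx. rewrite (Hf x y (or_introl eq_refl) (or_intror Hy) (eq_sym E)). exact Hy.
  - apply IH. intros; apply Hf; try right; assumption.
Qed.

Lemma NoDup_list_prod {I J : Type} (L : list I) (L' : list J) : NoDup L -> NoDup L' -> NoDup (list_prod L L').
Proof.
  intros H H'. induction H as [|x L Hx HL IH]; [constructor|]. simpl. apply NoDup_app.
  - apply NoDup_map_in; [intros ? ? _ _ E; congruence|exact H'].
  - exact IH.
  - intros [a b] Ha Hb. apply in_map_iff in Ha. destruct Ha as [y [E _]]. injection E as <- <-.
    apply in_prod_iff in Hb. apply Hx, Hb.
Qed.

Lemma NoDup_Zrange N : NoDup (Zrange N).
Proof. apply NoDup_map_in; [intros; lia|apply seq_NoDup]. Qed.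

Lemma NoDup_occ_box V n : NoDup (occ_box V n).
Proof.
  induction n as [|n IH]; [repeat constructor; intros []|].
  cbn [occ_box]. apply NoDup_map_in; [|apply NoDup_list_prod; [exact IH|apply seq_NoDup]].
  intros [mu v] [mu' v'] H H' E. apply in_prod_iff in H, H'. destruct H as [H _], H' as [H' _].
  apply in_occ_box in H, H'. cbn [fst snd] in E. set (p := Pos.of_succ_nat n) in *.
  assert (Ev : v = v') by (rewrite <- (upd_eq mu p v), <- (upd_eq mu' p v'), E; reflexivity).
  f_equal; [|exact Ev]. apply functional_extensionality. intros r.
  destruct (Pos.eq_dec r p) as [->|Hr].
  - rewrite (proj2 H), (proj2 H') by (unfold p; lia). reflexivity.
  - rewrite <- (upd_neq mu p v r Hr), <- (upd_neq mu' p v' r Hr), E. reflexivity.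
Qed.

Lemma NoDup_state_box nu N : NoDup (state_box nu N).
Proof.
  apply NoDup_map_in; [|repeat apply NoDup_list_prod; first [apply NoDup_Zrange|apply NoDup_occ_box]].
  intros [[z mu] mu'] [[w m] m'] _ _ E. unfold state_of in E. simpl in E. injection E as E1 -> ->.
  f_equal. f_equal. apply eq_IZR. lra.
Qed.

Lemma in_state_box nu N s : In s (state_box nu N) <->
  lam_le nu N (lam s) /\ In (occ_a s) (occ_box N N) /\ In (occ_d s) (occ_box N N).
Proof.
  unfold state_box. rewrite in_map_iff. split.
  - intros [[[z a] d] [<- H]]. apply in_prod_iff in H. destruct H as [H Hd]. apply in_prod_iff in H.
    destruct H as [Hz Ha]. apply in_Zrange in Hz. split; [exists z; split; [exact Hz|reflexivity]|split; assumption].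
  - intros [[z [Hz E]] [Ha Hd]]. exists (z, occ_a s, occ_d s). split.
    + unfold state_of; simpl. rewrite <- E. destruct s; reflexivity.
    + apply in_prod_iff. split; [|exact Hd]. apply in_prod_iff. split; [apply in_Zrange, Hz|exact Ha].
Qed.

Lemma occ_box_incl N M : (N <= M)%nat -> incl (occ_box N N) (occ_box M M).
Proof.
  intros H mu Hmu. apply in_occ_box in Hmu. apply in_occ_box. split; intros p; [pose proof (proj1 Hmu p); lia|].
  intros Hp. apply Hmu. lia.
Qed.

Lemma state_box_incl nu N M : (N <= M)%nat -> incl (state_box nu N) (state_box nu M).
Proof.
  intros H s Hs. apply in_state_box in Hs. apply in_state_box. destruct Hs as [H1 [H2 H3]].
  split; [apply (lam_le_mono nu N); assumption|split; apply (occ_box_incl N M H); assumption].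
Qed.

(** The generating function of partitions with parts at most [n], each repeated at most [V] times: a
    truncated partition function of one family of oscillators. *)
Definition box_sum (q : C) (V n : nat) : C := list_sum (fun mu => q ^ degree_upto mu n) (occ_box V n).

Lemma geom_sum_C (x : C) n : (1 - x) * Csum (fun v => x ^ v) n = 1 - x ^ n.
Proof. induction n as [|n IH]; [simpl; ring|]. cbn [Csum Cpow]. rewrite Cmult_plus_distr_l, IH. ring. Qed.

(** Mode [p] contributes the finite geometric sum (1 - q^{p(V+1)}) / (1 - q^p); the numerators
    together form the Euler product in q^{V+1}. *)
Lemma box_sum_euler q V n : euler_prod q n * box_sum q V n = euler_prod (q ^ S V) n.
Proof.
  induction n as [|n IH].
  - unfold box_sum, list_sum. simpl. ring.
  - unfold box_sum in *. cbn [occ_box]. rewrite list_sum_map.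
    rewrite (list_sum_ext_in _ (fun x => q ^ degree_upto (fst x) n * (q ^ S n) ^ (snd x))).
    + rewrite (list_sum_prod (fun mu => q ^ degree_upto mu n) (fun v => (q ^ S n) ^ v)), list_sum_seq.
      cbn [euler_prod]. rewrite <- IH.
      replace ((q ^ S V) ^ S n) with ((q ^ S n) ^ S V) by (rewrite <- !Cpow_mult_r; f_equal; lia).
      rewrite <- (geom_sum_C (q ^ S n) (S V)). ring.
    + intros [mu v] _. cbn [fst snd]. rewrite <- Cpow_mult_r, <- Cpow_add_r. f_equal.
      cbn [degree_upto]. rewrite upd_eq. f_equal.
      destruct (degree_upto_upd mu (Pos.of_succ_nat n) v n) as [[_ H]|[H _]]; [exact H|lia].
Qed.

Lemma euler_prod_neq_0 q n : (Cmod q < 1)%R -> euler_prod q n <> 0.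
Proof.
  intros Hq. apply Cmod_gt_0. eapply Rlt_le_trans; [apply exp_pos|apply euler_prod_lower, Hq].
Qed.

Lemma box_sum_eq q V n : (Cmod q < 1)%R -> box_sum q V n = euler_prod (q ^ S V) n / euler_prod q n.
Proof. intros Hq. rewrite <- (box_sum_euler q V n). field. apply euler_prod_neq_0, Hq. Qed.

Lemma Cmod_pow_S_le q V : (Cmod q < 1)%R -> (Cmod (q ^ S V) <= Cmod q)%R.
Proof.
  intros Hq. rewrite Cmod_pow. simpl. pose proof (Cmod_ge_0 q).
  pose proof (pow_range (Cmod q) V ltac:(lra)). nra.
Qed.

Lemma euler_prod_upper (q : C) (r : R) (n : nat) : (Cmod q <= r)%R -> (r < 1)%R ->
  (Cmod (euler_prod q n) <= exp (1 / (1 - r)))%R.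
Proof.
  intros H Hr. rewrite euler_prod_qprod. eapply Rle_trans; [apply qprod_bound; lra|].
  apply exp_le. unfold Rdiv. rewrite !Rmult_1_l. apply Rinv_le_contravar; lra.
Qed.

Lemma box_sum_bound q : (Cmod q < 1)%R -> exists B, forall V n, (Cmod (box_sum q V n) <= B)%R.
Proof.
  intros Hq. set (r := Cmod q) in *.
  exists (exp (1 / (1 - r)) / exp (- (1 / (1 - r) / (1 - r))))%R. intros V n.
  rewrite box_sum_eq by exact Hq. rewrite Cmod_div by (apply euler_prod_neq_0, Hq).
  unfold Rdiv at 1 3. apply Rmult_le_compat; [apply Cmod_ge_0| | |].
  - left. apply Rinv_0_lt_compat, Cmod_gt_0, euler_prod_neq_0, Hq.
  - apply euler_prod_upper; [apply Cmod_pow_S_le, Hq|exact Hq].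
  - apply Rinv_le_contravar; [apply exp_pos|apply euler_prod_lower, Hq].
Qed.

(** The numerator in [box_sum_eq] tends to 1 because its nome [q ^ (N + 1)] tends to 0, which leaves
    the reciprocal of the Euler product. *)
Lemma box_sum_lim q P : (Cmod q < 1)%R -> Clim (euler_prod q) P -> P <> 0 ->
  Clim (fun N => box_sum q N N) (/ P).
Proof.
  intros Hq HP HP0. set (r := Cmod q) in *. assert (Hr : (0 <= r < 1)%R) by (split; [apply Cmod_ge_0|exact Hq]).
  assert (H1 : Clim (fun N => euler_prod (q ^ S N) N) 1).
  { apply Clim_bound with (fun N => (exp (1 / (1 - r)) / (1 - r) * r ^ N)%R).
    - intros N. set (Q := q ^ S N). set (b := Cmod Q).
      assert (Hb : (0 <= b <= r)%R) by (split; [apply Cmod_ge_0|apply Cmod_pow_S_le, Hq]).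
      assert (E : forall n, euler_prod Q n - 1 = Csum (fun i => - (euler_prod Q i * Q ^ S i)) n).
      { induction n as [|n IH]; [simpl; ring|]. cbn [Csum]. rewrite <- IH. cbn [euler_prod]. ring. }
      rewrite E. eapply Rle_trans; [apply (Csum_geom_bound _ (exp (1 / (1 - r)) * r ^ N) r)|].
      + apply Rmult_le_pos; [left; apply exp_pos|apply pow_le; lra].
      + exact Hr.
      + intros i. rewrite Cmod_opp, Cmod_mult, (Cmod_pow Q), Rmult_assoc. fold b.
        apply Rmult_le_compat; [apply Cmod_ge_0|apply pow_le; lra|apply euler_prod_upper; [apply Hb|lra]|].
        simpl. apply Rmult_le_compat; [lra|apply pow_le; lra| |apply pow_incr; exact Hb].
        unfold b, Q. rewrite Cmod_pow. fold r. simpl. pose proof (pow_range r N ltac:(lra)). nra.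
      + right. field. lra.
    - replace (Finite 0) with (Rbar_mult (exp (1 / (1 - r)) / (1 - r))%R 0%R) by (simpl; f_equal; ring).
      apply is_lim_seq_scal_l. apply is_lim_seq_geom. rewrite Rabs_pos_eq; lra. }
  destruct (box_sum_bound q Hq) as [B HB].
  assert (HB0 : (0 <= B)%R) by (pose proof (HB O O); pose proof (Cmod_ge_0 (box_sum q 0 0)); lra).
  (* [box_sum - 1/P = (euler_prod (q^{N+1}) - 1) / P + box_sum (P - euler_prod q) / P] *)
  apply Clim_bound with (fun N => (/ Cmod P * (Cmod (euler_prod (q ^ S N) N - 1) + B * Cmod (euler_prod q N - P)))%R).
  - intros N.
    replace (box_sum q N N - / P) with (/ P * ((euler_prod (q ^ S N) N - 1) + box_sum q N N * (P - euler_prod q N))).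
    + rewrite Cmod_mult, Cmod_inv by exact HP0.
      apply Rmult_le_compat_l; [left; apply Rinv_0_lt_compat, Cmod_gt_0, HP0|].
      eapply Rle_trans; [apply Cmod_triangle|]. apply Rplus_le_compat_l. rewrite Cmod_mult, (Cmod_sub_sym P).
      apply Rmult_le_compat_r; [apply Cmod_ge_0|apply HB].
    + rewrite <- box_sum_euler. field. exact HP0.
  - replace (Finite 0) with (Rbar_mult (/ Cmod P)%R (0 + B * 0)%R) by (simpl; f_equal; ring).
    apply is_lim_seq_scal_l. apply is_lim_seq_plus'; [exact H1|].
    apply (is_lim_seq_scal_l _ B 0%R). exact HP.
Qed.

(** * Test functions on lines *)

Lemma is_RInt_CInt (f : R -> C) (a b : R) : Ccont f -> is_RInt (V := C_R_NormedModule) f a b (CInt f a b).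
Proof.
  intros Hf. apply (is_RInt_fct_extend_pair (U := R_NormedModule) (V := R_NormedModule) f a b).
  - exact (RInt_correct (V := R_CompleteNormedModule) _ _ _ (ex_RInt_Re f a b Hf)).
  - exact (RInt_correct (V := R_CompleteNormedModule) _ _ _ (ex_RInt_Im f a b Hf)).
Qed.

Lemma CInt_0 (f : R -> C) (a b : R) :
  (forall x, (Rmin a b < x < Rmax a b)%R -> f x = 0) -> CInt f a b = 0.
Proof.
  intros H. unfold CInt. rewrite (RInt_extR (fun x => Re (f x)) (fun _ => 0%R)), (RInt_extR (fun x => Im (f x)) (fun _ => 0%R)).
  - rewrite !RInt_const. unfold scal; simpl; unfold mult; simpl. apply C_ext; simpl; ring.
  - intros x Hx. rewrite H by exact Hx. reflexivity.
  - intros x Hx. rewrite H by exact Hx. reflexivity.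
Qed.

Lemma is_RInt_gen_compact (f : R -> C) (M : R) : Ccont f ->
  (forall x, (M <= Rabs x)%R -> f x = 0) ->
  is_RInt_gen (V := C_R_NormedModule) f (Rbar_locally m_infty) (Rbar_locally p_infty) (CInt f (- M) M).
Proof.
  intros Hf H P HP. apply (Filter_prod _ _ _ (fun a => (a < - M /\ a < 0)%R) (fun b => (M < b /\ 0 < b)%R)).
  - exists (Rmin (- M) 0). intros x Hx. pose proof (Rmin_l (- M) 0). pose proof (Rmin_r (- M) 0). lra.
  - exists (Rmax M 0). intros x Hx. pose proof (Rmax_l M 0). pose proof (Rmax_r M 0). lra.
  - intros a b Ha Hb. exists (CInt f (- M) M). split; [|apply locally_singleton, HP].
    assert (E : CInt f a b = CInt f (- M) M).
    { rewrite <- (CInt_Chasles f a (- M) b Hf), <- (CInt_Chasles f (- M) M b Hf).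
      rewrite (CInt_0 f a (- M)), (CInt_0 f M b); [ring| |].
      - intros x Hx. rewrite Rmin_left, Rmax_right in Hx by lra. apply H. unfold Rabs; destruct (Rcase_abs x); lra.
      - intros x Hx. rewrite Rmin_left, Rmax_right in Hx by lra. apply H. unfold Rabs; destruct (Rcase_abs x); lra. }
    rewrite <- E. apply is_RInt_CInt, Hf.
Qed.

Lemma CderAt_is_derive (f : R -> C) (x : R) (l : C) :
  is_derive (V := C_R_NormedModule) f x l -> CderAt f x l.
Proof.
  intros H. split.
  - pose proof (filterdiff_comp (U := R_NormedModule) (V := C_R_NormedModule) (W := R_NormedModule)
      (F := locally x) f (fun z : C => Re z) (fun y => scal y l) (fun z : C => Re z) H) as D.
    eapply filterdiff_ext_lin; [apply D|].
    + apply filterdiff_linear. apply is_linear_fst.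
    + intros y. reflexivity.
  - pose proof (filterdiff_comp (U := R_NormedModule) (V := C_R_NormedModule) (W := R_NormedModule)
      (F := locally x) f (fun z : C => Im z) (fun y => scal y l) (fun z : C => Im z) H) as D.
    eapply filterdiff_ext_lin; [apply D|].
    + apply filterdiff_linear. apply is_linear_snd.
    + intros y. reflexivity.
Qed.

Lemma CderAt_line (phi phix : C -> C) (w : C) (x : R) :
  (forall z, is_line_derive phi 1 z (phix z)) ->
  CderAt (fun x : R => phi (x / 2 + w)) x (RtoC (/ 2) * phix (x / 2 + w)).
Proof.
  intros H. specialize (H (x / 2 + w)). apply CderAt_is_derive in H.
  apply (CderAt_ext (fun t : R => (fun s : R => phi (x / 2 + w + s * 1)) ((t - x) / 2)%R)).
  - intros t. simpl. f_equal. rewrite RtoC_div, RtoC_minus by lra. field.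
  - apply (CderAt_comp (fun s : R => phi (x / 2 + w + s * 1)) (fun t => ((t - x) / 2)%R)).
    + replace ((x - x) / 2)%R with 0%R by field. exact H.
    + auto_derive; [exact I|]. field.
Qed.

Lemma Ccont_line (phi : C -> C) (w : C) :
  (forall z, continuous phi z) -> Ccont (fun x : R => phi (x / 2 + w)).
Proof.
  intros H.
  assert (L : forall x : R, continuous (fun x : R => phi ((x / 2 + Re w)%R, Im w)) x).
  { intros x. apply (continuous_comp_2 (U := R_UniformSpace) (V := R_UniformSpace) (W := R_UniformSpace) (X := C_UniformSpace)
      (fun x => (x / 2 + Re w)%R) (fun _ => Im w) (fun a b => phi (a, b)) x).
    - apply continuous_ex_derive. auto_derive. exact I.
    - apply continuous_const.
    - apply (continuous_ext phi); [intros [a b]; reflexivity|apply H]. }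
  assert (E : forall x : R, x / 2 + w = ((x / 2 + Re w)%R, Im w)).
  { intros x. rewrite <- RtoC_div by lra. destruct w. apply C_ext; simpl; ring. }
  intros x. split.
  - apply (continuous_ext (fun x : R => Re (phi ((x / 2 + Re w)%R, Im w)))); [intros; rewrite E; reflexivity|].
    apply (continuous_comp (fun x : R => phi ((x / 2 + Re w)%R, Im w)) (fun z : C => Re z)); [apply L|].
    destruct (phi _). apply continuous_fst.
  - apply (continuous_ext (fun x : R => Im (phi ((x / 2 + Re w)%R, Im w)))); [intros; rewrite E; reflexivity|].
    apply (continuous_comp (fun x : R => phi ((x / 2 + Re w)%R, Im w)) (fun z : C => Im z)); [apply L|].
    destruct (phi _). apply continuous_snd.
Qed.

Lemma CderAt_vanish (f f' : R -> C) (M : R) :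
  (forall x, CderAt f x (f' x)) -> (forall x, (M < Rabs x)%R -> f x = 0) -> forall x, (M < Rabs x)%R -> f' x = 0.
Proof.
  intros H Hz x Hx.
  assert (L : locally x (fun y => f y = 0)).
  { assert (He : (0 < Rabs x - M)%R) by lra. exists (mkposreal _ He). intros y Hy. apply Hz.
    unfold ball in Hy; simpl in Hy; unfold AbsRing_ball, abs, minus, plus, opp in Hy; simpl in Hy.
    pose proof (Rabs_triang_inv x y). rewrite <- (Rabs_Ropp (x - y)) in H0.
    replace (- (x - y))%R with (y + - x)%R in H0 by ring. lra. }
  destruct (H x) as [H1 H2]. apply C_ext; simpl.
  - rewrite <- (is_derive_unique _ _ _ H1). rewrite (Derive_ext_loc _ (fun _ => 0%R)); [apply Derive_const|].
    apply (filter_imp _ _ (fun y (E : f y = 0) => f_equal Re E) L).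
  - rewrite <- (is_derive_unique _ _ _ H2). rewrite (Derive_ext_loc _ (fun _ => 0%R)); [apply Derive_const|].
    apply (filter_imp _ _ (fun y (E : f y = 0) => f_equal Im E) L).
Qed.

(** [M] is a natural number so that the integers in the support are covered by a [Zsum], and the
    vanishing includes the end points so that boundary terms at [- M] and [M] drop out. *)
Definition compact_C2 (f : R -> C) (M : nat) : Prop := exists f' f'' : R -> C,
  (forall x, CderAt f x (f' x)) /\ (forall x, CderAt f' x (f'' x)) /\ Ccont f'' /\
  forall x, (INR M <= Rabs x)%R -> f x = 0 /\ f' x = 0 /\ f'' x = 0.

Lemma compact_C2_cont f M : compact_C2 f M -> Ccont f.
Proof. intros [f' [f'' [H _]]]. eapply CderAt_cont, H. Qed.

(** The line on which [2 * zeta_d + l * tau] is real is horizontal, so the two derivatives demanded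
    by the Fourier estimates are derivatives in the real direction, taken from [class_C 2]. *)
Lemma test_function_line (phi : C -> C) (w : C) : test_function phi ->
  exists M, compact_C2 (fun x : R => phi (x / 2 + w)) M.
Proof.
  intros [HC [K HK]]. destruct (HC 2%nat) as [_ [phix [_ [Hx [_ [Hc _]]]]]].
  destruct Hc as [_ [phixx [_ [Hxx [_ [Hcc _]]]]]].
  assert (HZ : forall x : R, (2 * (Rabs K + Cmod w) < Rabs x)%R -> phi (x / 2 + w) = 0).
  { intros x H. apply HK.
    assert (T : (Cmod (x / 2) <= Cmod (x / 2 + w) + Cmod w)%R).
    { replace (x / 2) with ((x / 2 + w) + - w) at 1 by ring. eapply Rle_trans; [apply Cmod_triangle|]. rewrite Cmod_opp. lra. }
    rewrite <- RtoC_div, Cmod_R in T by lra. unfold Rdiv in T. rewrite Rabs_mult, (Rabs_pos_eq (/ 2)) in T by lra.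
    pose proof (Rle_abs K). rewrite <- RtoC_div by lra. unfold Rdiv. lra. }
  pose (f' := fun x : R => RtoC (/ 2) * phix (x / 2 + w)).
  pose (f'' := fun x : R => RtoC (/ 2) * (RtoC (/ 2) * phixx (x / 2 + w))).
  assert (D1 : forall x, CderAt (fun x : R => phi (x / 2 + w)) x (f' x)) by (intros x; apply CderAt_line, Hx).
  assert (D2 : forall x, CderAt f' x (f'' x)).
  { intros x. unfold f', f''. eapply CderAt_eq; [apply CderAt_mult; [apply CderAt_const|apply CderAt_line, Hxx]|cbv beta; ring]. }
  set (A := (2 * (Rabs K + Cmod w))%R) in *.
  assert (HA : (0 <= A)%R) by (unfold A; pose proof (Rabs_pos K); pose proof (Cmod_ge_0 w); lra).
  exists (S (Z.to_nat (up A))), f', f''. split; [exact D1|split; [exact D2|split]].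
  - pose proof (Ccont_line phixx w Hcc). unfold f''. auto with ccont.
  - intros x HM. assert (Hx' : (A < Rabs x)%R).
    { eapply Rlt_le_trans; [|exact HM]. rewrite S_INR, INR_IZR_INZ.
      destruct (archimed A) as [Hu _]. rewrite Z2Nat.id; [lra|]. apply le_IZR. lra. }
    pose proof (CderAt_vanish _ _ A D1 HZ) as Z1. pose proof (CderAt_vanish _ _ A D2 Z1) as Z2.
    repeat split; [apply HZ|apply Z1|apply Z2]; exact Hx'.
Qed.

Lemma compact_C2_twist (f : R -> C) (c : C) (M : nat) :
  compact_C2 f M -> compact_C2 (fun x => cis2pi (c * x) * f x) M.
Proof.
  intros [f' [f'' [H1 [H2 [H3 H4]]]]]. set (w := 2 * PI * Ci * c).
  exists (fun x : R => cis2pi (c * x) * (w * f x + f' x)), (fun x : R => cis2pi (c * x) * (w * (w * f x + f' x) + (w * f' x + f'' x))).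
  split; [|split; [|split]].
  - intros x. cder. unfold w. ring.
  - intros x. cder. unfold w. ring.
  - assert (C1 : Ccont f) by (eapply CderAt_cont, H1). assert (C2 : Ccont f') by (eapply CderAt_cont, H2).
    auto 20 with ccont.
  - intros x Hx. destruct (H4 x Hx) as [-> [-> ->]]. repeat split; ring.
Qed.

Lemma Ccont_bounded (f : R -> C) (M : R) : Ccont f -> exists B, (0 <= B)%R /\ forall x, (- M <= x <= M)%R -> (Cmod (f x) <= B)%R.
Proof.
  intros Hf.
  destruct (bounded_continuity (K := R_AbsRing) (V := R_NormedModule) (fun x => Re (f x)) (- M) M) as [B1 H1];
    [intros x _; exact (proj1 (Hf x))|].
  destruct (bounded_continuity (K := R_AbsRing) (V := R_NormedModule) (fun x => Im (f x)) (- M) M) as [B2 H2];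
    [intros x _; exact (proj2 (Hf x))|].
  exists (Rabs B1 + Rabs B2)%R. split; [pose proof (Rabs_pos B1); pose proof (Rabs_pos B2); lra|].
  intros x Hx. eapply Rle_trans; [apply Cmod_le_abs|].
  specialize (H1 x Hx). specialize (H2 x Hx).
  change (Rabs (Re (f x)) < B1)%R in H1. change (Rabs (Im (f x)) < B2)%R in H2.
  pose proof (Rle_abs B1). pose proof (Rle_abs B2). lra.
Qed.

Definition fcoeff (f : R -> C) (M : nat) (c : C) : C := CInt (fun x => cis2pi (c * x) * f x) (- INR M) (INR M).

(** Two integrations by parts without boundary terms. Quadratic decay in the frequency makes the
    Fourier coefficients absolutely summable. *)
Lemma fcoeff_decay (f : R -> C) (M : nat) : compact_C2 f M ->
  exists K, (0 <= K)%R /\ forall c : R, c <> 0%R -> (Cmod (fcoeff f M c) <= K / c ^ 2)%R.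
Proof.
  intros [f' [f'' [H1 [H2 [H3 H4]]]]].
  destruct (Ccont_bounded f'' (INR M) H3) as [B [HB0 HB]].
  pose proof (pos_INR M) as HM. pose proof PI_RGT_0 as Hpi.
  exists (2 * (2 * INR M * B))%R. split; [nra|]. intros c Hc.
  set (w := 2 * PI * Ci * c).
  assert (Hw : w <> 0).
  { unfold w. apply Cmult_neq_0; [apply Cmult_neq_0; [apply Cmult_neq_0|]|]; try (apply RtoC_neq_0; lra).
    intros E; injection E; lra. }
  assert (Hw2 : (1 * c ^ 2 <= Cmod (w * w))%R).
  { unfold w. rewrite !Cmod_mult, Cmod_Ci, !Cmod_R, (Rabs_pos_eq 2), (Rabs_pos_eq PI) by lra.
    rewrite <- (pow2_abs c). pose proof (pow2_ge_0 (Rabs c)). pose proof PI2_1.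
    replace (2 * PI * 1 * Rabs c * (2 * PI * 1 * Rabs c))%R with ((4 * (PI * PI)) * Rabs c ^ 2)%R by ring.
    apply Rmult_le_compat_r; [assumption|]. nra. }
  assert (E : fcoeff f M c = / (w * w) * CInt (fun x => cis2pi (c * x) * f'' x) (- INR M) (INR M)).
  { unfold fcoeff. rewrite <- CInt_scal by auto with ccont.
    (* A primitive of [f - f'' / w ^ 2] times the exponential; it vanishes at both ends of the
       window. *)
    pose (F := fun x : R => cis2pi (c * x) * (/ w * f x + (- / (w * w)) * f' x)).
    pose (G := fun x : R => cis2pi (c * x) * f x + (- (1)) * (/ (w * w) * (cis2pi (c * x) * f'' x))).
    assert (HF : forall x, CderAt F x (G x)).
    { intros x. unfold F, G. cder. fold w. field. exact Hw. }
    assert (C0 : Ccont (fun x => cis2pi (c * x) * f x)) by (pose proof (CderAt_cont _ _ H1); auto with ccont).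
    assert (C2 : Ccont (fun x => / (w * w) * (cis2pi (c * x) * f'' x))) by auto with ccont.
    assert (C3 : Ccont (fun x => (- (1)) * (/ (w * w) * (cis2pi (c * x) * f'' x)))) by auto with ccont.
    pose proof (CInt_derive F G (- INR M) (INR M) HF (Ccont_plus _ _ C0 C3)) as D.
    unfold G in D. rewrite (CInt_plus _ _ _ _ C0 C3), (CInt_scal _ _ _ _ C2) in D.
    assert (Z : forall x, Rabs x = INR M -> F x = 0).
    { intros x Hx. unfold F. destruct (H4 x) as [-> [-> _]]; [lra|]. ring. }
    rewrite (Z (INR M)), (Z (- INR M)%R) in D by (rewrite ?Rabs_Ropp; apply Rabs_pos_eq, HM).
    set (Y := CInt (fun x => / (w * w) * (cis2pi (c * x) * f'' x)) (- INR M) (INR M)) in *.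
    set (X := CInt (fun x => cis2pi (c * x) * f x) (- INR M) (INR M)) in *.
    replace X with ((X + (- (1)) * Y) + Y) by ring. rewrite D. ring. }
  rewrite E, Cmod_mult, Cmod_inv by (apply Cmult_neq_0; exact Hw).
  assert (Hc2 : (0 < c ^ 2)%R) by (rewrite <- Rsqr_pow2; apply Rsqr_pos_lt, Hc).
  unfold Rdiv. rewrite Rmult_comm.
  apply Rmult_le_compat; [apply Cmod_ge_0|left; apply Rinv_0_lt_compat; lra| |apply Rinv_le_contravar; lra].
  eapply Rle_trans; [apply (CInt_bound _ (- INR M) (INR M) B)|right; ring].
  - lra.
  - auto with ccont.
  - intros x Hx. rewrite Cmod_mult. replace (c * x) with (RtoC (c * x)) by apply RtoC_mult.
    rewrite Cmod_cis2pi. simpl. rewrite Rmult_0_r, Ropp_0, exp_0, Rmult_1_l. apply HB, Hx.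
Qed.

Lemma list_sum_Zrange (u : Z -> C) N :
  list_sum u (Zrange N) = u 0%Z + Csum (fun i => u (Z.of_nat (S i)) + u (- Z.of_nat (S i))%Z) N.
Proof.
  unfold Zrange. rewrite list_sum_map, list_sum_seq. replace (2 * N + 1)%nat with (S (2 * N)) by lia.
  cbn [Csum]. rewrite Zsum_shift. replace (Z.of_nat (2 * N) - Z.of_nat N)%Z with (Z.of_nat N) by lia.
  induction N as [|N IH]; [unfold Zsum; simpl; ring|].
  transitivity ((Zsum u N + u (Z.of_nat N)) + (u (Z.of_nat (S N)) + u (- Z.of_nat (S N))%Z)).
  - unfold Zsum. cbn [Csum]. ring.
  - rewrite IH. cbn [Csum]. ring.
Qed.

(** Compact support makes the window exact: the trapezoidal sum over [-M, M] is the full sum over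
    the integers, and the Dirichlet integral is a symmetric partial sum of Fourier coefficients. *)
Lemma poisson_compact (f : R -> C) (M : nat) : compact_C2 f M ->
  Clim (fun N => list_sum (fun m => fcoeff f M (ZtoC m)) (Zrange N)) (Zsum (fun n => f (IZR n)) M).
Proof.
  intros [f' [f'' [H1 [H2 [H3 H4]]]]].
  destruct (Ccont_bounded f'' (INR M) H3) as [B [HB0 HB]].
  pose proof (pos_INR M) as HM.
  assert (HK : forall x, (Cmod (f'' x) <= (B * (1 + INR M ^ 2)) / (1 + x ^ 2))%R).
  { intros x. pose proof (one_sqr_pos x) as Hx. apply Rmult_le_reg_r with (1 + x ^ 2)%R; [exact Hx|].
    unfold Rdiv. rewrite Rmult_assoc, Rinv_l, Rmult_1_r by lra.
    destruct (Rle_lt_dec (INR M) (Rabs x)) as [L|L].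
    - destruct (H4 x L) as [_ [_ ->]]. rewrite Cmod_0. rewrite Rmult_0_l. apply Rmult_le_pos; [exact HB0|].
      pose proof (pow2_ge_0 (INR M)). lra.
    - apply Rmult_le_compat; [apply Cmod_ge_0|lra| |].
      + apply HB. apply Rabs_def2 in L. lra.
      + apply Rplus_le_compat_l. rewrite <- (pow2_abs x). apply pow_incr. split; [apply Rabs_pos|lra]. }
  set (K := (B * (1 + INR M ^ 2))%R) in *.
  assert (HT : Ctrapezoid f (- INR M) (2 * M) = Zsum (fun n => f (IZR n)) M).
  { rewrite Ctrapezoid_Zsum. destruct (H4 (INR M)) as [-> _]; [rewrite Rabs_pos_eq; lra|].
    destruct (H4 (- INR M)%R) as [-> _]; [rewrite Rabs_Ropp, Rabs_pos_eq; lra|]. field. }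
  assert (Hf : Ccont f) by (eapply CderAt_cont, H1).
  apply is_lim_seq_incr_1. apply (Clim_bound (fun N => list_sum (fun m => fcoeff f M (ZtoC m)) (Zrange (S N))) _ (fun N => (24 * K / INR (S N))%R)).
  - intros N. rewrite Cmod_sub_sym.
    pose proof (poisson_complex f f' f'' K M (S N) H1 H2 H3 HK ltac:(lia)) as H. rewrite HT in H.
    rewrite CInt_dirichlet in H by exact Hf. rewrite list_sum_Zrange.
    replace (fcoeff f M (ZtoC 0)) with (CInt f (- INR M) (INR M)).
    + erewrite (Csum_ext (fun i => fcoeff f M _ + _)); [exact H|].
      intros i _. rewrite ZtoC_opp, ZtoC_nat. reflexivity.
    + unfold fcoeff. apply CInt_ext. intros x. change (ZtoC 0) with (RtoC 0). rewrite Cmult_0_l, cis2pi_0. ring.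
  - apply (is_lim_seq_incr_1 (fun n => (24 * K / INR n)%R)), is_lim_seq_div_INR.
Qed.

Lemma fcoeff_abs_bound (f : R -> C) (M : nat) : compact_C2 f M ->
  exists B, forall N, (Cmod (list_sum (fun m => RtoC (Cmod (fcoeff f M (ZtoC m)))) (Zrange N)) <= B)%R.
Proof.
  intros H. destruct (fcoeff_decay f M H) as [K [HK HD]].
  exists (Cmod (fcoeff f M (ZtoC 0)) + 4 * K)%R. intros N. rewrite list_sum_Zrange.
  eapply Rle_trans; [apply Cmod_triangle|]. apply Rplus_le_compat.
  { rewrite Cmod_R, Rabs_pos_eq by apply Cmod_ge_0. lra. }
  set (u := fun i => _ + _).
  assert (Hu : forall i, (Cmod (u i) <= 2 * (K / INR (S i) ^ 2))%R).
  { intros i. unfold u. eapply Rle_trans; [apply Cmod_triangle|]. rewrite !Cmod_R, !Rabs_pos_eq by apply Cmod_ge_0.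
    assert (Hi : INR (S i) <> 0%R) by (apply not_0_INR; lia).
    rewrite ZtoC_opp, ZtoC_nat, <- RtoC_opp. pose proof (HD (INR (S i)) Hi) as A1.
    pose proof (HD (- INR (S i))%R ltac:(lra)) as A2.
    replace ((- INR (S i)) ^ 2)%R with (INR (S i) ^ 2)%R in A2 by ring. lra. }
  (* The partial sums of [1 / n ^ 2] are bounded inductively by [2 - 1 / n], since
     [1 / (n + 1) ^ 2 <= 1 / n - 1 / (n + 1)]. *)
  assert (E : forall n, (Cmod (Csum u (S n)) <= 2 * K * (2 - 1 / INR (S n)))%R).
  { induction n as [|n IH].
    - cbn [Csum]. rewrite Cplus_0_l. eapply Rle_trans; [apply Hu|]. simpl. right. field.
    - change (Csum u (S (S n))) with (Csum u (S n) + u (S n)).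
      eapply Rle_trans; [apply Cmod_triangle|]. specialize (Hu (S n)).
      rewrite (S_INR (S n)) in *. set (y := INR (S n)) in *. assert (Hy : (0 < y)%R) by (apply lt_0_INR; lia).
      assert (A : (K / (y + 1) ^ 2 <= K * (1 / y - 1 / (y + 1)))%R).
      { apply Rmult_le_compat_l; [exact HK|].
        replace (1 / y - 1 / (y + 1))%R with (/ (y * (y + 1)))%R by (field; lra).
        apply Rinv_le_contravar; simpl; nra. }
      lra. }
  destruct N as [|N]; [simpl; rewrite Cmod_0; lra|].
  eapply Rle_trans; [apply E|].
  assert (0 < 1 / INR (S N))%R by (apply Rdiv_lt_0_compat; [lra|apply lt_0_INR; lia]). nra.
Qed.

(** * The character *)

Definition basis_index (nu : R) : Type := {s : state | good_state nu s}.

Lemma good_vacuum nu : good_state nu (State nu (fun _ => O) (fun _ => O)).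
Proof. split; [exists 0%Z; simpl; lra|split; exists 1%positive; reflexivity]. Qed.

(** The vacuum is a default value outside the module; on a [state_box] every state is good, so it is
    never returned there as a default. *)
Definition to_index (nu : R) (s : state) : basis_index nu :=
  match excluded_middle_informative (good_state nu s) with
  | left h => exist _ s h
  | right _ => exist _ _ (good_vacuum nu)
  end.

Lemma to_index_val nu s : good_state nu s -> proj1_sig (to_index nu s) = s.
Proof. intros H. unfold to_index. destruct (excluded_middle_informative _); [reflexivity|contradiction]. Qed.

Lemma index_inj nu (i j : basis_index nu) : proj1_sig i = proj1_sig j -> i = j.
Proof. destruct i as [s h], j as [t h']. simpl. intros <-. f_equal. apply proof_irrelevance. Qed.

Definition index_box (nu : R) (N : nat) : list (basis_index nu) := map (to_index nu) (state_box nu N).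

Lemma map_index_box nu N : map (@proj1_sig _ _) (index_box nu N) = state_box nu N.
Proof.
  unfold index_box. rewrite map_map. rewrite <- (map_id (state_box nu N)) at 2. apply map_ext_in.
  intros s Hs. apply to_index_val, (state_box_good nu N), Hs.
Qed.

Lemma in_index_box nu N (j : basis_index nu) : In j (index_box nu N) <-> In (proj1_sig j) (state_box nu N).
Proof.
  rewrite <- map_index_box. split; [apply in_map|].
  intros H. apply in_map_iff in H. destruct H as [i [E Hi]]. apply index_inj in E. subst. exact Hi.
Qed.

Lemma NoDup_index_box nu N : NoDup (index_box nu N).
Proof. apply (NoDup_map_inv (@proj1_sig _ _)). rewrite map_index_box. apply NoDup_state_box. Qed.

Lemma index_box_incl nu N M : (N <= M)%nat -> incl (index_box nu N) (index_box nu M).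
Proof. intros H j Hj. apply in_index_box in Hj. apply in_index_box. exact (state_box_incl nu N M H _ Hj). Qed.

Lemma index_box_cover nu (j : basis_index nu) : exists N, In j (index_box nu N).
Proof.
  destruct (proj1 (good_state_le nu _) (proj2_sig j)) as [D HD]. exists D.
  apply in_index_box, state_le_box, HD.
Qed.

Lemma list_sum_index_box nu N (f : state -> C) :
  list_sum (fun j : basis_index nu => f (proj1_sig j)) (index_box nu N) = list_sum f (state_box nu N).
Proof. rewrite <- map_index_box, list_sum_map. reflexivity. Qed.

Lemma lin_comb_delta nu (c : basis_index nu -> C) L (j : basis_index nu) :
  NoDup L -> In j L -> lin_comb (fun i => delta (proj1_sig i)) c L (proj1_sig j) = c j.
Proof.
  intros HL Hj. unfold lin_comb. induction HL as [|i L Hi HL IH]; [destruct Hj|].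
  rewrite list_sum_cons. destruct Hj as [->|Hj].
  - rewrite delta_eq, list_sum_0; [ring|]. intros i Hi'. rewrite delta_neq; [ring|].
    intros E. apply index_inj in E. subst. contradiction.
  - rewrite IH by exact Hj. rewrite delta_neq; [ring|].
    intros E. apply index_inj in E. subst. contradiction.
Qed.

Lemma delta_basis nu : is_basis (in_Pi nu) (fun j : basis_index nu => delta (proj1_sig j)).
Proof.
  split; [|split].
  - intros j. apply in_Pi_delta, (proj2_sig j).
  - intros g Hg. apply in_Pi_supp in Hg. destruct Hg as [D HD].
    exists (fun j => g (proj1_sig j)), (index_box nu D). apply functional_extensionality. intros s.
    destruct (excluded_middle_informative (g s = 0)) as [E|E].
    + rewrite E. symmetry. apply list_sum_0. intros j _.
      destruct (excluded_middle_informative (s = proj1_sig j)) as [->|Hne]; [rewrite E; ring|].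
      rewrite delta_neq by exact Hne. ring.
    + assert (Hs : In s (state_box nu D)) by (apply state_le_box, HD, E).
      pose proof (to_index_val nu s (state_box_good nu D s Hs)) as Ev. rewrite <- Ev at 2.
      rewrite (lin_comb_delta nu (fun j => g (proj1_sig j))); [rewrite Ev; reflexivity|apply NoDup_index_box|].
      apply in_map, Hs.
  - intros c L HL H j Hj. rewrite <- (lin_comb_delta nu c L j HL Hj).
    exact (f_equal (fun g : vec => g (proj1_sig j)) H).
Qed.

(** The eigenvalue of the oscillator part of [T0], kept as a series so that it matches the series in
    [T0] term by term; [level_box] turns it into degrees. *)
Definition level (s : state) : C := CSeries (fun n =>
  let p := Pos.of_succ_nat n in ZtoC (Zpos p) * (INR (occ_a s p) + INR (occ_d s p))).

(** The terms linear in [lam] add up to [l * lam]. Hence the trace pairs [lam] with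
    [2 * zd + l * tau], the variable that is real on the line of summation. *)
Definition T0_eigenvalue (k : C) (l : Z) (s : state) : C :=
  ZtoC (l - 1) * lam s + level s - k / 3 * ZtoC (l - 1) + lam s.

Lemma delta_eigen (T : op) (ev : state -> C) (s : state) :
  (forall t, T (delta s) t = ev t * delta s t) -> T (delta s) = vscal (ev s) (delta s).
Proof.
  intros H. apply functional_extensionality. intros t. rewrite H. unfold vscal.
  destruct (excluded_middle_informative (t = s)) as [->|E]; [reflexivity|]. rewrite delta_neq by exact E. ring.
Qed.

Lemma T0_delta k l s : T0 k l (delta s) = vscal (T0_eigenvalue k l s) (delta s).
Proof.
  apply (delta_eigen (T0 k l) (T0_eigenvalue k l)). intros t. unfold T0. cbv zeta.
  replace (CSeries _) with (level t * delta s t).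
  - cbn [mode_a mode_d]. unfold T0_eigenvalue. field.
  - destruct (excluded_middle_informative (t = s)) as [->|E].
    + rewrite delta_eq, Cmult_1_r. unfold level. f_equal. apply functional_extensionality. intros n.
      rewrite mode_a_mode_d, mode_d_mode_a, delta_eq. rewrite ZtoC_mult. change (ZtoC 2) with (RtoC 2). field.
    + rewrite delta_neq by exact E. rewrite CSeries_0; [ring|]. intros n.
      rewrite mode_a_mode_d, mode_d_mode_a, delta_neq by exact E. field.
Qed.

Lemma level_box nu N s : In s (state_box nu N) -> level s = INR (degree_upto (occ_a s) N) + INR (degree_upto (occ_d s) N).
Proof.
  intros H. apply in_state_box in H. destruct H as [_ [Ha Hd]]. apply in_occ_box in Ha, Hd.
  unfold level. rewrite (CSeries_finite _ N).
  - clear Ha Hd. induction N as [|N IH]; [simpl; ring|]. cbn [Csum degree_upto]. cbv zeta. rewrite IH.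
    rewrite !plus_INR, !mult_INR, !RtoC_plus, !RtoC_mult.
    replace (ZtoC (Z.pos (Pos.of_succ_nat N))) with (RtoC (INR (S N))); [ring|].
    rewrite <- ZtoC_nat. reflexivity.
  - intros n Hn. cbv zeta. rewrite (proj2 Ha), (proj2 Hd) by lia. simpl. ring.
Qed.

(** The box is a product, so a product weight sums to a product. The formula is applied once to the
    trace and once to the moduli of its terms. *)
Lemma list_sum_state_box (nu : R) (N : nat) (A q : C) (u : Z -> C) (f : state -> C) :
  (forall z a d, In (state_of nu (z, a, d)) (state_box nu N) ->
     f (state_of nu (z, a, d)) = A * u z * q ^ degree_upto a N * q ^ degree_upto d N) ->
  list_sum f (state_box nu N) = A * list_sum u (Zrange N) * box_sum q N N * box_sum q N N.
Proof.
  intros H. unfold state_box. rewrite list_sum_map.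
  rewrite (list_sum_ext_in _ (fun x => A * ((fun y => u (fst y) * q ^ degree_upto (snd y) N) (fst x) * q ^ degree_upto (snd x) N))).
  - rewrite list_sum_scal.
    rewrite (list_sum_prod (fun y => u (fst y) * q ^ degree_upto (snd y) N) (fun d => q ^ degree_upto d N)).
    rewrite (list_sum_prod u (fun a => q ^ degree_upto a N)). unfold box_sum. ring.
  - intros [[z a] d] Hx. rewrite H; [simpl; ring|]. apply in_map, Hx.
Qed.

Lemma ch_Pi_support (k : C) (l : Z) (nu : R) (za tau : C) (phi : C -> C) (M : nat) :
  (forall x : R, (INR M <= Rabs x)%R -> phi ((x - ZtoC l * tau) / 2) = 0) ->
  ch_Pi k l nu za tau phi =
  cis2pi (za * ZtoC (l - 1)) * cis2pi (- (k * ZtoC l * tau / 3)) / dedekind_eta tau ^ 2 *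
  Zsum (fun n => cis2pi (ZtoC n * nu) * phi ((ZtoC n - ZtoC l * tau) / 2)) M.
Proof.
  intros H. unfold ch_Pi. f_equal. apply ZSeries_finite. intros n Hn. unfold gf_delta.
  change (ZtoC n) with (RtoC (IZR n)). rewrite (H (IZR n)); [ring|]. rewrite <- abs_IZR, INR_IZR_INZ. apply IZR_le, Hn.
Qed.

Lemma line_eq (tau : C) (l : Z) (x : R) : (x - ZtoC l * tau) / 2 = x / 2 + - (ZtoC l * tau / 2).
Proof. field. Qed.

Lemma character_Pi (k : C) (l : Z) (nu : R) : is_Pi_character k l nu (ch_Pi k l nu).
Proof.
  exists (basis_index nu), (fun j => delta (proj1_sig j)), (fun _ => ZtoC (l - 1)),
    (fun j => 2 * lam (proj1_sig j)), (fun j => T0_eigenvalue k l (proj1_sig j)).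
  split; [apply delta_basis|]. split; [intros j; reflexivity|].
  split; [intros j; apply (delta_eigen (mode_d 0) (fun t => 2 * lam t)); reflexivity|].
  split; [intros j; apply T0_delta|].
  intros za tau Htau phi Hphi.
  set (w := - (ZtoC l * tau / 2)).
  destruct (test_function_line phi w Hphi) as [M Hpsi].
  set (psi := fun x : R => phi (x / 2 + w)) in *.
  (* Splitting [lam = nu + z] moves [nu] into the function, so that the remaining frequencies are
     integers and Poisson summation applies. *)
  set (f := fun x : R => cis2pi (nu * x) * psi x).
  pose proof (compact_C2_twist psi nu M Hpsi : compact_C2 f M) as Hf.
  set (q := cis2pi tau). pose proof (Cmod_nome tau Htau) as Hq. fold q in Hq.
  (* The factors common to all monomials. The central charge contributes -(8k + 2)/24 = -k/3 - 1/12: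
     the first part joins -k(l - 1)/3 to give -kl/3, and the second matches the q^{1/12} in eta
     squared. *)
  set (A := cis2pi (za * ZtoC (l - 1)) * cis2pi (- (k * ZtoC l * tau / 3)) * cis2pi (- (tau / 12))).
  pose (I := fun s => A * cis2pi (tau * level s) * fcoeff psi M (lam s)).
  assert (Hpsi0 : forall x : R, (INR M <= Rabs x)%R -> psi x = 0).
  { intros x Hx. destruct Hpsi as [g' [g'' [_ [_ [_ H0]]]]]. apply (H0 x Hx). }
  exists (fun j => I (proj1_sig j)). split.
  - intros j. set (s := proj1_sig j).
    assert (Hc : compact_C2 (fun x => cis2pi (lam s * x) * psi x) M) by (apply compact_C2_twist, Hpsi).
    assert (Hexp : forall x : R, A * cis2pi (tau * level s) * (cis2pi (lam s * x) * psi x) =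
      let zd := (x - ZtoC l * tau) / 2 in
      cis2pi (za * ZtoC (l - 1) + zd * (2 * lam s) + tau * (T0_eigenvalue k l s - central_charge k / 24)) * phi zd).
    { intros x. cbv zeta. rewrite line_eq. fold w. fold (psi x). rewrite Cmult_assoc. f_equal.
      unfold A. rewrite <- !cis2pi_plus. f_equal.
      unfold T0_eigenvalue, central_charge, w. rewrite !ZtoC_sub. change (ZtoC 1) with (RtoC 1). field. }
    assert (E : I s = CInt (fun x : R => let zd := (x - ZtoC l * tau) / 2 in
        cis2pi (za * ZtoC (l - 1) + zd * (2 * lam s) + tau * (T0_eigenvalue k l s - central_charge k / 24)) * phi zd)
        (- INR M) (INR M)).
    { unfold I, fcoeff. rewrite <- CInt_scal by (apply compact_C2_cont with M, Hc). apply CInt_ext, Hexp. }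
    rewrite E. apply is_RInt_gen_compact.
    + pose proof (Ccont_mult _ _ (Ccont_const (A * cis2pi (tau * level s))) (compact_C2_cont _ M Hc)) as HCc.
      intros x. specialize (HCc x). destruct HCc as [HC1 HC2].
      split; [eapply continuous_ext; [|exact HC1]|eapply continuous_ext; [|exact HC2]]; intros t;
        [exact (f_equal Re (Hexp t))|exact (f_equal Im (Hexp t))].
    + intros x Hx. cbv zeta. rewrite line_eq. fold w. fold (psi x). rewrite Hpsi0 by exact Hx. ring.
  - assert (Hbox : forall N z a d, In (state_of nu (z, a, d)) (state_box nu N) ->
      I (state_of nu (z, a, d)) = A * fcoeff f M (ZtoC z) * q ^ degree_upto a N * q ^ degree_upto d N).
    { intros N z a d Hs. unfold I. rewrite (level_box nu N _ Hs). simpl.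
      replace (fcoeff psi M (nu + IZR z)%R) with (fcoeff f M (ZtoC z)).
      - replace (tau * (INR (degree_upto a N) + INR (degree_upto d N))) with (INR (degree_upto a N) * tau + INR (degree_upto d N) * tau) by ring.
        rewrite cis2pi_plus, <- !cis2pi_pow. fold q. ring.
      - apply CInt_ext. intros x. unfold f. rewrite Cmult_assoc, <- cis2pi_plus. f_equal. f_equal.
        rewrite RtoC_plus. unfold ZtoC. ring. }
    destruct (euler_prod_lim q Hq) as [P [HP HP0]].
    destruct (fcoeff_abs_bound f M Hf) as [BZ HBZ].
    (* The absolute sums factor in the same way with [q] replaced by its modulus, which again lies
       inside the unit disc. *)
    assert (Hqr : (Cmod (RtoC (Cmod q)) < 1)%R) by (rewrite Cmod_R, Rabs_pos_eq; [exact Hq|apply Cmod_ge_0]).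
    destruct (box_sum_bound (RtoC (Cmod q)) Hqr) as [BB HBB].
    apply (has_sum_exhaust _ (index_box nu) (Cmod A * BZ * BB * BB)).
    + apply NoDup_index_box.
    + apply index_box_incl.
    + apply index_box_cover.
    + intros N.
      assert (E : RtoC (abs_sum (fun j : basis_index nu => I (proj1_sig j)) (index_box nu N)) =
        RtoC (Cmod A) * list_sum (fun m => RtoC (Cmod (fcoeff f M (ZtoC m)))) (Zrange N)
          * box_sum (RtoC (Cmod q)) N N * box_sum (RtoC (Cmod q)) N N).
      { rewrite <- abs_sum_list_sum, (list_sum_index_box nu N (fun s => RtoC (Cmod (I s)))).
        apply list_sum_state_box. intros z a d Hs. rewrite (Hbox N z a d Hs).
        rewrite !Cmod_mult, !Cmod_pow, !RtoC_mult, !RtoC_pow. reflexivity. }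
      eapply Rle_trans; [apply Rle_abs|]. rewrite <- Cmod_R.
      change (Cmod (RtoC (abs_sum (fun j : basis_index nu => I (proj1_sig j)) (index_box nu N))) <= Cmod A * BZ * BB * BB)%R.
      rewrite E, !Cmod_mult, Cmod_R, Rabs_pos_eq by apply Cmod_ge_0.
      assert (N1 : (0 <= BZ)%R) by (eapply Rle_trans; [apply Cmod_ge_0|apply (HBZ O)]).
      assert (N2 : (0 <= BB)%R) by (eapply Rle_trans; [apply Cmod_ge_0|apply (HBB O O)]).
      pose proof (Cmod_ge_0 A).
      repeat apply Rmult_le_compat; repeat apply Rmult_le_pos; try apply Cmod_ge_0; try apply Rle_refl; auto.
    + rewrite (ch_Pi_support k l nu za tau phi M).
      2: { intros x Hx. rewrite line_eq. apply Hpsi0, Hx. }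
      apply Clim_ext with (fun N => A * list_sum (fun m => fcoeff f M (ZtoC m)) (Zrange N) * box_sum q N N * box_sum q N N).
      { intros N. symmetry. etransitivity; [apply (list_sum_index_box nu N I)|]. apply list_sum_state_box, Hbox. }
      apply Clim_eq with (A * Zsum (fun n => f (IZR n)) M * / P * / P).
      * apply Clim_mult; [apply Clim_mult; [apply Clim_scal, poisson_compact, Hf|]|]; apply box_sum_lim; assumption.
      * rewrite (eta_euler tau P HP). fold q.
        rewrite (Zsum_ext (fun n => f (IZR n)) (fun n => cis2pi (ZtoC n * nu) * phi ((ZtoC n - ZtoC l * tau) / 2))).
        -- replace ((cis2pi (tau / 24) * P) ^ 2) with (cis2pi (tau / 24) * cis2pi (tau / 24) * (P * P)) by (simpl; ring).
           rewrite <- (cis2pi_plus (tau / 24)). replace (tau / 24 + tau / 24) with (tau / 12) by field.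
           unfold A. rewrite (cis2pi_opp (tau / 12)). field. split; [exact HP0|apply cis2pi_neq_0].
        -- intros n. unfold f, psi. change (ZtoC n) with (RtoC (IZR n)). rewrite line_eq. fold w. f_equal. f_equal. ring.
Qed.

(** * The S-transform *)

Lemma Csum_single (u : nat -> C) (j n : nat) :
  (j < n)%nat -> (forall i, i <> j -> u i = 0) -> Csum u n = u j.
Proof.
  intros Hj H. induction n as [|n IH]; [lia|]. cbn [Csum].
  destruct (Nat.eq_dec j n) as [->|Hne].
  - replace (Csum u n) with (RtoC 0); [ring|]. symmetry. rewrite (Csum_ext u (fun _ => 0 * 0)).
    + rewrite Csum_scal. ring.
    + intros i Hi. rewrite H by lia. ring.
  - rewrite IH by lia. rewrite (H n) by lia. ring.
Qed.

Lemma Zsum_single (u : Z -> C) (j : Z) (N : nat) :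
  (Z.abs j < Z.of_nat N)%Z -> (forall n, n <> j -> u n = 0) -> Zsum u N = u j.
Proof.
  intros Hj H. rewrite <- Zsum_shift. rewrite (Csum_single _ (Z.to_nat (j + Z.of_nat N))).
  - f_equal. lia.
  - lia.
  - intros i Hi. apply H. lia.
Qed.

Lemma CInt_cis2pi (m : Z) : m <> 0%Z -> CInt (fun x => cis2pi (ZtoC m * x)) 0 1 = 0.
Proof.
  intros Hm. set (w := 2 * PI * Ci * ZtoC m).
  assert (Hw : w <> 0).
  { unfold w. pose proof PI_neq0. repeat apply Cmult_neq_0; try (apply RtoC_neq_0; lra).
    - intros E; injection E; lra.
    - apply RtoC_neq_0, not_0_IZR, Hm. }
  rewrite (CInt_derive (fun x => / w * cis2pi (ZtoC m * x)) (fun x => cis2pi (ZtoC m * x))).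
  - rewrite Cmult_1_r, Cmult_0_r, cis2pi_Z, cis2pi_0. ring.
  - intros x. cder. fold w. field. exact Hw.
  - apply Ccont_cis2pi.
Qed.

Lemma Ccont_Csum (u : nat -> R -> C) (n : nat) : (forall i, Ccont (u i)) -> Ccont (fun x => Csum (fun i => u i x) n).
Proof.
  intros H. induction n as [|n IH]; [exact (Ccont_const 0)|]. cbn [Csum]. apply Ccont_plus; [exact IH|apply H].
Qed.

Lemma CInt_Csum (u : nat -> R -> C) (a b : R) (n : nat) : (forall i, Ccont (u i)) ->
  CInt (fun x => Csum (fun i => u i x) n) a b = Csum (fun i => CInt (u i) a b) n.
Proof.
  intros H. induction n as [|n IH]; [apply CInt_0; reflexivity|]. cbn [Csum].
  rewrite CInt_plus; [rewrite IH; reflexivity|apply Ccont_Csum, H|apply H].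
Qed.

Lemma has_sum_finite {J : Type} (f : J -> C) (L0 : list J) :
  NoDup L0 -> (forall j, ~ In j L0 -> f j = 0) -> has_sum f (list_sum f L0).
Proof.
  intros H0 Hf eps Heps. exists L0. intros L HL Hi.
  destruct (incl_permutation L0 L H0 Hi) as [D HD].
  rewrite (list_sum_perm f _ _ HD), list_sum_app, (list_sum_0 f D).
  - replace (list_sum f L0 + 0 - list_sum f L0) with (RtoC 0) by ring. rewrite Cmod_0. exact Heps.
  - intros j Hj. apply Hf. intros Hj0. apply (Permutation_NoDup HD) in HL.
    apply in_split in Hj0. destruct Hj0 as [A [B ->]].
    rewrite <- app_assoc in HL. simpl in HL. apply NoDup_remove_2 in HL. apply HL.
    rewrite !in_app_iff. right. right. exact Hj.
Qed.

Lemma ZSeries_Zrange (u : Z -> C) (N : nat) :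
  (forall n, (Z.of_nat N <= Z.abs n)%Z -> u n = 0) -> ZSeries u = list_sum u (Zrange N).
Proof.
  intros H. rewrite (ZSeries_finite u (S N)) by (intros; apply H; lia).
  rewrite list_sum_Zrange. unfold Zsum. cbn [Csum]. rewrite (H (- Z.of_nat (S N))%Z) by lia.
  clear H. induction N as [|N IH]; [simpl; ring|].
  cbn [Csum]. transitivity ((Csum (fun i => u (Z.of_nat i) + u (- Z.of_nat (S i))%Z) N + (u (Z.of_nat N) + 0))
    + u (- Z.of_nat (S N))%Z + u (Z.of_nat (S N))); [ring|]. rewrite IH. ring.
Qed.

Lemma list_sum_Zrange_opp (u : Z -> C) (N : nat) :
  list_sum (fun n => u (- n)%Z) (Zrange N) = list_sum u (Zrange N).
Proof.
  rewrite !list_sum_Zrange. f_equal. apply Csum_ext. intros i _. rewrite Z.opp_involutive. ring.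
Qed.

Lemma dedekind_eta_neq_0 (tau : C) : (0 < Im tau)%R -> dedekind_eta tau <> 0.
Proof.
  intros H. destruct (euler_prod_lim (cis2pi tau) (Cmod_nome tau H)) as [P [HP HP0]].
  rewrite (eta_euler tau P HP). apply Cmult_neq_0; [apply cis2pi_neq_0|exact HP0].
Qed.

(** * Transformation of the character under tau -> -1/tau *)

Section STransform.
Context (k : C) (l : Z) (nu : R) (za tau : C) (Htau : (0 < Im tau)%R).

(** What remains of [S_Pi] and of the prefactor of [ch_Pi] once the factor e^{-2 pi i l nu'} has
    been spent on selecting one delta function. *)
Definition S_coeff (l' : Z) : C :=
  cis2pi (ZtoC (l + l') * k / 3) * cis2pi (- (ZtoC l' * nu)) *
  (cis2pi (za * ZtoC (l' - 1)) * cis2pi (- (k * ZtoC l' * tau / 3)) / dedekind_eta tau ^ 2).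

Definition S_term (l' : Z) : gfun := fun phi => S_coeff l' * phi ((ZtoC l - ZtoC l' * tau) / 2).

(** Tested on [phi], the integrand is a trigonometric polynomial in [nu'] with frequencies [n - l];
    integration over a period keeps the term [n = l]. *)
Lemma ch_Pi_circle_integral (l' : Z) :
  gf_circle_integral (fun nu' : R => gf_scal (S_Pi k l nu l' nu') (ch_Pi k l' nu' za tau)) (S_term l').
Proof.
  intros phi Hphi.
  destruct (test_function_line phi (- (ZtoC l' * tau / 2)) Hphi) as [M0 [g' [g'' [_ [_ [_ H0]]]]]].
  (* Large enough both for the support of [phi] on the line and for [l] to lie in the range
     [-M, M - 1] of [Zsum]. *)
  set (M := (M0 + Z.abs_nat l + 1)%nat).
  assert (HM : forall x : R, (INR M <= Rabs x)%R -> phi ((x - ZtoC l' * tau) / 2) = 0).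
  { intros x Hx. rewrite line_eq. apply H0. eapply Rle_trans; [|exact Hx]. apply le_INR. unfold M. lia. }
  pose (c := fun n => phi ((ZtoC n - ZtoC l' * tau) / 2)).
  pose (F := fun x : R => S_coeff l' * Zsum (fun n => c n * cis2pi (ZtoC (n - l) * x)) M).
  assert (HF : forall x : R, gf_scal (S_Pi k l nu l' x) (ch_Pi k l' x za tau) phi = F x).
  { intros x. unfold gf_scal. rewrite (ch_Pi_support k l' x za tau phi M HM). unfold F, S_Pi, S_coeff.
    rewrite (Zsum_ext (fun n => c n * cis2pi (ZtoC (n - l) * x))
               (fun n => cis2pi (- (ZtoC l * x)) * (cis2pi (ZtoC n * x) * c n))).
    - rewrite Zsum_scal. unfold c.
      replace (- (ZtoC l * x + ZtoC l' * nu)) with (- (ZtoC l * x) + - (ZtoC l' * nu)) by ring.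
      rewrite (cis2pi_plus (- (ZtoC l * x))). unfold Cdiv. ring.
    - intros n. rewrite Cmult_assoc, <- cis2pi_plus, ZtoC_sub. rewrite (Cmult_comm (c n)). f_equal. f_equal. ring. }
  assert (HC : forall n, Ccont (fun x : R => c n * cis2pi (ZtoC (n - l) * x)))
    by auto with ccont.
  assert (HC' : forall i : nat, Ccont (fun x : R => c (Z.of_nat i) * cis2pi (ZtoC (Z.of_nat i - l) * x) +
     c (- Z.of_nat (S i))%Z * cis2pi (ZtoC (- Z.of_nat (S i) - l) * x))) by auto with ccont.
  assert (HCF : Ccont (fun x => Zsum (fun n => c n * cis2pi (ZtoC (n - l) * x)) M))
    by exact (Ccont_Csum _ M HC').
  apply (is_RInt_ext (V := C_R_NormedModule) F); [intros x _; symmetry; apply HF|].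
  replace (S_term l' phi) with (CInt F 0 1).
  - apply is_RInt_CInt. apply Ccont_mult; [apply Ccont_const|exact HCF].
  - unfold F. rewrite CInt_scal by exact HCF. unfold S_term. f_equal.
    unfold Zsum. rewrite (CInt_Csum _ 0 1 M HC').
    rewrite (Csum_ext _ (fun i => (fun n => c n * CInt (fun x => cis2pi (ZtoC (n - l) * x)) 0 1) (Z.of_nat i)
      + (fun n => c n * CInt (fun x => cis2pi (ZtoC (n - l) * x)) 0 1) (- Z.of_nat (S i))%Z)).
    + change (Zsum (fun n => c n * CInt (fun x => cis2pi (ZtoC (n - l) * x)) 0 1) M = c l).
      rewrite (Zsum_single _ l).
      * rewrite Z.sub_diag. rewrite (CInt_ext _ (fun _ => 1)).
        -- rewrite (CInt_derive RtoC (fun _ => 1)); [ring|intros; apply CderAt_id|apply Ccont_const].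
        -- intros x. change (ZtoC 0) with (RtoC 0). rewrite Cmult_0_l. apply cis2pi_0.
      * unfold M. lia.
      * intros n Hn. rewrite CInt_cis2pi by lia. ring.
    + intros i _. rewrite CInt_plus by apply HC. rewrite !CInt_scal by apply Ccont_cis2pi. reflexivity.
Qed.

(** The points (l - n tau)/2 have imaginary part -n Im(tau)/2, so a bounded set contains finitely
    many of them. On each test function the sum over [l'] is therefore finite. *)
Lemma lattice_line_support (phi : C -> C) : test_function phi ->
  exists N : nat, forall n, (Z.of_nat N <= Z.abs n)%Z -> phi ((ZtoC l - ZtoC n * tau) / 2) = 0.
Proof.
  intros [_ [K HK]]. exists (S (Z.to_nat (up (2 * Rabs K / Im tau)))). intros n Hn. apply HK.
  eapply Rlt_le_trans; [|apply im_le_Cmod].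
  replace ((ZtoC l - ZtoC n * tau) / 2) with (RtoC (IZR l / 2) + RtoC (- IZR n / 2) * tau)
    by (unfold ZtoC; rewrite !RtoC_div, RtoC_opp by lra; field).
  change (Im (?a + ?b)) with (Im a + Im b)%R. rewrite Im_RtoC_mult. simpl (Im (RtoC _)). rewrite Rplus_0_l.
  rewrite Rabs_mult, (Rabs_pos_eq (Im tau)) by lra. unfold Rdiv at 1. rewrite Rabs_mult, Rabs_Ropp, (Rabs_pos_eq (/ 2)) by lra.
  assert (H1 : (2 * Rabs K / Im tau < Rabs (IZR n))%R).
  { rewrite <- abs_IZR. destruct (archimed (2 * Rabs K / Im tau)) as [Hu _].
    eapply Rlt_le_trans; [exact Hu|]. apply IZR_le. lia. }
  apply (Rmult_lt_compat_r (Im tau)) in H1; [|exact Htau].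
  replace (2 * Rabs K / Im tau * Im tau)%R with (2 * Rabs K)%R in H1 by (field; lra).
  pose proof (Rle_abs K). lra.
Qed.

Lemma S_term_Zsum : gf_Zsum S_term (fun phi => ZSeries (fun l' => S_term l' phi)).
Proof.
  intros phi Hphi. destruct (lattice_line_support phi Hphi) as [N HN].
  assert (H : forall n, (Z.of_nat N <= Z.abs n)%Z -> S_term n phi = 0).
  { intros n Hn. unfold S_term. rewrite HN by exact Hn. ring. }
  rewrite (ZSeries_Zrange _ N H). apply has_sum_finite; [apply NoDup_Zrange|].
  intros n Hn. apply H. rewrite in_Zrange in Hn. lia.
Qed.

(** On the support [2 * zd = l - l' * tau] both sides are exponentials whose exponents agree as
    rational expressions in [tau]; the scalar |tau| / (-i tau) is the Jacobian divided by the factor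
    from [eta_inversion_sqr]. The left side carries the index [- l'] because [ch_Pi_inversion]
    reverses the order of summation. *)
Lemma S_coeff_automorphy (l' : Z) :
  Cmod tau * (cis2pi (za / tau * ZtoC (l - 1)) * cis2pi (- (k * ZtoC l * (- (1 / tau)) / 3))
    / dedekind_eta (- (1 / tau)) ^ 2 * cis2pi (ZtoC (- l') * nu)) =
  S_coeff l' * automorphy k za ((ZtoC l - ZtoC l' * tau) / 2) tau.
Proof.
  pose proof (upper_half_neq_0 tau Htau) as Ht. pose proof (dedekind_eta_neq_0 tau Htau) as He.
  assert (HCi : Ci <> 0) by (intros E; injection E; lra).
  set (zd := (ZtoC l - ZtoC l' * tau) / 2).
  assert (HA : automorphy k za zd tau = Cmod tau / (- Ci * tau) *
    cis2pi (2 * za * zd / tau + za * (tau - 1) / tau + - (2 * k * zd * (tau - 1) / (3 * tau)))).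
  { unfold automorphy, cis2pi. rewrite <- !Cmult_assoc. f_equal. rewrite <- !Cexp_plus. f_equal. field. exact Ht. }
  rewrite HA. unfold S_coeff.
  replace (dedekind_eta (- (1 / tau)) ^ 2) with (- Ci * tau * (dedekind_eta tau * dedekind_eta tau))
    by (rewrite <- (eta_inversion_sqr tau Htau); simpl; ring).
  set (D := Cmod tau / (- Ci * tau) / (dedekind_eta tau * dedekind_eta tau)).
  transitivity (D * cis2pi (za / tau * ZtoC (l - 1) + - (k * ZtoC l * (- (1 / tau)) / 3) + ZtoC (- l') * nu)).
  - rewrite !cis2pi_plus. unfold D. field. repeat split; assumption.
  - transitivity (D * cis2pi (ZtoC (l + l') * k / 3 + - (ZtoC l' * nu) + za * ZtoC (l' - 1) + - (k * ZtoC l' * tau / 3)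
      + (2 * za * zd / tau + za * (tau - 1) / tau + - (2 * k * zd * (tau - 1) / (3 * tau))))).
    + f_equal. f_equal. unfold zd. rewrite !ZtoC_sub, ZtoC_plus, ZtoC_opp. change (ZtoC 1) with (RtoC 1). field. exact Ht.
    + rewrite (cis2pi_plus _ (2 * za * zd / tau + za * (tau - 1) / tau + - (2 * k * zd * (tau - 1) / (3 * tau)))).
      rewrite (cis2pi_plus _ (- (k * ZtoC l' * tau / 3))), (cis2pi_plus _ (za * ZtoC (l' - 1))),
        (cis2pi_plus _ (- (ZtoC l' * nu))). unfold D. simpl. field. repeat split; assumption.
Qed.

Lemma ch_Pi_inversion :
  gf_eq (gf_dilate tau (ch_Pi k l nu (za / tau) (- (1 / tau))))
    (gf_mul (fun zd => automorphy k za zd tau) (fun phi => ZSeries (fun l' => S_term l' phi))).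
Proof.
  intros phi Hphi. pose proof (upper_half_neq_0 tau Htau) as Ht.
  destruct (lattice_line_support phi Hphi) as [N HN].
  unfold gf_dilate, gf_mul, ch_Pi, gf_delta, S_term.
  (* Dilation by [tau] sends the delta function of index [- n] in the transformed character to the
     point that supports [S_term n]. *)
  assert (Hpt : forall n, tau * ((ZtoC (- n) - ZtoC l * (- (1 / tau))) / 2) = (ZtoC l - ZtoC n * tau) / 2)
    by (intros n; rewrite ZtoC_opp; field; exact Ht).
  rewrite (ZSeries_Zrange _ N).
  2: { intros n Hn. rewrite <- (Z.opp_involutive n), Hpt, HN by lia. ring. }
  rewrite (ZSeries_Zrange _ N).
  2: { intros n Hn. rewrite HN by exact Hn. ring. }
  rewrite <- list_sum_Zrange_opp, Cmult_assoc, <- list_sum_scal. apply list_sum_ext_in. intros n _.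
  rewrite Hpt, (Cmult_assoc (S_coeff n)), <- S_coeff_automorphy. ring.
Qed.
End STransform.

Theorem proposition4p5 (k : C) (l : Z) (nu : R) :
  Pi_irreducible l nu /\
  is_Pi_character k l nu (ch_Pi k l nu) /\
  (forall za tau : C, (0 < Im tau)%R ->
    exists (I : Z -> gfun) (E : gfun),
      (forall l' : Z,
         gf_circle_integral
           (fun nu' : R => gf_scal (S_Pi k l nu l' nu') (ch_Pi k l' nu' za tau))
           (I l')) /\
      gf_Zsum I E /\
      gf_eq
        (gf_dilate tau (ch_Pi k l nu (za / tau) (- (1 / tau))))
        (gf_mul (fun zd => automorphy k za zd tau) E)).
Proof.
  split; [apply Pi_irreducible_all|]. split; [apply character_Pi|].
  intros za tau Htau.
  exists (S_term k l nu za tau), (fun phi => ZSeries (fun l' => S_term k l nu za tau l' phi)).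
  split; [apply ch_Pi_circle_integral|]. split; [apply S_term_Zsum, Htau|apply ch_Pi_inversion, Htau].
Qed.
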